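(* Let $p\propto\exp(-U)$ be a probability density on $\mathbb{R}^d$ such that $U$ is $\alpha$-weakly convex ($\alpha>0$) and differentiable, $\nabla U$ is $L$-Lipschitz ($L>0$) and dissipative, and $U$ is convex outside a ball. Then for any $\overline\tau\in\big(0,\min\{1/\alpha,1/L\}\big)$ the path $(p_\tau)_{\tau\in[0,\overline\tau]}$, $$p_\tau(x)=\frac{\exp(-M_U^\tau(x))}{\int\exp(-M_U^\tau(y))\,\mathrm{d}y},$$ satisfies the Path Assumption stated in the context on the index set $I=[0,\overline\tau]$.
   Context: $M_U^\tau(x)=\inf_{y\in\mathbb{R}^d}\big(U(y)+\frac{1}{2\tau}|x-y|^2\big)$ for $\tau>0$ is the Moreau envelope, and $M_U^0:=U$. A function $f$ is $\alpha$-weakly convex if $f+\frac{\alpha}{2}|\cdot|^2$ is convex. A function $f$ is convex outside a ball if there is a compact set $K$ such that $f(\lambda x+(1-\lambda)y)\le\lambda f(x)+(1-\lambda)f(y)$ for all $\lambda\in(0,1)$ and all $x,y\in\mathbb{R}^d\setminus K$. A vector field $v:\mathbb{R}^d\to\mathbb{R}^d$ is dissipative with constants $a,b,R>0$ if $\langle x,v(x)\rangle\ge a|x|^2-b\,\mathbf{1}_{B_R(0)}(x)$ for all $x\in\mathbb{R}^d$, where $B_R(0)$ is the open ball of radius $R$ around $0$; it is dissipative if such constants exist. A probability measure $\nu$ satisfies the log-Sobolev inequality (LSI) if there is $C>0$ such that $\int f^2\log\big(f^2/\overline{f^2}\big)\,\mathrm{d}\nu\le C\int|\nabla f|^2\,\mathrm{d}\nu$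 for all $f\in C_c^\infty(\mathbb{R}^d)$, where $\overline{f^2}=\int f^2\,\mathrm{d}\nu$; the smallest such $C$ is the log-Sobolev constant of $\nu$. Path Assumption on an interval $I\subset[0,\infty)$ containing $0$, for probability densities $(p_\tau)_{\tau\in I}$ with $U_\tau:=-\log p_\tau$ and $\pi_\tau(\mathrm{d}x)=p_\tau(x)\,\mathrm{d}x$: (1) $\tau\mapsto U_\tau(x)$ is differentiable and there is $c>0$ with $|\partial_\tau U_\tau(x)|\le c(|x|^2+1)$ for all $x\in\mathbb{R}^d$, $\tau\in I$. (2) $U_\tau$ is differentiable and $\nabla U_\tau$ is $L_\tau$-Lipschitz. (3) For every $\tau\in I$, $\tau>0$, $\nabla U_\tau$ is dissipative with constants $a_\tau,b_\tau,R_\tau>0$. (4) Over $\tau\in I$, $\tau>0$: $\sup L_\tau<\infty$, $\inf a_\tau>0$, $\sup b_\tau<\infty$, $\sup R_\tau<\infty$. (5) Each $\pi_\tau$ satisfies the LSI with constant $C_{\mathrm{LSI}}(\tau)$, and $\sup_{\tau\in I}C_{\mathrm{LSI}}(\tau)<\infty$. *)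

(* Defs.v *)
From HB Require Import structures.
From mathcomp Require Import all_boot all_order all_algebra.
From mathcomp Require Import all_classical all_reals all_analysis.
From mathcomp Require Import measurable_realfun.

Set Implicit Arguments.
Unset Strict Implicit.
Unset Printing Implicit Defensive.

Import Order.TTheory GRing.Theory Num.Theory.
Import numFieldNormedType.Exports.

Local Open Scope classical_set_scope.
Local Open Scope ring_scope.

Section borel_rV.
Context {R : realType} {d : nat}.

Definition borel_rV : set (set 'rV[R]_d) := <<s @open 'rV[R]_d >>.

Let borel0 : borel_rV set0.
Proof. exact: sigma_algebra0. Qed.

Let borelC A : borel_rV A -> borel_rV (~` A).
Proof. exact: sigma_algebraC. Qed.

Let borel_bigcup (F : (set 'rV[R]_d)^nat) :
  (forall i, borel_rV (F i)) -> borel_rV (\bigcup_i (F i)).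
Proof. exact: sigma_algebra_bigcup. Qed.

HB.instance Definition _ :=
  @isMeasurable.Build default_measure_display 'rV[R]_d
    borel_rV borel0 borelC borel_bigcup.

Lemma open_measurable_rV (A : set 'rV[R]_d) : open A -> measurable A.
Proof. by move=> oA; apply: sub_sigma_algebra. Qed.

Lemma measurable_coord (j : 'I_d) :
  measurable_fun [set: 'rV[R]_d] (fun v : 'rV[R]_d => v 0 j).
Proof.
apply: (measurability _ (RGenOpens.measurableE R)).
move=> _ [_ [a [b ->] <-]]; rewrite setTI; apply: open_measurable_rV.
have /continuousP := @coord_continuous R 1 d 0 j; apply; exact: interval_open.
Qed.

Lemma open_bigcup_box (A : set 'rV[R]_d) : open A ->
  A = \bigcup_(ab in [set ab : 'rV[rat]_d * 'rV[rat]_d |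
        [set v : 'rV[R]_d | forall j, v 0 j \in `]ratr (ab.1 0 j), ratr (ab.2 0 j)[]
          `<=` A])
      [set v : 'rV[R]_d | forall j, v 0 j \in `]ratr (ab.1 0 j), ratr (ab.2 0 j)[].
Proof.
move=> oA; apply/seteqP; split => [v Av|v [ab /= sA vab]]; last exact: sA.
have /nbhs_ballP[e /= e0 veA] : nbhs v A by exact: open_nbhs_nbhs.
have ha j : exists q : rat, ratr q \in `]v 0 j - e, v 0 j[.
  by apply: rat_in_itvoo; rewrite ltrBlDr ltrDl.
have hb j : exists q : rat, ratr q \in `]v 0 j, v 0 j + e[.
  by apply: rat_in_itvoo; rewrite ltrDl.
have [a aP] := choice ha; have [b bP] := choice hb.
exists (\row_j a j, \row_j b j) => /= [w wab|j]; last first.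
  rewrite !mxE in_itv/=.
  by move: (aP j) (bP j); rewrite !in_itv/= => /andP[_ ->] /andP[->].
apply: veA; split => // i j; rewrite ord1.
move: (wab j) (aP j) (bP j); rewrite !mxE !in_itv/= => /andP[aw wb].
move=> /andP[ea _] /andP[_ be].
rewrite /ball/= ltr_distlC (lt_trans ea aw)/=.
exact: lt_trans wb be.
Qed.

Lemma measurable_fun_rVP d' (T : measurableType d') (f : T -> 'rV[R]_d) :
  measurable_fun [set: T] f <->
  forall j, measurable_fun [set: T] (fun t => f t 0 j).
Proof.
split=> [mf j|mf].
  exact: (measurableT_comp (measurable_coord j) mf).
apply: (@measurability _ _ _ _ _ _ (@open 'rV[R]_d)) => // _ [A oA <-].
rewrite setTI (open_bigcup_box oA) preimage_bigcup bigcup_mkcond.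
apply: countable_bigcupT_measurable => [|ab].
  exact: countableP.
case: ifPn => _ //.
rewrite (_ : _ @^-1` _ = \bigcap_(j in [set: 'I_d])
   ((fun t => f t 0 j) @^-1` `]ratr (ab.1 0 j), ratr (ab.2 0 j)[)); last first.
  apply/seteqP; split => t /=; first by move=> h j _; exact: h.
  by move=> h j; exact: h.
apply: fin_bigcap_measurable => // j _.
rewrite -[X in measurable X]setTI; apply: mf => //.
Qed.

End borel_rV.

Section lebesgue_rV.
Context {R : realType}.

Definition cons_rV n (xv : measurableTypeR R * 'rV[R]_n) : 'rV[R]_n.+1 :=
  row_mx (const_mx xv.1 : 'rV[R]_1) xv.2.

Lemma measurable_cons_rV n : measurable_fun setT (@cons_rV n).
Proof.
apply/measurable_fun_rVP => j; rewrite /cons_rV.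
case: (@splitP 1 n j) => k jk.
  have -> : j = lshift n k by exact: val_inj.
  rewrite (_ : (fun _ => _) = fst) ; first exact: measurable_fst.
  by apply/funext => xv; rewrite (@row_mxEl _ 1 1 n) mxE.
have -> : j = rshift 1 k by exact: val_inj.
rewrite (_ : (fun _ => _) = (fun v : 'rV[R]_n => v 0 k) \o snd).
  exact: measurableT_comp (measurable_coord k) measurable_snd.
by apply/funext => xv; rewrite (@row_mxEr _ 1 1 n).
Qed.

Section succ.
Context n (m : {sigma_finite_measure set 'rV[R]_n -> \bar R}).

Definition lebesgue_succ : set 'rV[R]_n.+1 -> \bar R :=
  pushforward (lebesgue_measure \x m)%E (@cons_rV n).

Let lebesgue_succ0 : lebesgue_succ set0 = 0%E.
Proof. by rewrite /lebesgue_succ /pushforward preimage_set0 measure0. Qed.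

Let lebesgue_succ_ge0 A : (0 <= lebesgue_succ A)%E.
Proof. by rewrite /lebesgue_succ /pushforward measure_ge0. Qed.

Let lebesgue_succ_sigma_additive : semi_sigma_additive lebesgue_succ.
Proof.
move=> F mF tF mUF; rewrite /lebesgue_succ /pushforward preimage_bigcup.
have mcF k : measurable (@cons_rV n @^-1` F k).
  by rewrite -[X in measurable X]setTI; exact: measurable_cons_rV.
apply: measure_semi_sigma_additive => //.
- apply/trivIsetP => /= i j _ _ ij; rewrite -preimage_setI.
  by move/trivIsetP : tF => /(_ _ _ _ _ ij) ->//; rewrite preimage_set0.
- exact: bigcupT_measurable.
Qed.

HB.instance Definition _ := isMeasure.Build _ _ _ lebesgue_succ
  lebesgue_succ0 lebesgue_succ_ge0 lebesgue_succ_sigma_additive.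

Let lebesgue_succ_sigma_finite : sigma_finite setT lebesgue_succ.
Proof.
pose u (v : 'rV[R]_n.+1) : measurableTypeR R * 'rV[R]_n :=
  (v 0 0, @rsubmx _ 1 1 n v).
have uK xv : u (cons_rV xv) = xv.
  rewrite /u /cons_rV row_mxKr; case: xv => x v /=; congr pair.
  have -> : (0 : 'I_n.+1) = @lshift 1 n 0 by exact: val_inj.
  by rewrite (@row_mxEl _ 1 1 n) mxE.
have mu : measurable_fun setT u.
  apply/measurable_fun_pairP; split => /=.
    exact: measurable_coord.
  apply/measurable_fun_rVP => j /=; under eq_fun do rewrite mxE.
  exact: measurable_coord.
have /sigma_finiteP[G [UG ndG mG]] := sigma_finiteT m.
have /sigma_finiteP[F [UF ndF mF]] := sigma_finiteT (@lebesgue_measure R).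
have mE k : measurable (F k `*` G k).
  by apply: measurableX; [case: (mF k)|case: (mG k)].
exists (fun k => u @^-1` (F k `*` G k)).
  apply/seteqP; split => // v _.
  have [a _ Fa] : (\bigcup_k F k) (u v).1 by rewrite -UF.
  have [b _ Gb] : (\bigcup_k G k) (u v).2 by rewrite -UG.
  exists (maxn a b) => //; split.
    by move: Fa; exact/subsetPset/ndF/leq_maxl.
  by move: Gb; exact/subsetPset/ndG/leq_maxr.
move=> k; split.
  by rewrite -[X in measurable X]setTI; exact: mu.
rewrite /lebesgue_succ /pushforward -comp_preimage.
rewrite (_ : u \o _ = id); last by apply/funext => xv /=; rewrite uK.
have [? ?] := mF k; have [? ?] := mG k.
by rewrite preimage_id product_measure1E// lte_mul_pinfty// ge0_fin_numE.
Qed.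

HB.instance Definition _ := Measure_isSigmaFinite.Build _ _ _ lebesgue_succ
  lebesgue_succ_sigma_finite.

End succ.

Fixpoint lebesgue_rV d : {sigma_finite_measure set 'rV[R]_d -> \bar R} :=
  match d with
  | 0 => \d_(0 : 'rV[R]_0)
  | n.+1 => lebesgue_succ (lebesgue_rV n)
  end.

End lebesgue_rV.

Lemma lebesgue_rV_box (R : realType) d (A : 'I_d -> set R) :
  (forall j, measurable (A j)) ->
  lebesgue_rV d [set v | forall j, A j (v 0 j)] =
  (\prod_(j < d) lebesgue_measure (A j))%E.
Proof.
elim: d A => [|n IH] A mA.
  by rewrite big_ord0 /= diracE mem_set// => -[].
rewrite big_ord_recl -IH// /= /lebesgue_succ /pushforward.
rewrite (_ : _ @^-1` _ =
    A ord0 `*` [set v : 'rV[R]_n | forall j, A (lift ord0 j) (v 0 j)]).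
  rewrite product_measure1E//; first exact: mA.
  rewrite (_ : [set v | _] = \bigcap_(j in [set: 'I_n])
     ((fun v : 'rV[R]_n => v 0 j) @^-1` A (lift ord0 j))); last first.
    by apply/seteqP; split => v /= h j; [move=> _; exact: h|exact: h].
  apply: fin_bigcap_measurable => // j _; rewrite -[X in measurable X]setTI.
  exact: measurable_coord.
have E0 (xv : measurableTypeR R * 'rV[R]_n) : cons_rV xv 0 ord0 = xv.1.
  have -> : (ord0 : 'I_n.+1) = @lshift 1 n 0 by exact: val_inj.
  by rewrite (@row_mxEl _ 1 1 n) mxE.
have ES (xv : measurableTypeR R * 'rV[R]_n) j :
    cons_rV xv 0 (lift ord0 j) = xv.2 0 j.
  have -> : (lift ord0 j : 'I_n.+1) = @rshift 1 n j by exact: val_inj.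
  by rewrite (@row_mxEr _ 1 1 n).
apply/seteqP; split => xv /=.
  by move=> h; split=> [|j /=]; [rewrite -E0|rewrite -ES]; exact: h.
move=> [h0 h] j; case: (unliftP ord0 j) => [k ->|->]; last by rewrite E0.
by rewrite ES; exact: h.
Qed.

Section euclidean.
Context {R : realType} {d : nat}.
Implicit Types (x y : 'rV[R]_d) (f U : 'rV[R]_d -> R) (v : 'rV[R]_d -> 'rV[R]_d).

Definition dotv x y : R := \sum_(j < d) x 0 j * y 0 j.

(* The library norm [`|x|] of a row vector is the sup norm. *)
Definition enorm x : R := Num.sqrt (dotv x x).

Definition partial (j : 'I_d) f x : R := 'D_(delta_mx 0 j) f x.

Definition grad f x : 'rV[R]_d := \row_j partial j f x.

Definition lipschitz_with (L : R) v : Prop :=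
  forall x y, enorm (v x - v y) <= L * enorm (x - y).

Definition dissipative_with (a b r : R) v : Prop :=
  [/\ 0 < a, 0 < b, 0 < r &
    forall x, a * enorm x ^+ 2 - b * \1_[set z | enorm z < r] x <= dotv x (v x)].

Definition dissipative v : Prop := exists a b r, dissipative_with a b r v.

Definition weakly_convex (alpha : R) f : Prop :=
  convex_function [set: convex_lmodType 'rV[R]_d]
    (fun x => f x + alpha / 2 * enorm x ^+ 2).

Definition convex_outside_ball f : Prop :=
  exists2 K : set 'rV[R]_d, compact K &
    forall (lambda : R) x y, 0 < lambda < 1 -> ~ K x -> ~ K y ->
      f (lambda *: x + (1 - lambda) *: y)
        <= lambda * f x + (1 - lambda) * f y.

(* The real-valued [inf] of a set that is not bounded below is [0], so for
   [tau != 0] this is the Moreau envelope only where the latter is finite. *)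
Definition moreau U (tau : R) x : R :=
  if tau == 0 then U x
  else inf (range (fun y => U y + (2 * tau)^-1 * enorm (x - y) ^+ 2)).

(* [foldr partial f s] is the iterated partial derivative of [f] along the
   multi-index [s]. *)
Definition smooth f : Prop :=
  forall s : seq 'I_d,
    continuous (foldr partial f s) /\
    forall x (j : 'I_d), derivable (foldr partial f s) x (delta_mx 0 j).

Definition compactly_supported f : Prop :=
  compact (closure [set x | f x != 0]).

Definition is_density (p : 'rV[R]_d -> R) : Prop :=
  [/\ measurable_fun setT p, forall x, 0 <= p x &
    (\int[lebesgue_rV d]_x (p x)%:E = 1)%E].

Definition has_density (nu : probability 'rV[R]_d R) (p : 'rV[R]_d -> R) : Prop :=
  forall A, measurable A -> nu A = (\int[lebesgue_rV d]_(x in A) (p x)%:E)%E.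

(* As [ln 0 = 0] and [0^-1 = 0], the integrand on the left is [0] where
   [f x = 0], which is the usual convention [0 log 0 = 0]. *)
Definition lsi_with (nu : probability 'rV[R]_d R) (C : R) : Prop :=
  forall f, smooth f -> compactly_supported f ->
    let m := \int[nu]_y (f y ^+ 2) in
    (\int[nu]_x (f x ^+ 2 * ln (f x ^+ 2 / m))%:E
      <= C%:E * \int[nu]_x (enorm (grad f x) ^+ 2)%:E)%E.

Definition lsi_constants (nu : probability 'rV[R]_d R) : set R :=
  [set C | 0 < C /\ lsi_with nu C].

Definition satisfies_lsi (nu : probability 'rV[R]_d R) : Prop :=
  lsi_constants nu !=set0.

(* The least element of [lsi_constants nu] whenever there is one. *)
Definition lsi_constant (nu : probability 'rV[R]_d R) : R :=
  inf (lsi_constants nu).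

(* [t^'] is the punctured neighbourhood filter: this is a two-sided derivative
   in the interior of [I] and a one-sided one at its endpoints. *)
Definition is_derive_within (I : set R) (g : R -> R) (t l : R) : Prop :=
  (g s - g t) / (s - t) @[s --> within I t^'] --> l.

Definition potential (p : R -> 'rV[R]_d -> R) (tau : R) x : R := - ln (p tau x).

Record path_assumption (I : set R) (p : R -> 'rV[R]_d -> R) : Prop := {
  path_interval : [/\ is_interval I, I `<=` [set tau | 0 <= tau] & I 0] ;
  path_density : forall tau, I tau ->
    is_density (p tau) /\ forall x, 0 < p tau x ;
  path_time : exists2 dU : R -> 'rV[R]_d -> R,
    (forall tau x, I tau ->
       is_derive_within I (fun s => potential p s x) tau (dU tau x)) &
    exists2 c : R, 0 < c &
      forall tau x, I tau -> `|dU tau x| <= c * (enorm x ^+ 2 + 1) ;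
  path_space : exists L a b r : R -> R,
    let Ipos := I `&` [set tau | 0 < tau] in
    [/\ forall tau, I tau ->
          (forall x, differentiable (potential p tau) x) /\
          lipschitz_with (L tau) (grad (potential p tau)),
        forall tau, Ipos tau ->
          dissipative_with (a tau) (b tau) (r tau) (grad (potential p tau)) &
        [/\ has_ubound (L @` Ipos),
            exists2 a0, 0 < a0 & lbound (a @` Ipos) a0,
            has_ubound (b @` Ipos) &
            has_ubound (r @` Ipos)]] ;
  path_lsi : exists pi : R -> probability 'rV[R]_d R,
    [/\ forall tau, I tau -> has_density (pi tau) (p tau),
        forall tau, I tau -> satisfies_lsi (pi tau) &
        has_ubound [set lsi_constant (pi tau) | tau in I]]
}.

Definition moreau_path U (tau : R) x : R :=
  expR (- moreau U tau x) / \int[lebesgue_rV d]_y expR (- moreau U tau y).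

End euclidean.

(* Main.v *)
Require Import Defs.
From HB Require Import structures.
From mathcomp Require Import all_boot all_order all_algebra.
From mathcomp Require Import all_classical all_reals all_analysis.
From mathcomp Require Import measurable_realfun ring lra.
Import Order.TTheory GRing.Theory Num.Theory.
Import numFieldNormedType.Exports.
Local Open Scope classical_set_scope.
Local Open Scope ring_scope.

Set Implicit Arguments.
Unset Strict Implicit.
Unset Printing Implicit Defensive.

(* As [L * t < 1], the map [u |-> grad U (x - t u)] is a contraction; its fixed
   point [u t x] is the gradient at [x] of the Moreau envelope
   [M t x = U (x - t u) + t |u|^2 / 2]. Two-sided quadratic estimates of [M] in
   [x] and in [t] give its derivatives, the latter being [- |u t x|^2 / 2], and
   Gaussian domination carries them over to the normalising constant.
   Dissipativity of [grad U] passes to [u t] with uniform constants.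

   The log-Sobolev inequality holds for every density [exp (- V)] with [V] and
   [grad V] of at most quadratic growth and [grad V] dissipative, with a constant
   that depends on the bounds only. On a large box, tensorization of a
   one-dimensional inequality bounds the entropy of a positive function [F] by
   the integral of [|grad F|]; for [F = f^2 exp (- V)] this is a defective
   log-Sobolev inequality up to second moments. A Lyapunov argument, integrating
   the divergence of [x f^2 exp (- V)], controls the second moments and, with the
   Poincare inequality of a box, yields a weighted Poincare inequality. A
   pointwise variant of Rothaus' lemma then removes the defect. *)

(** The log-Sobolev constant has to be bounded uniformly in the time parameter, so
    [lsi_of_potential] fixes its constant before the potential, and every estimate leading to it
    depends on [V] through [a], [b], [A] only. The entropy bound costs a defect of the form of an
    integral of [f ^+ 2 * (1 + dotv x x)], because [V] and its gradient are only known to grow at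
    most quadratically; this is why the Poincare inequality has to carry a weight. It is applied to
    [f - c], which is no longer compactly supported, so the argument runs on large boxes, where
    continuous functions are integrable, and pays for the mass outside the box. The integrand [f ^+
    2 * (ln (f ^+ 2) - ln t) - f ^+ 2 + t] is nonnegative, and its integral against a probability is
    at least the entropy for every [t > 0]; hence integrands can be compared at a convenient [t].
    For the envelope, the variable [u = (x - y) / t] in place of the proximal point [y] turns
    [|x - y|^2 / (2t)] into [t |u|^2 / 2]; the estimates then do not divide by [t] and include
    [t = 0]. *)

(** * Bounded measurable functions on a set of finite measure *)

Section bounded_measurable.
Context {disp} {T : measurableType disp} {R : realType}.
Implicit Types (D : set T) (f g : T -> R).

Definition bounded_on D f := exists K, forall x, D x -> `|f x| <= K.

(** Stable under algebraic operations and sufficient for integrability on a set of finite measure,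
    so the integrability side conditions on boxes become syntactic. *)
Definition bmfun D f := measurable_fun D f /\ bounded_on D f.

Lemma bmfun_cst D (c : R) : bmfun D (fun=> c).
Proof. by split; [exact: measurable_cst|exists `|c|]. Qed.

Lemma bmfunD D f g : bmfun D f -> bmfun D g -> bmfun D (fun x => f x + g x).
Proof.
move=> [mf [K fK]] [mg [M gM]]; split; first exact: measurable_funD.
by exists (K + M) => x Dx; rewrite (le_trans (ler_normD _ _))// lerD// ?fK ?gM.
Qed.

Lemma bmfunM D f g : bmfun D f -> bmfun D g -> bmfun D (fun x => f x * g x).
Proof.
move=> [mf [K fK]] [mg [M gM]]; split; first exact: measurable_funM.
by exists (K * M) => x Dx; rewrite normrM ler_pM// ?fK ?gM.
Qed.

Lemma bmfunN D f : bmfun D f -> bmfun D (fun x => - f x).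
Proof.
move=> [mf [K fK]]; split; first exact: measurableT_comp.
by exists K => x Dx; rewrite normrN fK.
Qed.

Lemma bmfunB D f g : bmfun D f -> bmfun D g -> bmfun D (fun x => f x - g x).
Proof. by move=> bf bg; apply: bmfunD => //; exact: bmfunN. Qed.

Lemma bmfun_norm D f : bmfun D f -> bmfun D (fun x => `|f x|).
Proof.
move=> [mf [K fK]]; split; first exact: measurableT_comp.
by exists K => x Dx; rewrite normr_id fK.
Qed.

Lemma bmfunX D f n : bmfun D f -> bmfun D (fun x => f x ^+ n).
Proof.
move=> bf; elim: n => [|n IH]; first exact: bmfun_cst.
by under eq_fun do rewrite exprS; exact: bmfunM.
Qed.

Lemma bmfun_sum D n (f : 'I_n -> T -> R) :
  (forall i, bmfun D (f i)) -> bmfun D (fun x => \sum_(i < n) f i x).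
Proof.
elim: n f => [|n IH] f bf.
  by under eq_fun do rewrite big_ord0; exact: bmfun_cst.
by under eq_fun do rewrite big_ord_recl; apply: bmfunD => //; exact: IH.
Qed.

Lemma bmfun_ln D f (k : R) : 0 < k -> (forall x, D x -> k <= f x) ->
  bmfun D f -> bmfun D (fun x => ln (f x)).
Proof.
move=> k0 kf [mf [K fK]]; split; first exact: measurableT_comp mf.
exists (`|ln k| + `|ln K|) => x Dx; have fx := kf _ Dx.
have f0 : 0 < f x by exact: lt_le_trans fx.
have fxK : f x <= K by rewrite (le_trans (ler_norm _))// fK.
have K0 : 0 < K by exact: lt_le_trans fxK.
have h1 : ln k <= ln (f x) by rewrite ler_ln ?posrE.
have h2 : ln (f x) <= ln K by rewrite ler_ln ?posrE.
have := ler_norm (ln K); have := ler_norm (- ln k); rewrite normrN.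
have := normr_ge0 (ln K); have := normr_ge0 (ln k).
rewrite ler_norml; lra.
Qed.

Variables (mu : {measure set T -> \bar R}) (D : set T).
Hypotheses (mD : measurable D) (muD : (mu D < +oo)%E).

Lemma bmfun_integrable f : bmfun D f -> mu.-integrable D (EFin \o f).
Proof.
move=> [mf [K fK]]; apply: measurable_bounded_integrable => //.
exists K; split; first by rewrite num_real.
by move=> M KM x /= Dx; exact: le_trans (fK _ Dx) (ltW KM).
Qed.

Lemma le_Rintegral_bm f g : bmfun D f -> bmfun D g ->
  (forall x, D x -> f x <= g x) ->
  \int[mu]_(x in D) f x <= \int[mu]_(x in D) g x.
Proof. by move=> bf bg; apply: le_Rintegral => //; exact: bmfun_integrable. Qed.

Lemma RintegralD_bm f g : bmfun D f -> bmfun D g ->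
  \int[mu]_(x in D) (f x + g x) = \int[mu]_(x in D) f x + \int[mu]_(x in D) g x.
Proof. by move=> bf bg; apply: RintegralD => //; exact: bmfun_integrable. Qed.

Lemma RintegralB_bm f g : bmfun D f -> bmfun D g ->
  \int[mu]_(x in D) (f x - g x) = \int[mu]_(x in D) f x - \int[mu]_(x in D) g x.
Proof. by move=> bf bg; apply: RintegralB => //; exact: bmfun_integrable. Qed.

Lemma RintegralZl_bm f (r : R) : bmfun D f ->
  \int[mu]_(x in D) (r * f x) = r * \int[mu]_(x in D) f x.
Proof. by move=> bf; apply: RintegralZl => //; exact: bmfun_integrable. Qed.

Lemma RintegralZr_bm f (r : R) : bmfun D f ->
  \int[mu]_(x in D) (f x * r) = \int[mu]_(x in D) f x * r.
Proof. by move=> bf; apply: RintegralZr => //; exact: bmfun_integrable. Qed.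

Lemma Rintegral_sum_bm n (f : 'I_n -> T -> R) : (forall i, bmfun D (f i)) ->
  \int[mu]_(x in D) (\sum_(i < n) f i x) = \sum_(i < n) \int[mu]_(x in D) f i x.
Proof.
elim: n f => [|n IH] f bf.
  rewrite big_ord0; under eq_Rintegral do rewrite big_ord0.
  by rewrite Rintegral_cst// mul0r.
rewrite big_ord_recl -IH// -RintegralD_bm//; last exact: bmfun_sum.
by apply: eq_Rintegral => x _; rewrite big_ord_recl.
Qed.

Lemma norm_Rintegral_bm f (K : R) : (forall x, D x -> `|f x| <= K) ->
  measurable_fun D f -> `|\int[mu]_(x in D) f x| <= K * fine (mu D).
Proof.
move=> fK mf; have bf : bmfun D f by split => //; exists K.
rewrite (le_trans (le_normr_Rintegral _ _))//; first exact: bmfun_integrable.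
by rewrite -Rintegral_cst//; apply: le_Rintegral_bm => //; [exact: bmfun_norm|exact: bmfun_cst].
Qed.

End bounded_measurable.

(** * Fubini's theorem for bounded functions on a rectangle *)

Section bounded_fubini.
Context {d1 d2} {T1 : measurableType d1} {T2 : measurableType d2} {R : realType}.
Variables (m1 : {sigma_finite_measure set T1 -> \bar R})
  (m2 : {sigma_finite_measure set T2 -> \bar R}) (D1 : set T1) (D2 : set T2).
Hypotheses (mD1 : measurable D1) (mD2 : measurable D2).
Hypotheses (f1 : (m1 D1 < +oo)%E) (f2 : (m2 D2 < +oo)%E).
Variable f : T1 * T2 -> R.
Hypothesis bf : bmfun (D1 `*` D2) f.

Let mD : measurable (D1 `*` D2). Proof. exact: measurableX. Qed.

Lemma product_measure_setX_lty : ((m1 \x m2)%E (D1 `*` D2) < +oo)%E.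
Proof. by rewrite product_measure1E// lte_mul_pinfty// ge0_fin_numE. Qed.

(** Extension by zero, since Fubini's theorem concerns integrals over the whole product; [gF] and
    [gG] check that integrating out one variable commutes with this extension. *)
Let g : T1 * T2 -> \bar R := EFin \o (f \_ (D1 `*` D2)).

Let ig : (m1 \x m2)%E.-integrable setT g.
Proof.
rewrite /g -restrict_EFin; apply/integrable_restrict => //; rewrite setTI.
exact: bmfun_integrable mD product_measure_setX_lty _ bf.
Qed.

Lemma bmfun_section1 x : D1 x -> bmfun D2 (fun y => f (x, y)).
Proof.
move: bf => [mf [K fK]] D1x; split; last by exists K => y D2y; apply: fK.
apply: (measurable_comp mD _ mf); first by move=> _ [y D2y <-].
exact: measurable_funTS (pair1_measurable x).
Qed.

Lemma bmfun_section2 y : D2 y -> bmfun D1 (fun x => f (x, y)).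
Proof.
move: bf => [mf [K fK]] D2y; split; last by exists K => x D1x; apply: fK.
apply: (measurable_comp mD _ mf); first by move=> _ [x D1x <-].
exact: measurable_funTS (pair2_measurable y).
Qed.

Let gF : fubini_F m2 g =
  EFin \o ((fun x => \int[m2]_(y in D2) f (x, y)) \_ D1).
Proof.
apply/funext => x; rewrite /fubini_F /g /= patchE; case: ifPn => [|] xD.
  rewrite inE in xD.
  rewrite [RHS](_ : _ = \int[m2]_(y in D2) (f (x, y))%:E)%E; last first.
    by rewrite fineK//; apply: integrable_fin_num => //; apply: bmfun_integrable => //; exact: bmfun_section1.
  rewrite [RHS]integral_mkcond; apply: eq_integral => y _.
  rewrite !patchE; case: ifPn => [|/negP] h1; case: ifPn => [|/negP] h2 //; exfalso.
    by apply: h2; move: h1; rewrite !inE => -[].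
  by apply: h1; move: h2; rewrite !inE => h; split.
rewrite integral0_eq// => y _; rewrite patchE ifN//.
by apply: contra xD; rewrite !inE => -[].
Qed.

Let gG : fubini_G m1 g =
  EFin \o ((fun y => \int[m1]_(x in D1) f (x, y)) \_ D2).
Proof.
apply/funext => y; rewrite /fubini_G /g /= patchE; case: ifPn => [|] yD.
  rewrite inE in yD.
  rewrite [RHS](_ : _ = \int[m1]_(x in D1) (f (x, y))%:E)%E; last first.
    by rewrite fineK//; apply: integrable_fin_num => //; apply: bmfun_integrable => //; exact: bmfun_section2.
  rewrite [RHS]integral_mkcond; apply: eq_integral => x _.
  rewrite !patchE; case: ifPn => [|/negP] h1; case: ifPn => [|/negP] h2 //; exfalso.
    by apply: h2; move: h1; rewrite !inE => -[].
  by apply: h1; move: h2; rewrite !inE => h; split.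
rewrite integral0_eq// => x _; rewrite patchE ifN//.
by apply: contra yD; rewrite !inE => -[].
Qed.

Lemma bmfun_fst (h : T1 -> R) : bmfun D1 h ->
  bmfun (D1 `*` D2) (fun z => h z.1).
Proof.
move=> [mh [K hK]]; split; last by exists K => z [z1 _]; apply: hK.
apply: (measurable_comp mD1 _ mh); first by move=> _ [z [z1 _] <-].
exact: measurable_funTS measurable_fst.
Qed.

Lemma bmfun_snd (h : T2 -> R) : bmfun D2 h ->
  bmfun (D1 `*` D2) (fun z => h z.2).
Proof.
move=> [mh [K hK]]; split; last by exists K => z [_ z2]; apply: hK.
apply: (measurable_comp mD2 _ mh); first by move=> _ [z [_ z2] <-].
exact: measurable_funTS measurable_snd.
Qed.

Lemma bmfun_int2 : bmfun D1 (fun x => \int[m2]_(y in D2) f (x, y)).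
Proof.
split.
  have := measurable_fubini_F ig; rewrite gF => /measurable_EFinP.
  by move/(measurable_restrictT _ mD1).
have [_ [K fK]] := bf; exists (K * fine (m2 D2)) => x D1x.
apply: norm_Rintegral_bm => // [y D2y|]; first exact: fK.
by have [] := bmfun_section1 D1x.
Qed.

Lemma bmfun_int1 : bmfun D2 (fun y => \int[m1]_(x in D1) f (x, y)).
Proof.
split.
  have := measurable_fubini_G ig; rewrite gG => /measurable_EFinP.
  by move/(measurable_restrictT _ mD2).
have [_ [K fK]] := bf; exists (K * fine (m1 D1)) => y D2y.
apply: norm_Rintegral_bm => // [x D1x|]; first exact: fK.
by have [] := bmfun_section2 D2y.
Qed.

Lemma Rintegral12 : \int[(m1 \x m2)%E]_(z in D1 `*` D2) f z =
  \int[m1]_(x in D1) \int[m2]_(y in D2) f (x, y).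
Proof.
rewrite Rintegral_mkcond [RHS]Rintegral_mkcond /Rintegral; congr fine.
rewrite -integral12_prod_meas1//.
by rewrite gF.
Qed.

Lemma Rintegral21 : \int[(m1 \x m2)%E]_(z in D1 `*` D2) f z =
  \int[m2]_(y in D2) \int[m1]_(x in D1) f (x, y).
Proof.
rewrite Rintegral_mkcond [RHS]Rintegral_mkcond /Rintegral; congr fine.
rewrite -integral21_prod_meas1//.
by rewrite gG.
Qed.

End bounded_fubini.

(** * Row vectors: continuity and splitting off the first coordinate *)

Section row_vectors.
Context {R : realType}.

Lemma continuous_rV (T : topologicalType) n (f : T -> 'rV[R]_n) :
  (forall j, continuous (fun x => f x 0 j)) -> continuous f.
Proof.
move=> cf x; apply/cvg_ballP => e e0.
have : \forall y \near x, forall j : 'I_n, ball (f x 0 j) e (f y 0 j).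
  by apply: filter_forall => j; move/cvg_ballP : (cf j x); exact.
by apply: filterS => y h; split => // i j; rewrite ord1; exact: h.
Qed.

Lemma continuous_addr (T : topologicalType) (f g : T -> R) :
  continuous f -> continuous g -> continuous (fun x => f x + g x).
Proof. by move=> cf cg x; apply: cvgD; [exact: cf|exact: cg]. Qed.

Lemma continuous_mulr (T : topologicalType) (f g : T -> R) :
  continuous f -> continuous g -> continuous (fun x => f x * g x).
Proof. by move=> cf cg x; apply: cvgM; [exact: cf|exact: cg]. Qed.

Lemma continuous_sumr (T : topologicalType) n (f : 'I_n -> T -> R) :
  (forall i, continuous (f i)) -> continuous (fun x => \sum_(i < n) f i x).
Proof.
elim: n f => [|n IH] f cf.
  by under eq_fun do rewrite big_ord0; exact: cst_continuous.
by under eq_fun do rewrite big_ord_recl; apply: continuous_addr => //; exact: IH.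
Qed.

Lemma continuous_measurable_rV n (f : 'rV[R]_n -> R) :
  continuous f -> measurable_fun setT f.
Proof.
move=> cf; apply: (measurability _ (RGenOpens.measurableE R)).
move=> _ [_ [a [b ->] <-]]; rewrite setTI; apply: open_measurable_rV.
by move/continuousP : cf; apply; exact: interval_open.
Qed.

Lemma cons_rV0 n (t : R) (v : 'rV[R]_n) : cons_rV (t, v) 0 ord0 = t.
Proof.
have -> : (ord0 : 'I_n.+1) = @lshift 1 n 0 by exact: val_inj.
by rewrite (@row_mxEl _ 1 1 n) mxE.
Qed.

Lemma cons_rVS n (t : R) (v : 'rV[R]_n) j :
  cons_rV (t, v) 0 (lift ord0 j) = v 0 j.
Proof.
have -> : (lift ord0 j : 'I_n.+1) = @rshift 1 n j by exact: val_inj.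
by rewrite (@row_mxEr _ 1 1 n).
Qed.

Lemma cons_rVP n (u w : 'rV[R]_n.+1) :
  u 0 ord0 = w 0 ord0 -> (forall j, u 0 (lift ord0 j) = w 0 (lift ord0 j)) ->
  u = w.
Proof.
move=> h0 hS; apply/rowP => j.
by case: (unliftP ord0 j) => [k ->|->].
Qed.

Lemma cons_rV_shift0 n (h t : R) (v : 'rV[R]_n) :
  cons_rV (h *: 1 + t, v) = h *: delta_mx 0 ord0 + cons_rV (t, v).
Proof.
apply: cons_rVP => [|j]; rewrite [in RHS]mxE [in RHS]mxE ?cons_rV0 ?cons_rVS !mxE.
  by rewrite !eqxx mulr1 [_%:A]mulr1.
by rewrite eqxx /= mulr0 add0r.
Qed.

Lemma cons_rV_shiftS n (h t : R) (v : 'rV[R]_n) j :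
  cons_rV (t, h *: delta_mx 0 j + v) =
  h *: delta_mx 0 (lift ord0 j) + cons_rV (t, v).
Proof.
apply: cons_rVP => [|k]; rewrite [in RHS]mxE [in RHS]mxE ?cons_rV0 ?cons_rVS !mxE.
  by rewrite mulr0 add0r.
by rewrite eqxx /= (inj_eq lift_inj).
Qed.

Lemma continuous_cons_rV1 n (v : 'rV[R]_n) :
  continuous (fun t : R => cons_rV (t, v)).
Proof.
apply: continuous_rV => j; case: (unliftP ord0 j) => [k ->|->].
  by under eq_fun do rewrite cons_rVS; exact: cst_continuous.
by under eq_fun do rewrite cons_rV0; move=> x; exact: cvg_id.
Qed.

Lemma continuous_cons_rV2 n (t : R) :
  continuous (fun v : 'rV[R]_n => cons_rV (t, v)).
Proof.
apply: continuous_rV => j; case: (unliftP ord0 j) => [k ->|->].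
  by under eq_fun do rewrite cons_rVS; exact: coord_continuous.
by under eq_fun do rewrite cons_rV0; exact: cst_continuous.
Qed.

(** Along an affine [g] the two difference quotients are literally equal. Partial derivatives thus
    pass to slices and to lines without a chain rule. *)
Lemma derivable_affine (V W : normedModType R) (f : V -> R) (g : W -> V) x v w :
  (forall h : R, g (h *: w + x) = h *: v + g x) ->
  derivable (f \o g) x w = derivable f (g x) v.
Proof.
move=> gE; rewrite /derivable (_ : (fun h => _) =
  (fun h => h^-1 *: ((f \o shift (g x)) (h *: v) - f (g x)))) //.
by apply/funext => h /=; rewrite gE.
Qed.

Lemma derive_affine (V W : normedModType R) (f : V -> R) (g : W -> V) x v w :
  (forall h : R, g (h *: w + x) = h *: v + g x) ->
  'D_w (f \o g) x = 'D_v f (g x).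
Proof.
move=> gE; rewrite /derive; congr lim.
rewrite (_ : (fun h => h^-1 *: ((f \o g \o shift x) (h *: w) - _)) =
  (fun h => h^-1 *: ((f \o shift (g x)) (h *: v) - f (g x)))) //.
by apply/funext => h /=; rewrite gE.
Qed.

End row_vectors.

(** * Functions with continuous partial derivatives *)

Section C1_functions.
Context {R : realType}.

(** Coordinatewise rather than through the differential: this is what [smooth] provides and what
    restriction to slices preserves. Continuity of [f] is a clause of its own, so that it need not
    be derived from the partial derivatives. *)
Definition C1 n (f : 'rV[R]_n -> R) := continuous f /\
  forall j, (forall x, derivable f x (delta_mx 0 j)) /\ continuous (partial j f).

Lemma C1_is_derive n (f : 'rV[R]_n -> R) j x : C1 f ->
  is_derive x (delta_mx 0 j) f (partial j f x).
Proof. by move=> [_ /(_ j)[df _]]; exact: derivableP. Qed.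

Lemma C1P n (f : 'rV[R]_n -> R) (f' : 'I_n -> 'rV[R]_n -> R) :
  continuous f -> (forall j, continuous (f' j)) ->
  (forall j x, is_derive x (delta_mx 0 j) f (f' j x)) ->
  C1 f /\ forall j x, partial j f x = f' j x.
Proof.
move=> cf cf' df; have E j x : partial j f x = f' j x.
  by rewrite /partial; apply: derive_val.
split=> //; split=> // j; split=> [x|]; first exact: ex_derive.
by rewrite (_ : partial j f = f' j) //; apply/funext => x; exact: E.
Qed.

Lemma C1_cst n (c : R) : C1 (fun _ : 'rV[R]_n => c) /\
  forall j x, partial j (fun _ : 'rV[R]_n => c) x = 0.
Proof. by apply: (@C1P _ _ (fun _ _ => 0)) => *; exact: cst_continuous. Qed.

Lemma C1D n (f g : 'rV[R]_n -> R) : C1 f -> C1 g ->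
  C1 (fun x => f x + g x) /\
  forall j x, partial j (fun x => f x + g x) x = partial j f x + partial j g x.
Proof.
move=> Cf Cg; apply: (@C1P _ _ (fun j x => partial j f x + partial j g x)).
- by apply: continuous_addr; [exact: Cf.1|exact: Cg.1].
- by move=> j; apply: continuous_addr; [exact: (Cf.2 j).2|exact: (Cg.2 j).2].
- by move=> j x; apply: is_deriveD; exact: C1_is_derive.
Qed.

Lemma C1M n (f g : 'rV[R]_n -> R) : C1 f -> C1 g ->
  C1 (fun x => f x * g x) /\
  forall j x, partial j (fun x => f x * g x) x =
    f x * partial j g x + g x * partial j f x.
Proof.
move=> Cf Cg.
apply: (@C1P _ _ (fun j x => f x * partial j g x + g x * partial j f x)).
- by apply: continuous_mulr; [exact: Cf.1|exact: Cg.1].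
- move=> j; apply: continuous_addr; apply: continuous_mulr;
    by [exact: Cf.1|exact: Cg.1|exact: (Cf.2 j).2|exact: (Cg.2 j).2].
- move=> j x; have df := C1_is_derive j x Cf; have dg := C1_is_derive j x Cg.
  exact: is_deriveM.
Qed.

Lemma C1_expR n (f : 'rV[R]_n -> R) : C1 f ->
  C1 (fun x => expR (f x)) /\
  forall j x, partial j (fun x => expR (f x)) x = expR (f x) * partial j f x.
Proof.
move=> Cf; have cE : continuous (fun x => expR (f x)).
  by move=> x; apply: continuous_comp; [exact: Cf.1|exact: continuous_expR].
apply: (@C1P _ _ (fun j x => expR (f x) * partial j f x)) => //.
  by move=> j; apply: continuous_mulr; [exact: cE|exact: (Cf.2 j).2].
move=> j x; have df := (Cf.2 j).1 x.
(* The line through [x] in direction [j]: on it the chain rule for real functions of one real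
   variable applies. *)
pose g (h : R) := h *: (delta_mx 0 j : 'rV[R]_n) + x.
have gE (h : R) : g (h *: 1 + 0) = h *: delta_mx 0 j + g 0.
  by rewrite /g scale0r add0r addr0 [h%:A]mulr1.
have g0 : g 0 = x by rewrite /g scale0r add0r.
have d1 : is_derive (0 : R) 1 (f \o g) (partial j f x).
  apply: DeriveDef; first by rewrite (derivable_affine f gE) g0.
  by rewrite (derive_affine f gE) g0.
have d2 : is_derive (0 : R) 1 (expR \o (f \o g)) (expR (f x) * partial j f x).
  apply: is_derive1_comp; rewrite /= g0; exact: is_derive_expR.
have -> : (fun x => expR (f x)) = expR \o f by [].
have d3 : derivable (expR \o f) x (delta_mx 0 j).
  by rewrite -g0 -(derivable_affine (expR \o f) gE); exact: ex_derive.
apply: DeriveDef => //.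
rewrite -[in LHS]g0 -(derive_affine (expR \o f) gE).
by have /@derive_val := d2.
Qed.

Lemma C1_coord n (k : 'I_n) : C1 (fun x : 'rV[R]_n => x 0 k) /\
  forall j x, partial j (fun x : 'rV[R]_n => x 0 k) x = (k == j)%:R.
Proof.
apply: (@C1P _ _ (fun j x => (k == j)%:R)) => [|j|j x].
- exact: coord_continuous.
- exact: cst_continuous.
have lim1 : h^-1 *: (((fun x : 'rV[R]_n => x 0 k) \o shift x) (h *: delta_mx 0 j) - x 0 k)
    @[h --> 0^'] --> ((k == j)%:R : R).
  apply: cvg_near_cst; near=> h; rewrite /= !mxE addrK.
  by rewrite eqxx /= [_ *: _]mulrA mulVf ?mul1r//; near: h; exact: nbhs_dnbhs_neq.
by apply: DeriveDef; [apply/cvg_ex; eexists; exact: lim1|exact/cvg_lim].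
Unshelve. all: by end_near. Qed.

Section slices.
Context {n : nat} (f : 'rV[R]_n.+1 -> R).
Hypothesis Cf : C1 f.

Lemma C1_slice t : C1 (fun v => f (cons_rV (t, v))) /\
  forall j v, partial j (fun v => f (cons_rV (t, v))) v =
    partial (lift ord0 j) f (cons_rV (t, v)).
Proof.
apply: (@C1P _ _ (fun j v => partial (lift ord0 j) f (cons_rV (t, v)))).
- by move=> v; apply: continuous_comp; [exact: continuous_cons_rV2|exact: Cf.1].
- move=> j v; apply: continuous_comp; first exact: continuous_cons_rV2.
  exact: (Cf.2 _).2.
move=> j v; have E (h : R) := cons_rV_shiftS h t v j.
apply: DeriveDef.
  by rewrite (derivable_affine f E); exact: (Cf.2 _).1.
by rewrite (derive_affine f E).
Qed.

Lemma is_derive_slice0 (t : R) (v : 'rV[R]_n) :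
  is_derive t 1 (fun t => f (cons_rV (t, v))) (partial ord0 f (cons_rV (t, v))).
Proof.
have E (h : R) := cons_rV_shift0 h t v.
pose g (s : R) := cons_rV (s, v).
apply: DeriveDef.
  rewrite [X in derivable X](_ : _ = f \o g)// (derivable_affine (g:=g) f E).
  exact: (Cf.2 _).1.
exact: (derive_affine (g:=g) f E).
Qed.

Lemma continuous_slice0 v : continuous (fun t : R => f (cons_rV (t, v))).
Proof.
by move=> t; apply: continuous_comp; [exact: continuous_cons_rV1|exact: Cf.1].
Qed.

Lemma continuous_partial_slice0 v :
  continuous (fun t : R => partial ord0 f (cons_rV (t, v))).
Proof.
move=> t; apply: continuous_comp; first exact: continuous_cons_rV1.
exact: (Cf.2 _).2.
Qed.

End slices.
End C1_functions.

(** * Boxes and iterated integrals over them *)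

Section boxes.
Context {R : realType}.
Implicit Types N : R.

Definition seg N : set (measurableTypeR R) := `[- N, N]%classic.

Definition box n N : set 'rV[R]_n := [set v | forall j, seg N (v 0 j)].

Lemma measurable_seg N : measurable (seg N).
Proof. exact: measurable_itv. Qed.

Lemma compact_seg N : compact (seg N : set R).
Proof. exact: segment_compact. Qed.

Lemma seg_measure N : 0 <= N -> lebesgue_measure (seg N) = (2 * N)%:E.
Proof.
move=> N0; rewrite /seg lebesgue_measure_itv/= lte_fin.
case: ltP => NN; first by rewrite -EFinD; congr EFin; ring.
have -> : N = 0 by lra.
by rewrite mulr0.
Qed.

Lemma seg_measure_lty N : (lebesgue_measure (seg N) < +oo)%E.
Proof.
rewrite /seg lebesgue_measure_itv/=; case: ifPn => // _.
by rewrite -EFinD ltry.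
Qed.

Lemma measurable_box n N : measurable (@box n N).
Proof.
rewrite (_ : @box n N = \bigcap_(j in [set: 'I_n])
   ((fun v : 'rV[R]_n => v 0 j) @^-1` seg N)); last first.
  by apply/seteqP; split => v /= h j; [move=> _; exact: h|exact: h].
apply: fin_bigcap_measurable => // j _; rewrite -[X in measurable X]setTI.
exact: measurable_coord (measurable_seg N).
Qed.

Lemma box_measure n N : 0 <= N -> lebesgue_rV n (box N) = ((2 * N) ^+ n)%:E.
Proof.
move=> N0; rewrite [LHS](@lebesgue_rV_box R n (fun=> seg N) (fun=> measurable_seg N)).
under eq_bigr do rewrite seg_measure//.
by rewrite prodEFin prodr_const card_ord.
Qed.

Lemma box_measure_lty n N : (lebesgue_rV n (box N) < +oo)%E.
Proof.
rewrite [X in (X < _)%E](@lebesgue_rV_box R n (fun=> seg N) (fun=> measurable_seg N)).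
under eq_bigr do rewrite -[lebesgue_measure _]fineK ?ge0_fin_numE ?seg_measure_lty//.
by rewrite prodEFin ltry.
Qed.

Lemma compact_box n N : compact (@box n N).
Proof. by apply: (@rV_compact _ _ (fun=> seg N)) => _; exact: compact_seg. Qed.

Lemma box_bounded n N (f : 'rV[R]_n -> R) : continuous f -> bounded_on (box N) f.
Proof.
move=> cf.
have /compact_bounded[M [_ fM]] : compact (f @` (@box n N)).
  by apply: continuous_compact; [exact: continuous_subspaceT|exact: compact_box].
exists (M + 1) => x Bx; apply: (fM (M + 1)); first by rewrite ltrDl ltr01.
by exists x.
Qed.

Lemma bmfun_box n N (f : 'rV[R]_n -> R) : continuous f -> bmfun (box N) f.
Proof.
move=> cf; split; last exact: box_bounded.
by apply: measurable_funTS; exact: continuous_measurable_rV.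
Qed.

Lemma bmfun_seg N (f : R -> R) : continuous f ->
  bmfun (seg N) (f : measurableTypeR R -> R).
Proof.
move=> cf; split.
  by apply: measurable_funTS; exact: continuous_measurable_fun.
have /compact_bounded[M [_ fM]] : compact (f @` (seg N)).
  by apply: continuous_compact; [exact: continuous_subspaceT|exact: compact_seg].
exists (M + 1) => x Bx; apply: (fM (M + 1)); first by rewrite ltrDl ltr01.
by exists x.
Qed.

Lemma cons_rV_box n N : @cons_rV R n @^-1` (box N) = seg N `*` box N.
Proof.
apply/seteqP; split => -[t v] /=.
  move=> h; split; first by have := h ord0; rewrite cons_rV0.
  by move=> j; have := h (lift ord0 j); rewrite cons_rVS.
move=> [h1 h2] j; case: (unliftP ord0 j) => [k ->|->]; last by rewrite cons_rV0.
by rewrite cons_rVS; exact: h2.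
Qed.

Section fubini.
Context {n : nat} {N : R} (f : 'rV[R]_n.+1 -> R).
Hypothesis bf : bmfun (box N) f.

Lemma bmfun_cons : bmfun (seg N `*` box N) (f \o @cons_rV R n).
Proof.
have [mf [K fK]] := bf; split; last first.
  exists K => z; rewrite -cons_rV_box; exact: fK.
apply: (measurable_comp (@measurable_box n.+1 N) _ mf).
  by rewrite -cons_rV_box => _ [z Dz <-].
by apply: measurable_funTS; exact: measurable_cons_rV.
Qed.

(** [lebesgue_rV n.+1] is by construction the image of a product measure under [cons_rV], and the
    preimage of a box is a segment times a box. *)
Lemma Rintegral_cons : \int[lebesgue_rV n.+1]_(x in box N) f x =
  \int[(lebesgue_measure \x lebesgue_rV n)%E]_(z in seg N `*` box N)
    f (cons_rV z).
Proof.
have mB := @measurable_box n.+1 N.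
have mp : measurable (seg N `*` @box n N).
  by apply: measurableX; [exact: measurable_seg|exact: measurable_box].
have memE z : (cons_rV z \in box N) = (z \in seg N `*` @box n N).
  by rewrite -cons_rV_box; apply/idP/idP; rewrite !inE.
rewrite /Rintegral; congr fine; rewrite integral_mkcond.
rewrite [LHS](@integral_pushforward _ _ _ _ _ _ (@measurable_cons_rV _ n)
  (lebesgue_measure \x lebesgue_rV n)%E setT).
- rewrite preimage_setT [RHS]integral_mkcond; apply: eq_integral => z _ /=.
  by rewrite !patchE memE.
- apply/(measurable_restrictT _ mB); apply/measurable_EFinP; exact: bf.1.
- rewrite preimage_setT.
  rewrite (_ : _ \o _ = (EFin \o (f \o @cons_rV R n)) \_ (seg N `*` box N)).
    apply/integrable_restrict => //; rewrite setTI.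
    apply: bmfun_integrable => //; last exact: bmfun_cons.
    by apply: product_measure_setX_lty; [exact: measurable_seg|exact: measurable_box|exact: seg_measure_lty|exact: box_measure_lty].
  apply/funext => z /=.
  by rewrite !patchE memE.
- by [].
Qed.

Lemma box_int12 : \int[lebesgue_rV n.+1]_(x in box N) f x =
  \int[lebesgue_measure]_(t in seg N) \int[lebesgue_rV n]_(v in box N) f (cons_rV (t, v)).
Proof.
rewrite Rintegral_cons; apply: (@Rintegral12 _ _ _ _ R lebesgue_measure (lebesgue_rV n) (seg N) (box N) _ _ _ _ (f \o @cons_rV R n));
  [exact: measurable_seg|exact: measurable_box|exact: seg_measure_lty|exact: box_measure_lty|exact: bmfun_cons].
Qed.

Lemma box_int21 : \int[lebesgue_rV n.+1]_(x in box N) f x =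
  \int[lebesgue_rV n]_(v in box N) \int[lebesgue_measure]_(t in seg N) f (cons_rV (t, v)).
Proof.
rewrite Rintegral_cons; apply: (@Rintegral21 _ _ _ _ R lebesgue_measure (lebesgue_rV n) (seg N) (box N) _ _ _ _ (f \o @cons_rV R n));
  [exact: measurable_seg|exact: measurable_box|exact: seg_measure_lty|exact: box_measure_lty|exact: bmfun_cons].
Qed.

Lemma bmfun_box_int2 :
  bmfun (seg N) (fun t => \int[lebesgue_rV n]_(v in box N) f (cons_rV (t, v))).
Proof.
apply: (@bmfun_int2 _ _ _ _ R lebesgue_measure (lebesgue_rV n) (seg N) (box N) _ _ _ _ (f \o @cons_rV R n));
  [exact: measurable_seg|exact: measurable_box|exact: seg_measure_lty|exact: box_measure_lty|exact: bmfun_cons].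
Qed.

Lemma bmfun_box_int1 :
  bmfun (box N) (fun v => \int[lebesgue_measure]_(t in seg N) f (cons_rV (t, v))).
Proof.
apply: (@bmfun_int1 _ _ _ _ R lebesgue_measure (lebesgue_rV n) (seg N) (box N) _ _ _ _ (f \o @cons_rV R n));
  [exact: measurable_seg|exact: measurable_box|exact: seg_measure_lty|exact: box_measure_lty|exact: bmfun_cons].
Qed.

Lemma bmfun_slice2 t : seg N t -> bmfun (box N) (fun v => f (cons_rV (t, v))).
Proof. by apply: (bmfun_section1 _ _ bmfun_cons);
  [exact: measurable_seg|exact: measurable_box]. Qed.

Lemma bmfun_slice1 v : box N v ->
  bmfun (seg N) (fun t => f (cons_rV (t, v))).
Proof. by apply: (bmfun_section2 _ _ bmfun_cons);
  [exact: measurable_seg|exact: measurable_box]. Qed.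

End fubini.
End boxes.

#[global] Hint Extern 0 (measurable (box _)) => solve [exact: measurable_box] : core.
#[global] Hint Extern 0 (measurable (seg _)) => solve [exact: measurable_seg] : core.
#[global] Hint Extern 0 (is_true (Order.lt _ +oo%E)) =>
  solve [exact: box_measure_lty | exact: seg_measure_lty] : core.

(** * Poincare and entropy inequalities on a segment *)

Section segment_inequalities.
Context {R : realType} (N : R) (N0 : 0 < N).
Variables (f f' : R -> R).
Hypotheses (df : forall x : R, is_derive x 1 f (f' x)) (cf' : continuous f').
Local Notation mu := (@lebesgue_measure R).

Let cf : continuous f.
Proof.
move=> x; apply: differentiable_continuous; apply/derivable1_diffP.
by have := df x => ?; exact: ex_derive.
Qed.

Lemma FTC2_C1 a b : a <= b -> \int[mu]_(x in `[a, b]) f' x = f b - f a.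
Proof.
rewrite le_eqVlt => /predU1P[->|ab].
  by rewrite set_itv1 Rintegral_set1 subrr.
rewrite /Rintegral (@continuous_FTC2 _ f' f)//.
- exact: continuous_subspaceT.
- split.
  + by move=> x _; have := df x => ?; exact: ex_derive.
  + by apply: cvg_at_right_filter; exact: cf.
  + by apply: cvg_at_left_filter; exact: cf.
- by move=> x _; rewrite derive1E; have := df x => ?; rewrite derive_val.
Qed.

Lemma osc_seg x y : seg N x -> seg N y ->
  `|f x - f y| <= \int[mu]_(z in seg N) `|f' z|.
Proof.
wlog xy : x y / y <= x => [hw|] sx sy.
  have /orP[yx|yx] := le_total y x; first exact: hw.
  by rewrite distrC; exact: hw.
rewrite -FTC2_C1//.
have yxN : `[y, x] `<=` seg N.
  apply: subset_itvScc => /=; move: sx sy; rewrite /seg/= !in_itv/=.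
    by move=> _ /andP[].
  by move=> /andP[].
have bf' : bmfun (seg N) f' by exact: bmfun_seg.
have i1 : mu.-integrable (seg N) (EFin \o f').
  exact: bmfun_integrable.
have i2 : mu.-integrable `[y, x] (EFin \o f').
  exact: integrableS i1.
apply: (le_trans (le_normr_Rintegral _ _)) => //.
rewrite /Rintegral fine_le//.
- by apply: integrable_fin_num => //; exact: (integrable_norm i2).
- by apply: integrable_fin_num => //; exact: (integrable_norm i1).
apply: ge0_subset_integral => //.
by apply/measurable_EFinP; apply: measurableT_comp => //; exact: bf'.1.
Qed.

Let mS := @measurable_seg R N.
Let lS := @seg_measure_lty R N.

Lemma fine_seg : fine (mu (seg N)) = 2 * N.
Proof. by rewrite seg_measure// ltW. Qed.

Let NN : 0 < 2 * N. Proof. by rewrite mulr_gt0. Qed.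

Let N2 : 2 * N != 0. Proof. exact: lt0r_neq0. Qed.

(** The deviation from the mean is at most the oscillation, hence at most [J], the integral of
    [|f'|]. One factor [2 * N] comes from Cauchy-Schwarz for [J], the other from the length of the
    segment. *)
Lemma poincare_seg : \int[mu]_(x in seg N)
    (f x - (2 * N)^-1 * \int[mu]_(y in seg N) f y) ^+ 2 <=
  (2 * N) ^+ 2 * \int[mu]_(x in seg N) f' x ^+ 2.
Proof.
have bf := bmfun_seg N cf; have bf' := bmfun_seg N cf'.
set c := _ * _; set J := \int[mu]_(z in seg N) `|f' z|.
set D := \int[mu]_(x in seg N) (f' x ^+ 2).
have J2 : J ^+ 2 <= 2 * N * D.
  (* Cauchy-Schwarz, by integrating the square of [|f'| - q] with [q] the mean of [|f'|]. *)
  pose q := (2 * N)^-1 * J.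
  have : 0 <= \int[mu]_(x in seg N) (f' x ^+ 2 + q ^+ 2 - (2 * q) * `|f' x|).
    apply: Rintegral_ge0 => x _.
    have : 0 <= (`|f' x| - q) ^+ 2 by exact: sqr_ge0.
    rewrite sqrrB real_normK ?num_real//; lra.
  rewrite RintegralB_bm//; last 2 first.
  - by apply: bmfunD; [exact: bmfunX|exact: bmfun_cst].
  - by apply: bmfunM; [exact: bmfun_cst|exact: bmfun_norm].
  rewrite RintegralD_bm//; [|exact: bmfunX|exact: bmfun_cst].
  rewrite Rintegral_cst// RintegralZl_bm//; last exact: bmfun_norm.
  rewrite -/J -/D fine_seg.
  have q2 : q * (2 * N) = J by rewrite /q mulrAC mulVf ?mul1r.
  move=> h; have := mulr_ge0 (ltW NN) h.
  have -> : 2 * N * (D + q ^+ 2 * (2 * N) - 2 * q * J) =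
    2 * N * D + (q * (2 * N)) ^+ 2 - 2 * (q * (2 * N)) * J by ring.
  rewrite q2; have -> : 2 * N * D + J ^+ 2 - 2 * J * J = 2 * N * D - J ^+ 2 by ring.
  by rewrite subr_ge0.
have fc x : seg N x -> (f x - c) ^+ 2 <= 2 * N * D.
  move=> sx; apply: le_trans J2; rewrite -[leLHS]real_normK ?num_real//.
  rewrite lerXn2r ?nnegrE//; first by apply: Rintegral_ge0.
  have -> : f x - c = (2 * N)^-1 * \int[mu]_(y in seg N) (f x - f y).
    rewrite RintegralB_bm//; last exact: bmfun_cst.
    rewrite Rintegral_cst// fine_seg /c; by field; exact: lt0r_neq0.
  rewrite normrM gtr0_norm ?invr_gt0// ler_pdivrMl//.
  apply: (le_trans (le_normr_Rintegral _ _)) => //.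
    by apply: bmfun_integrable => //; apply: bmfunB => //; exact: bmfun_cst.
  rewrite mulrC -fine_seg -Rintegral_cst//; apply: le_Rintegral_bm => //.
  - by apply: bmfun_norm; apply: bmfunB => //; exact: bmfun_cst.
  - exact: bmfun_cst.
  - by move=> y sy; exact: osc_seg.
apply: (@le_trans _ _ (\int[mu]_(x in seg N) (2 * N * D))).
  apply: le_Rintegral_bm => //; last exact: bmfun_cst.
  by apply: bmfunX; apply: bmfunB => //; exact: bmfun_cst.
rewrite Rintegral_cst// fine_seg; lra.
Qed.

Lemma entropy_seg : 1 <= 2 * N -> (forall x, 0 < f x) ->
  \int[mu]_(x in seg N) (f x * ln (f x / \int[mu]_(y in seg N) f y)) <=
  \int[mu]_(x in seg N) `|f' x|.
Proof.
move=> N1 f0; have bf := bmfun_seg N cf; have bf' := bmfun_seg N cf'.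
set m := \int[mu]_(y in seg N) f y; set J := \int[mu]_(z in seg N) `|f' z|.
have [k k0 kf] : exists2 k, 0 < k & forall x, seg N x -> k <= f x.
  have [|c _ h] := @EVT_min R f (- N) N _ (continuous_subspaceT cf); first lra.
  by exists (f c) => // x; exact: h.
have J0 : 0 <= J by apply: Rintegral_ge0.
have m0 : 0 < m.
  apply: (@lt_le_trans _ _ (\int[mu]_(x in seg N) k)).
    by rewrite Rintegral_cst// fine_seg mulr_gt0//; lra.
  by apply: le_Rintegral_bm => //; exact: bmfun_cst.
have fx x : seg N x -> f x <= m + J.
  move=> sx; have : \int[mu]_(y in seg N) f x <= \int[mu]_(y in seg N) (f y + J).
    apply: le_Rintegral_bm => //; [exact: bmfun_cst|by apply: bmfunD => //; exact: bmfun_cst|].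
    move=> y sy; rewrite -lerBlDl; apply: le_trans (osc_seg sx sy); exact: ler_norm.
  rewrite RintegralD_bm//; last exact: bmfun_cst.
  rewrite !Rintegral_cst// fine_seg -/m => h.
  have h2 : (f x - J) * (2 * N) <= m by lra.
  (* Here the length [2 * N] must be at least 1: for positive [f x - J], the bound on
     [(f x - J) * (2 * N)] then bounds [f x - J] itself. *)
  have [|fJ] := leP (f x) J; first lra.
  suff : f x - J <= m by lra.
  by apply: le_trans h2; rewrite ler_peMr//; lra.
have bmm : bmfun (seg N) (fun x => f x * ln (f x / m)).
  apply: bmfunM => //; apply: (@bmfun_ln _ _ _ _ _ (k / m)) => //.
  - by rewrite divr_gt0.
  - by move=> x sx; rewrite ler_pM2r ?invr_gt0// kf.
  - by apply: bmfunM => //; exact: bmfun_cst.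
apply: (@le_trans _ _ (\int[mu]_(x in seg N) (f x * (J / m)))).
  apply: le_Rintegral_bm => //; first by apply: bmfunM => //; exact: bmfun_cst.
  move=> x sx; rewrite ler_pM2l//.
  have := @le_ln1Dx R (f x / m - 1).
  have -> : 1 + (f x / m - 1) = f x / m by ring.
  move=> h.
  apply: le_trans (h _) _; first by rewrite ltrBrDr addNr divr_gt0.
  by rewrite lerBlDr -[1](divff (lt0r_neq0 m0)) -mulrDl ler_pM2r ?invr_gt0// addrC; exact: fx.
by rewrite RintegralZr_bm// -/m mulrCA divff ?mulr1// lt0r_neq0.
Qed.

End segment_inequalities.

(** * Tensorization: entropy, variance and divergence on a box *)

Section box_inequalities.
Context {R : realType} (N : R) (N0 : 0 < N).
Local Notation mu := (@lebesgue_measure R).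
Local Notation B n := (@box R n N).
Local Notation S := (seg N).

Let mS := @measurable_seg R N.
Let lS := @seg_measure_lty R N.
Let mB n := @measurable_box R n N.
Let lB n := @box_measure_lty R n N.
Let mP n : measurable (S `*` B n). Proof. exact: measurableX. Qed.
Let lP n : ((mu \x lebesgue_rV n)%E (S `*` B n) < +oo)%E.
Proof. exact: (product_measure_setX_lty mS (@mB n) lS (@lB n)). Qed.

Let I12 n (h : measurableTypeR R * 'rV[R]_n -> R) (bh : bmfun (S `*` B n) h) :=
  @Rintegral12 _ _ _ _ R mu (lebesgue_rV n) S (B n) mS (@mB n) lS (@lB n) h bh.
Let I21 n (h : measurableTypeR R * 'rV[R]_n -> R) (bh : bmfun (S `*` B n) h) :=
  @Rintegral21 _ _ _ _ R mu (lebesgue_rV n) S (B n) mS (@mB n) lS (@lB n) h bh.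
Local Notation I n h := (\int[(mu \x lebesgue_rV n)%E]_(z in S `*` B n) h z).

Lemma fine_box n : fine (lebesgue_rV n (B n)) = (2 * N) ^+ n.
Proof. by rewrite box_measure// ltW. Qed.

Lemma box0 n : B n 0.
Proof. by move=> j; rewrite /seg /= in_itv/= mxE oppr_le0 ltW. Qed.

Lemma box_gt0_lb n (f : 'rV[R]_n -> R) : continuous f -> (forall x, 0 < f x) ->
  exists2 k, 0 < k & forall x, B n x -> k <= f x.
Proof.
move=> cf f0.
have [||c _ h] := @EVT_min_rV R n f (B n) _ _ (continuous_subspaceT cf).
- by exists 0; exact: box0.
- exact: compact_box.
- by exists (f c) => // x; have := h x; rewrite !inE; apply.
Qed.

Lemma ln_le_subr1 (x : R) : 0 < x -> ln x <= x - 1.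
Proof.
move=> x0; have -> : ln x = ln (1 + (x - 1)) by congr ln; ring.
by apply: le_ln1Dx; rewrite ltrBrDr addNr.
Qed.

(* Pointwise form of the subadditivity of entropy: after integration the last
   two terms cancel. *)
Lemma entropy_subadditive_pt (F E m e : R) : 0 < F -> 0 < E -> 0 < m -> 0 < e ->
  F * (ln F - ln E) <=
  F * (ln F - ln m) + F * (ln F - ln e) + (m * e / E - F).
Proof.
move=> F0 E0 m0 e0.
have h := @ln_le_subr1 (m * e / (E * F)) _.
have {}h : ln m + ln e - ln E - ln F <= m * e / (E * F) - 1.
  have -> : ln m + ln e - ln E - ln F = ln (m * e / (E * F)).
    rewrite ln_div ?posrE ?mulr_gt0// !lnM ?posrE//; ring.
  by apply: h; rewrite divr_gt0 ?mulr_gt0.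
have : F * (ln m + ln e - ln E - ln F) <= F * (m * e / (E * F) - 1).
  by rewrite ler_pM2l.
have -> : F * (m * e / (E * F) - 1) = m * e / E - F.
  by field; rewrite !lt0r_neq0.
lra.
Qed.

Section tensorization.
Context {n : nat} (F : 'rV[R]_n.+1 -> R).
Hypothesis cF : continuous F.
Let bF : bmfun (B n.+1) F. Proof. exact: bmfun_box. Qed.
Let bFc : bmfun (S `*` B n) (F \o @cons_rV R n). Proof. exact: bmfun_cons. Qed.
(** Total mass; [e] and [m] below are the two marginals of [F], all unnormalised. *)
Let E := \int[lebesgue_rV n.+1]_(x in B n.+1) F x.
Let e t := \int[lebesgue_rV n]_(v in B n) F (cons_rV (t, v)).
Let m v := \int[mu]_(t in S) F (cons_rV (t, v)).
Let be0 : bmfun S e. Proof. exact: bmfun_box_int2. Qed.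
Let bm0 : bmfun (B n) m. Proof. exact: bmfun_box_int1. Qed.
Let be : bmfun (S `*` B n) (fun z => e z.1). Proof. by apply: bmfun_fst. Qed.
Let bm : bmfun (S `*` B n) (fun z => m z.2). Proof. exact: (bmfun_snd S (@mB n) bm0). Qed.

Lemma int_marginals : I n (fun z => e z.1 * m z.2) = E * E.
Proof.
rewrite I12; last exact: bmfunM.
under eq_Rintegral => t _.
  rewrite /= RintegralZl_bm// -box_int21// -/E.
  over.
by rewrite RintegralZr_bm// -box_int12.
Qed.

(** One positive lower bound for the mass and both marginals, which keeps their logarithms
    bounded. *)
Lemma marginal_gt0 : (forall x, 0 < F x) ->
  exists2 k, 0 < k &
    [/\ k <= E, forall t, S t -> k <= e t & forall v, B n v -> k <= m v].
Proof.
move=> F0; have [k k0 kF] := box_gt0_lb cF F0.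
have NN (j : nat) : 0 < k * (2 * N) ^+ j by rewrite mulr_gt0// exprn_gt0// mulr_gt0.
(* Masses of the constant [k] on the box, on a slice and on the segment. A minimum is taken because
   [2 * N] may lie on either side of 1. *)
exists (Num.min (k * (2 * N) ^+ n.+1) (Num.min (k * (2 * N) ^+ n) (k * (2 * N) ^+ 1))).
  by rewrite !lt_min !NN.
split=> [|t St|v Bv].
- rewrite ge_min; apply/orP; left; rewrite -fine_box -Rintegral_cst//.
  by apply: le_Rintegral_bm => //; exact: bmfun_cst.
- rewrite !ge_min; apply/orP; right; apply/orP; left.
  rewrite -fine_box -Rintegral_cst//; apply: le_Rintegral_bm => //.
  + exact: bmfun_cst.
  + exact: bmfun_slice2.
  + by move=> v Bv; apply: kF; have : (S `*` B n) (t, v) by []; rewrite -cons_rV_box.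
- rewrite !ge_min; apply/orP; right; apply/orP; right.
  rewrite expr1 -(fine_seg N0) -Rintegral_cst//; apply: le_Rintegral_bm => //.
  + exact: bmfun_cst.
  + exact: bmfun_slice1.
  + by move=> t St; apply: kF; have : (S `*` B n) (t, v) by []; rewrite -cons_rV_box.
Qed.

Lemma entropy_tensor : (forall x, 0 < F x) ->
  \int[lebesgue_rV n.+1]_(x in B n.+1) (F x * (ln (F x) - ln E)) <=
  \int[lebesgue_rV n]_(v in B n) \int[mu]_(t in S)
     (F (cons_rV (t, v)) * (ln (F (cons_rV (t, v))) - ln (m v))) +
  \int[mu]_(t in S) \int[lebesgue_rV n]_(v in B n)
     (F (cons_rV (t, v)) * (ln (F (cons_rV (t, v))) - ln (e t))).
Proof.
move=> F0; have [k k0 [kE ke km]] := marginal_gt0 F0.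
have mPn := @mP n; have lPn := @lP n.
have [k' k'0 kF] := box_gt0_lb cF F0.
have E0 : 0 < E by exact: lt_le_trans kE.
have blF : bmfun (S `*` B n) (fun z => ln (F (cons_rV z))).
  by apply: (bmfun_ln k'0 _ bFc) => z; rewrite -cons_rV_box; exact: kF.
have b1 : bmfun (S `*` B n) (fun z => F (cons_rV z) * (ln (F (cons_rV z)) - ln (m z.2))).
  apply: bmfunM => //; apply: bmfunB => //; apply: (bmfun_ln k0 _ bm).
  by move=> z [_ z2]; exact: km.
have b2 : bmfun (S `*` B n) (fun z => F (cons_rV z) * (ln (F (cons_rV z)) - ln (e z.1))).
  apply: bmfunM => //; apply: bmfunB => //; apply: (bmfun_ln k0 _ be).
  by move=> z [z1 _]; exact: ke.
have b3 : bmfun (S `*` B n) (fun z => e z.1 * m z.2 * E^-1).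
  by apply: bmfunM; [exact: bmfunM|exact: bmfun_cst].
rewrite Rintegral_cons; last first.
  apply: bmfunM => //; apply: bmfunB; last exact: bmfun_cst.
  by apply: (bmfun_ln k'0 _ bF) => x; exact: kF.
rewrite -(I12 b2) -(I21 b1).
rewrite -RintegralD_bm//.
(* A term of integral zero is added: [e * m / E] and [F] both have mass [E]. *)
have -> : I n (fun z => F (cons_rV z) * (ln (F (cons_rV z)) - ln (m z.2)) +
      F (cons_rV z) * (ln (F (cons_rV z)) - ln (e z.1))) =
    I n (fun z => (F (cons_rV z) * (ln (F (cons_rV z)) - ln (m z.2)) +
      F (cons_rV z) * (ln (F (cons_rV z)) - ln (e z.1))) +
      (e z.1 * m z.2 * E^-1 - F (cons_rV z))).
  rewrite [RHS]RintegralD_bm//; [|exact: bmfunD|exact: bmfunB].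
  rewrite [X in _ = _ + X]RintegralB_bm// RintegralZr_bm//; last exact: bmfunM.
  by rewrite int_marginals -Rintegral_cons// -/E mulfK ?lt0r_neq0// subrr addr0.
apply: le_Rintegral_bm => //.
- apply: bmfunM => //; apply: bmfunB => //; exact: bmfun_cst.
- by apply: bmfunD; [exact: bmfunD|exact: bmfunB].
- move=> z [z1 z2]; rewrite [e _ * _]mulrC; apply: entropy_subadditive_pt => //.
    by apply: lt_le_trans (km _ _).
  by apply: lt_le_trans (ke _ _).
Qed.

Let I_m : I n (fun z => m z.2) = 2 * N * E.
Proof.
rewrite I12//.
under eq_Rintegral => t _ do rewrite /= -box_int21//.
by rewrite Rintegral_cst// fine_seg// mulrC.
Qed.

Let I_e : I n (fun z => e z.1) = (2 * N) ^+ n * E.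
Proof.
rewrite I21//.
under eq_Rintegral => t _ do rewrite /= -box_int12//.
by rewrite Rintegral_cst// fine_box mulrC.
Qed.

(** With [X] and [Y] the averages of [F] over one variable and [E'] the full average, the inequality
    [(F - E')^2 <= (F - X)^2 + (F - Y)^2 + 2 (X - E') (Y - E')] holds pointwise, as the difference
    is the square of [F - X - Y + E']. The cross term integrates to zero. *)
Lemma variance_tensor :
  \int[lebesgue_rV n.+1]_(x in B n.+1) (F x - (2 * N) ^- n.+1 * E) ^+ 2 <=
  \int[lebesgue_rV n]_(v in B n) \int[mu]_(t in S)
     (F (cons_rV (t, v)) - (2 * N)^-1 * m v) ^+ 2 +
  \int[mu]_(t in S) \int[lebesgue_rV n]_(v in B n)
     (F (cons_rV (t, v)) - (2 * N) ^- n * e t) ^+ 2.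
Proof.
have mPn := @mP n; have lPn := @lP n.
set W := 2 * N; set V := (2 * N) ^+ n; set E' := _ * E.
have W0 : W != 0 by rewrite lt0r_neq0// mulr_gt0.
have V0 : V != 0 by rewrite expf_neq0.
have b1 : bmfun (S `*` B n) (fun z => (F (cons_rV z) - W^-1 * m z.2) ^+ 2).
  apply: bmfunX; apply: bmfunB => //; apply: bmfunM => //; exact: bmfun_cst.
have b2 : bmfun (S `*` B n) (fun z => (F (cons_rV z) - V^-1 * e z.1) ^+ 2).
  apply: bmfunX; apply: bmfunB => //; apply: bmfunM => //; exact: bmfun_cst.
have bm' : bmfun (S `*` B n) (fun z => W^-1 * m z.2 - E').
  by apply: bmfunB; [apply: bmfunM => //; exact: bmfun_cst|exact: bmfun_cst].
have be' : bmfun (S `*` B n) (fun z => V^-1 * e z.1 - E').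
  by apply: bmfunB; [apply: bmfunM => //; exact: bmfun_cst|exact: bmfun_cst].
have b3 := bmfunM bm' be'.
have b0 : bmfun (B n.+1) (fun x => (F x - E') ^+ 2).
  by apply: bmfunX; apply: bmfunB => //; exact: bmfun_cst.
(* Each factor depends on one variable only and has mean zero. *)
have I0 : I n (fun z => (W^-1 * m z.2 - E') * (V^-1 * e z.1 - E')) = 0.
  transitivity (I n (fun z => (W^-1 * V^-1 * (e z.1 * m z.2) + E' * E') -
      (W^-1 * E' * m z.2 + V^-1 * E' * e z.1))).
    by apply: eq_Rintegral => z _; ring.
  have c (r : R) : bmfun (S `*` B n) (fun=> r) by exact: bmfun_cst.
  rewrite RintegralB_bm//; last 2 first.
  - by apply: bmfunD => //; apply: bmfunM => //; exact: bmfunM.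
  - by apply: bmfunD => //; exact: bmfunM.
  rewrite RintegralD_bm//; last by apply: bmfunM => //; exact: bmfunM.
  rewrite RintegralD_bm//; [|exact: bmfunM|exact: bmfunM].
  rewrite Rintegral_cst// RintegralZl_bm//; last exact: bmfunM.
  rewrite !RintegralZl_bm// int_marginals I_m I_e.
  have -> : fine ((mu \x lebesgue_rV n)%E (S `*` B n)) = W * V.
    by rewrite product_measure1E// fineM ?ge0_fin_numE// fine_box fine_seg.
  rewrite -/W -/V /E' exprS -/V -/W; field; rewrite W0 V0//.
rewrite Rintegral_cons// -(I12 b2) -(I21 b1) -RintegralD_bm//.
have -> : I n (fun z => (F (cons_rV z) - W^-1 * m z.2) ^+ 2 +
     (F (cons_rV z) - V^-1 * e z.1) ^+ 2) =
   I n (fun z => (F (cons_rV z) - W^-1 * m z.2) ^+ 2 +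
     (F (cons_rV z) - V^-1 * e z.1) ^+ 2 +
     2 * ((W^-1 * m z.2 - E') * (V^-1 * e z.1 - E'))).
  have b2' := bmfunM (bmfun_cst (S `*` B n) 2) b3.
  rewrite [RHS]RintegralD_bm//; last exact: bmfunD.
  by rewrite [X in _ = _ + X]RintegralZl_bm// I0 mulr0 addr0.
apply: le_Rintegral_bm => //.
- by have := bmfun_cons b0.
- apply: bmfunD; first exact: bmfunD.
  by apply: bmfunM => //; exact: bmfun_cst.
move=> z _; rewrite -subr_ge0.
have -> : (F (cons_rV z) - W^-1 * m z.2) ^+ 2 +
     (F (cons_rV z) - V^-1 * e z.1) ^+ 2 +
     2 * ((W^-1 * m z.2 - E') * (V^-1 * e z.1 - E')) - (F (cons_rV z) - E') ^+ 2
  = (F (cons_rV z) - W^-1 * m z.2 - V^-1 * e z.1 + E') ^+ 2 by ring.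
exact: sqr_ge0.
Qed.

End tensorization.

Lemma rV0_cst (f : 'rV[R]_0 -> R) x : f x = f 0.
Proof. by congr f; apply/rowP => -[]. Qed.

Lemma Rintegral_box0 (f : 'rV[R]_0 -> R) :
  \int[lebesgue_rV 0]_(x in B 0) f x = f 0.
Proof.
under eq_Rintegral do rewrite rV0_cst.
by rewrite Rintegral_cst// fine_box expr0 mulr1.
Qed.

Lemma bmfun_partial n (f : 'rV[R]_n -> R) j : C1 f -> bmfun (B n) (partial j f).
Proof. by move=> Cf; apply: bmfun_box; exact: (Cf.2 j).2. Qed.

(* One-dimensional case: [F] is at most [m + J], where [m] is the integral of
   [F] and [J] that of [|F'|], and [ln ((m + J) / m) <= J / m]. *)
Lemma entropy_box n (F : 'rV[R]_n -> R) : 1 <= 2 * N -> C1 F ->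
  (forall x, 0 < F x) ->
  \int[lebesgue_rV n]_(x in B n)
    (F x * (ln (F x) - ln (\int[lebesgue_rV n]_(y in B n) F y))) <=
  \sum_(j < n) \int[lebesgue_rV n]_(x in B n) `|partial j F x|.
Proof.
move=> N1; elim: n F => [|n IH] F CF F0.
  by rewrite !Rintegral_box0 subrr mulr0 big_ord0.
apply: (le_trans (entropy_tensor CF.1 F0)); rewrite big_ord_recl; apply: lerD.
  rewrite box_int21; last by apply: bmfun_norm; exact: bmfun_partial.
  have [k k0 [_ _ km]] := marginal_gt0 CF.1 F0.
  have [k' k'0 kF] := box_gt0_lb CF.1 F0.
  have bF := bmfun_box N CF.1.
  apply: le_Rintegral_bm => //.
  - have b1 : bmfun (S `*` B n) (fun z => F (cons_rV z) * (ln (F (cons_rV z)) -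
        ln (\int[mu]_(t in S) F (cons_rV (t, z.2))))).
      apply: bmfunM; first exact: bmfun_cons.
      apply: bmfunB.
        by apply: (bmfun_ln k'0 _ (bmfun_cons bF)) => z; rewrite -cons_rV_box; exact: kF.
      apply: (bmfun_ln k0 _ (bmfun_snd S (@mB n) (bmfun_box_int1 bF))).
      by move=> z [_ z2]; exact: km.
    exact: (@bmfun_int1 _ _ _ _ R mu (lebesgue_rV n) S (B n) mS (@mB n) lS (@lB n) _ b1).
  - exact: (bmfun_box_int1 (bmfun_norm (bmfun_partial ord0 CF))).
  - move=> v Bv.
    have := entropy_seg N0 (fun t => is_derive_slice0 CF t v)
      (@continuous_partial_slice0 _ _ _ CF v) N1 (fun t => F0 _).
    apply: le_trans; rewrite le_eqVlt; apply/orP; left; apply/eqP; apply: eq_Rintegral => t _.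
    by rewrite ln_div ?posrE//; exact: lt_le_trans (km _ Bv).
have bp (j : 'I_n) := bmfun_norm (bmfun_partial (lift ord0 j) CF).
have -> : \sum_(j < n) \int[lebesgue_rV n.+1]_(x in B n.+1)
      `|partial (lift ord0 j) F x| =
    \int[mu]_(t in S) (\sum_(j < n) \int[lebesgue_rV n]_(v in B n)
      `|partial (lift ord0 j) F (cons_rV (t, v))|).
  rewrite Rintegral_sum_bm//; last by move=> j; exact: (bmfun_box_int2 (bp j)).
  by apply: eq_bigr => j _; rewrite box_int12.
have [k k0 [_ ke _]] := marginal_gt0 CF.1 F0.
have [k' k'0 kF] := box_gt0_lb CF.1 F0.
have bF := bmfun_box N CF.1.
apply: le_Rintegral_bm => //.
- have b1 : bmfun (S `*` B n) (fun z => F (cons_rV z) * (ln (F (cons_rV z)) -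
      ln (\int[lebesgue_rV n]_(v in B n) F (cons_rV (z.1, v))))).
    apply: bmfunM; first exact: bmfun_cons.
    apply: bmfunB.
      by apply: (bmfun_ln k'0 _ (bmfun_cons bF)) => z; rewrite -cons_rV_box; exact: kF.
    apply: (bmfun_ln k0 _ (bmfun_fst (B n) mS (bmfun_box_int2 bF))).
    by move=> z [z1 _]; exact: ke.
  exact: (@bmfun_int2 _ _ _ _ R mu (lebesgue_rV n) S (B n) mS (@mB n) lS (@lB n) _ b1).
- by apply: bmfun_sum => j; exact: (bmfun_box_int2 (bp j)).
- move=> t St; have [Ct dt] := C1_slice CF t.
  apply: le_trans (IH _ Ct (fun v => F0 _)) _.
  rewrite le_eqVlt; apply/orP; left; apply/eqP; apply: eq_bigr => j _.
  by apply: eq_Rintegral => v _; rewrite dt.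
Qed.

(** Since the variance is subadditive over the coordinates, the constant [(2 * N) ^+ 2] of the
    segment survives in every dimension. *)
Lemma poincare_box n (F : 'rV[R]_n -> R) : C1 F ->
  \int[lebesgue_rV n]_(x in B n)
    (F x - (2 * N) ^- n * \int[lebesgue_rV n]_(y in B n) F y) ^+ 2 <=
  (2 * N) ^+ 2 * \sum_(j < n) \int[lebesgue_rV n]_(x in B n) (partial j F x ^+ 2).
Proof.
elim: n F => [|n IH] F CF.
  by rewrite !Rintegral_box0 expr0 invr1 mul1r subrr expr0n/= big_ord0 mulr0.
apply: (le_trans (variance_tensor CF.1)); rewrite big_ord_recl mulrDr.
have bF := bmfun_box N CF.1.
have bp j := bmfunX 2 (bmfun_partial j CF).
apply: lerD.
  rewrite box_int21// -RintegralZl_bm//; last exact: (bmfun_box_int1 (bp ord0)).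
  apply: le_Rintegral_bm => //.
  - have b1 : bmfun (S `*` B n) (fun z => (F (cons_rV z) -
        (2 * N)^-1 * (\int[mu]_(t in S) F (cons_rV (t, z.2)))) ^+ 2).
      apply: bmfunX; apply: bmfunB; first exact: bmfun_cons.
      apply: bmfunM; first exact: bmfun_cst.
      exact: (bmfun_snd S (@mB n) (bmfun_box_int1 bF)).
    exact: (@bmfun_int1 _ _ _ _ R mu (lebesgue_rV n) S (B n) mS (@mB n) lS (@lB n) _ b1).
  - by apply: bmfunM; [exact: bmfun_cst|exact: (bmfun_box_int1 (bp ord0))].
  - move=> v Bv; exact: (poincare_seg N0 (fun t => is_derive_slice0 CF t v)
      (@continuous_partial_slice0 _ _ _ CF v)).
have -> : \sum_(j < n) \int[lebesgue_rV n.+1]_(x in B n.+1)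
      (partial (lift ord0 j) F x ^+ 2) =
    \int[mu]_(t in S) (\sum_(j < n) \int[lebesgue_rV n]_(v in B n)
      (partial (lift ord0 j) F (cons_rV (t, v)) ^+ 2)).
  rewrite Rintegral_sum_bm//; last by move=> j; exact: (bmfun_box_int2 (bp (lift ord0 j))).
  by apply: eq_bigr => j _; rewrite box_int12.
have bs : bmfun S (fun t => \sum_(j < n) \int[lebesgue_rV n]_(v in B n)
      (partial (lift ord0 j) F (cons_rV (t, v)) ^+ 2)).
  by apply: bmfun_sum => j; exact: (bmfun_box_int2 (bp (lift ord0 j))).
rewrite -RintegralZl_bm//; apply: le_Rintegral_bm => //.
- have b1 : bmfun (S `*` B n) (fun z => (F (cons_rV z) -
      (2 * N) ^- n * (\int[lebesgue_rV n]_(v in B n) F (cons_rV (z.1, v)))) ^+ 2).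
    apply: bmfunX; apply: bmfunB; first exact: bmfun_cons.
    apply: bmfunM; first exact: bmfun_cst.
    exact: (bmfun_fst (B n) mS (bmfun_box_int2 bF)).
  exact: (@bmfun_int2 _ _ _ _ R mu (lebesgue_rV n) S (B n) mS (@mB n) lS (@lB n) _ b1).
- by apply: bmfunM => //; exact: bmfun_cst.
- move=> t St; have [Ct dt] := C1_slice CF t.
  have h := IH _ Ct.
  under eq_bigr => j _.
    rewrite (_ : Rintegral _ _ _ = \int[lebesgue_rV n]_(v in B n)
      (partial j (fun v => F (cons_rV (t, v))) v ^+ 2)); last first.
      by apply: eq_Rintegral => v _; rewrite dt.
    over.
  exact: h.
Qed.

(* Integration by parts with the boundary term dropped: on the faces of the
   box the outward normal has a nonnegative scalar product with [x]. *)
Lemma Rintegral_box_div_ge0 n (F : 'rV[R]_n -> R) j : C1 F ->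
  (forall x, 0 <= F x) ->
  0 <= \int[lebesgue_rV n]_(x in B n) (F x + x 0 j * partial j F x).
Proof.
elim: n F j => [F []//|n IH] F j CF F0.
have [Cx _] := @C1_coord R _ j.
have bF := bmfun_box N CF.1.
have bH : bmfun (B n.+1) (fun x => F x + x 0 j * partial j F x).
  apply: bmfunD => //; apply: bmfunM; last exact: bmfun_partial.
  exact: (bmfun_box N Cx.1).
case: (unliftP ord0 j) bH => [k ->|->] bH.
  rewrite box_int12//; apply: Rintegral_ge0 => t St.
  have [Ct dt] := C1_slice CF t.
  apply: le_trans (IH _ k Ct (fun v => F0 _)) _.
  rewrite le_eqVlt; apply/orP; left; apply/eqP.
  by apply: eq_Rintegral => v _; rewrite cons_rVS dt.
rewrite box_int21//; apply: Rintegral_ge0 => v Bv.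
under eq_Rintegral => t _ do rewrite cons_rV0.
pose h t := t * F (cons_rV (t, v)).
pose h' t := F (cons_rV (t, v)) + t * partial ord0 F (cons_rV (t, v)).
have dh (t : R) : is_derive t 1 h (h' t).
  have ht := is_derive_slice0 CF t v.
  apply: is_derive_eq; rewrite /h' addrC; congr (_ + _).
  by rewrite /GRing.scale/= mulr1.
have ch : continuous h'.
  apply: continuous_addr; first exact: continuous_slice0.
  apply: continuous_mulr; first by move=> ?; exact: cvg_id.
  exact: continuous_partial_slice0.
have NN : - N <= N by apply: le_trans (ltW N0); rewrite oppr_le0 ltW.
rewrite [leRHS](FTC2_C1 dh ch NN) /h mulNr opprK.
by rewrite addr_ge0// mulr_ge0// ltW.
Qed.

End box_inequalities.

(** The pattern for differences precedes the one for sums, because [f - g] is the sum of [f] and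
    [- g]. *)
Ltac bmfun_tac := repeat match goal with
  | |- bmfun _ _ => assumption
  | |- bmfun _ (fun=> _) => exact: bmfun_cst
  | |- bmfun _ (fun x => @?f x + - @?g x) => apply: (@bmfunB _ _ _ _ f g)
  | |- bmfun _ (fun x => @?f x + @?g x) => apply: (@bmfunD _ _ _ _ f g)
  | |- bmfun _ (fun x => - @?f x) => apply: (@bmfunN _ _ _ _ f)
  | |- bmfun _ (fun x => @?f x * @?g x) => apply: (@bmfunM _ _ _ _ f g)
  | |- bmfun _ (fun x => @?f x ^+ _) => apply: (@bmfunX _ _ _ _ f)
  end.

(** * Pointwise inequalities for the entropy integrand *)

Section pointwise.
Context {R : realType}.

Lemma xlnx_le (u : R) : 0 <= u -> u * ln u - u + 1 <= (u - 1) ^+ 2.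
Proof.
rewrite le_eqVlt => /predU1P[<-|u0]; first by rewrite mul0r; lra.
have : u * ln u <= u * (u - 1) by rewrite ler_pM2l// ln_le_subr1.
rewrite expr2; lra.
Qed.

(* Replaces Rothaus' lemma: it bounds the entropy of [f ^ 2] by that of
   [(f - c) ^ 2] and by the variance, up to multiplicative constants. *)
Lemma rothaus_pt (f c s : R) (g := f - c) (t := c ^+ 2 + s) : 0 < s ->
  f ^+ 2 * (ln (f ^+ 2) - ln t) - f ^+ 2 + t <=
  3 * ((g ^+ 2 + s) * (ln (g ^+ 2 + s) - ln s)) + 24 * g ^+ 2 + 3 * s.
Proof.
move=> s0.
have c2 : 0 <= c ^+ 2 by exact: sqr_ge0.
have g2 : 0 <= g ^+ 2 by exact: sqr_ge0.
have f2 : 0 <= f ^+ 2 by exact: sqr_ge0.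
have st : s <= t by rewrite /t lerDr.
have t0 : 0 < t by exact: lt_le_trans st.
have lst : ln s <= ln t by rewrite ler_ln ?posrE.
have X0 : 0 <= (g ^+ 2 + s) * (ln (g ^+ 2 + s) - ln s).
  apply: mulr_ge0; first lra.
  by rewrite subr_ge0 ler_ln ?posrE//; lra.
(* If [g ^+ 2 <= 4 * t], the quadratic bound [xlnx_le] at [f ^+ 2 / t] suffices: the square of
   [f ^+ 2 - t = 2 c g + g^2 - s] is at most [3 (4 c^2 g^2 + g^4 + s^2)], hence at most
   [t (24 g^2 + 3 s)]. Otherwise [g] dominates [f] and [c], and the logarithms are compared
   directly. *)
have [gt|gt] := leP (g ^+ 2) (4 * t).
  suff : f ^+ 2 * (ln (f ^+ 2) - ln t) - f ^+ 2 + t <= 24 * g ^+ 2 + 3 * s by lra.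
  have h1 : f ^+ 2 * (ln (f ^+ 2) - ln t) - f ^+ 2 + t <= (f ^+ 2 - t) ^+ 2 / t.
    have [->|f20] := eqVneq (f ^+ 2) 0.
      by rewrite mul0r subr0 add0r sub0r sqrrN expr2 mulfK// lt0r_neq0.
    have f2p : 0 < f ^+ 2 by rewrite lt_def f20.
    have := @xlnx_le (f ^+ 2 / t) (ltW (divr_gt0 f2p t0)).
    rewrite ln_div ?posrE// -(ler_pM2l t0).
    have -> : t * (f ^+ 2 / t * (ln (f ^+ 2) - ln t) - f ^+ 2 / t + 1) =
      f ^+ 2 * (ln (f ^+ 2) - ln t) - f ^+ 2 + t by field; exact: lt0r_neq0.
    have -> : t * (f ^+ 2 / t - 1) ^+ 2 = (f ^+ 2 - t) ^+ 2 / t.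
      by field; exact: lt0r_neq0.
    by [].
  apply: le_trans h1 _; rewrite ler_pdivrMr//.
  have -> : f ^+ 2 - t = 2 * c * g + g ^+ 2 - s by rewrite /t /g; ring.
  have h2 : (2 * c * g + g ^+ 2 - s) ^+ 2 <=
      3 * (4 * c ^+ 2 * g ^+ 2 + g ^+ 2 * g ^+ 2 + s * s).
    have : 0 <= (2 * c * g - g ^+ 2) ^+ 2 + (2 * c * g + s) ^+ 2 + (g ^+ 2 + s) ^+ 2.
      by rewrite !addr_ge0// sqr_ge0.
    rewrite !expr2; lra.
  have h3 : c ^+ 2 * g ^+ 2 <= t * g ^+ 2 by rewrite ler_wpM2r// /t; lra.
  have h4 : g ^+ 2 * g ^+ 2 <= 4 * t * g ^+ 2 by rewrite ler_wpM2r.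
  have h5 : s * s <= s * t by rewrite ler_wpM2l// ltW.
  lra.
have g20 : 0 < g ^+ 2 by lra.
have [ft|ft] := leP (f ^+ 2) t.
  have : f ^+ 2 * (ln (f ^+ 2) - ln t) <= 0.
    have [->|f20] := eqVneq (f ^+ 2) 0; first by rewrite mul0r.
    have f2p : 0 < f ^+ 2 by rewrite lt_def f20.
    by rewrite pmulr_rle0// subr_le0 ler_ln ?posrE.
  lra.
have f2p : 0 < f ^+ 2 by exact: lt_trans ft.
(* From [f^2 <= 2 c^2 + 2 g^2] and [c^2 <= t < g^2 / 4]. The [3 / 2] further on bounds
   [ln (5 / 2)]. *)
have fg : f ^+ 2 <= 5 / 2 * g ^+ 2.
  have : f ^+ 2 <= 2 * c ^+ 2 + 2 * g ^+ 2.
    have : 0 <= (c - g) ^+ 2 by exact: sqr_ge0.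
    have -> : f = c + g by rewrite /g; ring.
    rewrite !expr2; lra.
  rewrite /t in gt; lra.
have lg : ln (g ^+ 2) <= ln (g ^+ 2 + s) by rewrite ler_ln ?posrE//; lra.
have lf : ln (f ^+ 2) <= ln (g ^+ 2 + s) + 3 / 2.
  have : ln (f ^+ 2) <= ln (5 / 2 * g ^+ 2) by rewrite ler_ln ?posrE//; lra.
  have p52 : 0 < 5 / 2 :> R by lra.
  rewrite (@lnM _ (5 / 2)) ?posrE//; have := ln_le_subr1 p52; lra.
have l0 : 0 <= ln (f ^+ 2) - ln t by rewrite subr_ge0 ler_ln ?posrE// ltW.
have h1 : f ^+ 2 * (ln (f ^+ 2) - ln t) <= 5 / 2 * g ^+ 2 * (ln (f ^+ 2) - ln t).
  by rewrite ler_wpM2r.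
have h2 : 5 / 2 * g ^+ 2 * (ln (f ^+ 2) - ln t) <=
    5 / 2 * g ^+ 2 * (ln (g ^+ 2 + s) - ln s + 3 / 2).
  by rewrite ler_wpM2l//; lra.
have h3 : g ^+ 2 * (ln (g ^+ 2 + s) - ln s) <=
   (g ^+ 2 + s) * (ln (g ^+ 2 + s) - ln s).
  have : ln s <= ln (g ^+ 2 + s) by rewrite ler_ln ?posrE//; lra.
  by move=> ?; rewrite ler_wpM2r//; lra.
lra.
Qed.

Lemma xlnx_ge (u : R) : 0 <= u -> u - 1 <= u * ln u.
Proof.
rewrite le_eqVlt => /predU1P[<-|u0]; first by rewrite mul0r; lra.
have := @ln_le_subr1 R u^-1; rewrite invr_gt0 lnV ?posrE// => /(_ u0) h.
have : u * - ln u <= u * (u^-1 - 1) by rewrite ler_pM2l.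
rewrite mulrBr divff; last exact: lt0r_neq0.
lra.
Qed.

(** The tangent inequality of [x ln x] at [t]. It allows the entropy to be computed with any
    reference level [t] in place of the mean [m]. *)
Lemma xlnx_sub_ge (m t : R) : 0 <= m -> 0 < t -> m - t <= m * ln m - m * ln t.
Proof.
move=> + t0; rewrite le_eqVlt => /predU1P[<-|m0]; first by rewrite !mul0r; lra.
have h := ln_le_subr1 (divr_gt0 t0 m0); rewrite ln_div ?posrE// in h.
have : m * (ln t - ln m) <= m * (t / m - 1) by rewrite ler_pM2l.
have -> : m * (t / m - 1) = t - m by field; exact: lt0r_neq0.
lra.
Qed.

(** Unlike [bmfun_ln], this admits zeros of [h]: [u * ln u] lies between the polynomials of
    [xlnx_ge] and [xlnx_le], also at [u = 0]. *)
Lemma bmfun_xlnx disp (T : measurableType disp) (D : set T) (h : T -> R) :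
  (forall x, D x -> 0 <= h x) -> bmfun D h -> bmfun D (fun x => h x * ln (h x)).
Proof.
move=> h0 [mh [K hK]]; split.
  by apply: measurable_funM => //; exact: measurableT_comp mh.
exists (1 + K ^+ 2 + K) => x Dx; have h0x := h0 _ Dx.
have hx : h x <= K by have := hK _ Dx; rewrite ger0_norm.
have h2 : h x ^+ 2 <= K ^+ 2 by rewrite lerXn2r ?nnegrE//; lra.
have l1 := xlnx_le h0x; have l2 := xlnx_ge h0x.
rewrite ler_norml; apply/andP; split; rewrite ?sqrrB in l1; rewrite ?expr2 in l1 h2 *; nra.
Qed.

End pointwise.

(** * Log-Sobolev inequality for a Gibbs density on large boxes *)

Section gibbs.
Context {R : realType} {d : nat}.
Variables (a b A : R).
Hypotheses (a0 : 0 < a) (b0 : 0 < b) (A0 : 0 < A).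
Variable V : 'rV[R]_d -> R.
Hypothesis CV : C1 V.
Hypothesis V_lb : forall x, - A <= V x.
Hypothesis V_ub : forall x, V x <= A * (1 + dotv x x).
Hypothesis dV_ub : forall j x, `|partial j V x| <= A * (1 + dotv x x).
Hypothesis V_diss : forall x,
  a * dotv x x - b <= \sum_(j < d) x 0 j * partial j V x.

Local Notation mu := (lebesgue_rV d).
Let p x := expR (- V x).
Let gradsq (f : 'rV[R]_d -> R) x := \sum_(j < d) partial j f x ^+ 2.

Let dot_ge0 (x : 'rV[R]_d) : 0 <= dotv x x.
Proof. by apply: sumr_ge0 => j _; rewrite -expr2 sqr_ge0. Qed.

Let gradsq_ge0 f x : 0 <= gradsq f x.
Proof. by apply: sumr_ge0 => j _; exact: sqr_ge0. Qed.

Let p_gt0 x : 0 < p x. Proof. exact: expR_gt0. Qed.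

Let Cp : C1 p /\ forall j x, partial j p x = - p x * partial j V x.
Proof.
have [CN _] := @C1_cst R d (-1).
have [C1V dNV] := C1M CN CV.
have [Cp dp] := C1_expR C1V.
have pE : p = (fun x => expR (-1 * V x)).
  by apply/funext => x; rewrite /p mulN1r.
rewrite pE; split=> // j x; rewrite dp dNV (@C1_cst R d (-1)).2; ring.
Qed.

Let bp_ (N : R) : bmfun (box N) p. Proof. exact: bmfun_box Cp.1.1. Qed.
Let bV_ (N : R) : bmfun (box N) V. Proof. exact: bmfun_box CV.1. Qed.
Let bdot_ (N : R) : bmfun (box N) (fun x : 'rV[R]_d => dotv x x).
Proof.
apply: bmfun_sum => j; have h := bmfun_box N (@C1_coord R d j).1.1.
exact: bmfunM.
Qed.
Let bgrad_ (N : R) g : C1 g -> bmfun (box N) (gradsq g).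
Proof. by move=> Cg; apply: bmfun_sum => j; apply: bmfunX; exact: bmfun_partial. Qed.

Section one_box.
Variable N : R.
Hypothesis N0 : 0 < N.
Local Notation B := (@box R d N).
Let bp := bp_ N. Let bV := bV_ N. Let bdot := bdot_ N. Let bgrad := @bgrad_ N.

(** The divergence of [x g^2 p] has a nonnegative integral over the box. It equals
    [(d g^2 + 2 g x.grad g - g^2 x.grad V) p]; dissipativity bounds the last term, and Young's
    inequality spends half of the resulting [a |x|^2 g^2] on the middle one. *)
Lemma lyapunov_box g : C1 g ->
  0 <= \int[mu]_(x in B) ((2 / a * gradsq g x -
    g x ^+ 2 * (a / 2 * dotv x x - b - d%:R)) * p x).
Proof.
move=> Cg; have [Cgg dgg] := C1M Cg Cg; have [CH dH] := C1M Cgg Cp.1.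
have bg := bmfun_box N Cg.1; have bgr := bgrad Cg.
have H0 x : 0 <= g x * g x * p x by apply: mulr_ge0; [rewrite -expr2 sqr_ge0|exact: ltW].
have bH j : bmfun B (fun x => g x * g x * p x +
    x 0 j * partial j (fun x => g x * g x * p x) x).
  have h := bmfun_box N (@C1_coord R d j).1.1.
  have h' := bmfun_partial N j CH.
  by bmfun_tac.
apply: (@le_trans _ _ (\int[mu]_(x in B) (\sum_(j < d) (g x * g x * p x +
    x 0 j * partial j (fun x => g x * g x * p x) x)))).
  rewrite Rintegral_sum_bm//; apply: sumr_ge0 => j _.
  exact: Rintegral_box_div_ge0.
apply: le_Rintegral_bm => //; first exact: bmfun_sum.
  by bmfun_tac.
move=> x _.
have E : \sum_(j < d) (g x * g x * p x +
    x 0 j * partial j (fun x => g x * g x * p x) x) =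
  (d%:R * g x ^+ 2 + \sum_(j < d) 2 * (g x * x 0 j) * partial j g x
   - g x ^+ 2 * \sum_(j < d) x 0 j * partial j V x) * p x.
  transitivity (\sum_(j < d) (g x ^+ 2 + 2 * (g x * x 0 j) * partial j g x -
      g x ^+ 2 * (x 0 j * partial j V x)) * p x).
    by apply: eq_bigr => j _; rewrite dH dgg Cp.2; ring.
  rewrite -mulr_suml sumrB big_split/= sumr_const card_ord mulr_natl.
  by rewrite [in RHS]mulr_sumr.
rewrite E ler_pM2r//.
have h1 : \sum_(j < d) 2 * (g x * x 0 j) * partial j g x <=
    a / 2 * (g x ^+ 2 * dotv x x) + 2 / a * gradsq g x.
  rewrite /dotv /gradsq !mulr_sumr -big_split/=; apply: ler_sum => j _.
  rewrite -subr_ge0.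
  have -> : a / 2 * (g x ^+ 2 * (x 0 j * x 0 j)) + 2 / a * partial j g x ^+ 2 -
      2 * (g x * x 0 j) * partial j g x =
    (2 / a) * (a / 2 * (g x * x 0 j) - partial j g x) ^+ 2.
    by field; exact: lt0r_neq0.
  by rewrite mulr_ge0 ?sqr_ge0// divr_ge0// ltW.
have h2 : g x ^+ 2 * (a * dotv x x - b) <=
    g x ^+ 2 * \sum_(j < d) x 0 j * partial j V x.
  by rewrite ler_wpM2l ?sqr_ge0.
lra.
Qed.

Hypothesis p_mass : \int[mu]_(x in B) p x <= 1.

(** This is [lyapunov_box] for the constant function 1. *)
Lemma second_moment_box :
  \int[mu]_(x in B) ((1 + dotv x x) * p x) <= 1 + 2 * (b + d%:R) / a.
Proof.
have [C1c dc] := @C1_cst R d 1.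
have := lyapunov_box C1c.
have -> : (fun x : 'rV[R]_d => (2 / a * gradsq (fun=> 1) x -
    1 ^+ 2 * (a / 2 * dotv x x - b - d%:R)) * p x) =
    (fun x => (a / 2 + b + d%:R) * p x - a / 2 * ((1 + dotv x x) * p x)).
  apply/funext => x; rewrite /gradsq big1; last by move=> j _; rewrite dc expr0n.
  ring.
have c (r : R) : bmfun B (fun=> r) by exact: bmfun_cst.
rewrite RintegralB_bm//; [|by bmfun_tac|by bmfun_tac].
rewrite !RintegralZl_bm//; last by bmfun_tac.
rewrite subr_ge0 => h.
have {h} : a / 2 * \int[mu]_(x in B) ((1 + dotv x x) * p x) <= a / 2 + b + d%:R.
  apply: le_trans h _; rewrite -[leRHS]mulr1 ler_wpM2l//.
  by rewrite addr_ge0// addr_ge0 ?divr_ge0// ltW.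
rewrite -ler_pdivlMl ?divr_gt0//.
move=> h; apply: le_trans h _; rewrite le_eqVlt; apply/orP; left; apply/eqP.
by field; exact: lt0r_neq0.
Qed.

(** [entropy_box] applied to [F = (g^2 + s) p]. The shift by [s] makes [F] positive, and as [s] also
    bounds the weighted norm of [g] and its energy, every term is a multiple of [s]: [I3] for the
    gradient of [F], [I4] for [V] inside [ln F], [I5] for the normalisation. *)
Lemma entropy_gibbs_box (g : 'rV[R]_d -> R) (s : R) : 1 <= 2 * N -> 0 < s -> C1 g ->
  \int[mu]_(x in B) (g x ^+ 2 * (1 + dotv x x) * p x) <= s ->
  \int[mu]_(x in B) (gradsq g x * p x) <= s ->
  \int[mu]_(x in B) ((g x ^+ 2 + s) * (ln (g x ^+ 2 + s) - ln s) * p x) <=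
  (d%:R + 3 + (d%:R + 1) * A * (2 + 2 * (b + d%:R) / a)) * s.
Proof.
move=> N1 s0 Cg hg hD.
have [Cgg dgg] := C1M Cg Cg.
have [Cs ds] := @C1_cst R d s.
have [CG dG] := C1D Cgg Cs.
have [CF dF] := C1M CG Cp.1.
set F := fun x => (g x * g x + s) * p x in CF dF.
have gs x : 0 < g x * g x + s by rewrite ltr_wpDl// -expr2 sqr_ge0.
have F0 x : 0 < F x by rewrite mulr_gt0.
have bg := bmfun_box N Cg.1; have bgr := bgrad Cg; have bF := bmfun_box N CF.1.
have c (r : R) : bmfun B (fun=> r) by exact: bmfun_cst.
have bln : bmfun B (fun x => ln (g x ^+ 2 + s)).
  apply: (bmfun_ln s0); last by bmfun_tac.
  by move=> x _; rewrite lerDr sqr_ge0.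
set M := \int[mu]_(x in B) F x.
have I1 : \int[mu]_(x in B) (g x ^+ 2 * p x) <= s.
  apply: le_trans hg; apply: le_Rintegral_bm => //; [by bmfun_tac|by bmfun_tac|].
  move=> x _; rewrite ler_pM2r// ler_peMr ?sqr_ge0// lerDl; exact: dot_ge0.
have MD : M = \int[mu]_(x in B) (g x ^+ 2 * p x) + s * \int[mu]_(x in B) p x.
  rewrite -RintegralZl_bm// -RintegralD_bm//; [|by bmfun_tac|by bmfun_tac].
  by apply: eq_Rintegral => x _; rewrite /F; ring.
have M2 : M <= 2 * s.
  have : s * \int[mu]_(x in B) p x <= s by rewrite ler_piMr// ltW.
  rewrite MD; lra.
have [k k0 kF] := box_gt0_lb N0 CF.1 F0.
have blF : bmfun B (fun x => ln (F x)) by exact: (bmfun_ln k0 kF).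
have M0 : 0 < M.
  apply: (@lt_le_trans _ _ (\int[mu]_(x in B) k)).
    by rewrite Rintegral_cst// fine_box// mulr_gt0// exprn_gt0// mulr_gt0.
  exact: le_Rintegral_bm.
have I2 : \int[mu]_(x in B) ((g x ^+ 2 + s) * (1 + dotv x x) * p x) <=
    (2 + 2 * (b + d%:R) / a) * s.
  have -> : (fun x : 'rV[R]_d => (g x ^+ 2 + s) * (1 + dotv x x) * p x) =
     (fun x => g x ^+ 2 * (1 + dotv x x) * p x + s * ((1 + dotv x x) * p x)).
    by apply/funext => x; ring.
  rewrite RintegralD_bm//; [|by bmfun_tac|by bmfun_tac].
  rewrite RintegralZl_bm//; last by bmfun_tac.
  have h : s * \int[mu]_(x in B) ((1 + dotv x x) * p x) <= s * (1 + 2 * (b + d%:R) / a).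
    by rewrite ler_pM2l//; exact: second_moment_box.
  lra.
have I3 : \sum_(j < d) \int[mu]_(x in B) `|partial j F x| <=
    (d%:R + 1 + d%:R * A * (2 + 2 * (b + d%:R) / a)) * s.
  have bpF j : bmfun B (fun x => `|partial j F x|).
    by apply: bmfun_norm; exact: bmfun_partial.
  rewrite -Rintegral_sum_bm//.
  apply: (@le_trans _ _ (\int[mu]_(x in B) (d%:R * (g x ^+ 2 * p x) +
     gradsq g x * p x + d%:R * A * ((g x ^+ 2 + s) * (1 + dotv x x) * p x)))).
    apply: le_Rintegral_bm => //; [exact: bmfun_sum|by bmfun_tac|].
    move=> x _.
    have -> : d%:R * (g x ^+ 2 * p x) + gradsq g x * p x +
        d%:R * A * ((g x ^+ 2 + s) * (1 + dotv x x) * p x) =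
      \sum_(j < d) (g x ^+ 2 + partial j g x ^+ 2 +
         A * (g x ^+ 2 + s) * (1 + dotv x x)) * p x.
      rewrite -mulr_suml !big_split/= !sumr_const card_ord -/(gradsq g x).
      by rewrite -(mulr_natl (g x ^+ 2)) -(mulr_natl (_ * _ * (1 + _))); ring.
    apply: ler_sum => j _.
    (* The product [2 * g * partial j g] is split by Young's inequality, and the derivative of [V]
       costs the weight [A * (1 + dotv x x)]. *)
    have -> : partial j F x = (2 * g x * partial j g x -
       (g x ^+ 2 + s) * partial j V x) * p x.
      by rewrite dF dG dgg ds Cp.2; ring.
    rewrite normrM (gtr0_norm (p_gt0 x)) ler_pM2r//.
    apply: le_trans (ler_normB _ _) _; apply: lerD.
      have e1 : 0 <= (g x + partial j g x) ^+ 2 by exact: sqr_ge0.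
      have e2 : 0 <= (g x - partial j g x) ^+ 2 by exact: sqr_ge0.
      by rewrite ler_norml; apply/andP; split; rewrite !expr2 in e1 e2 *; lra.
    rewrite normrM [A * _]mulrC -mulrA ger0_norm; last by rewrite addr_ge0 ?sqr_ge0// ltW.
    by rewrite ler_wpM2l// addr_ge0 ?sqr_ge0// ltW.
  rewrite RintegralD_bm//; [|by bmfun_tac|by bmfun_tac].
  rewrite RintegralD_bm//; [|by bmfun_tac|by bmfun_tac].
  rewrite !RintegralZl_bm//; [|by bmfun_tac|by bmfun_tac].
  have h1 : d%:R * \int[mu]_(x in B) (g x ^+ 2 * p x) <= d%:R * s by rewrite ler_wpM2l.
  have h2 : d%:R * A * \int[mu]_(x in B) ((g x ^+ 2 + s) * (1 + dotv x x) * p x) <=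
     d%:R * A * ((2 + 2 * (b + d%:R) / a) * s) by rewrite ler_wpM2l// mulr_ge0// ltW.
  lra.
have I4 : \int[mu]_(x in B) (F x * V x) <= A * ((2 + 2 * (b + d%:R) / a) * s).
  apply: (@le_trans _ _ (A * \int[mu]_(x in B) ((g x ^+ 2 + s) * (1 + dotv x x) * p x))).
    rewrite -RintegralZl_bm//; last by bmfun_tac.
    apply: le_Rintegral_bm => //; [by bmfun_tac|by bmfun_tac|].
    move=> x _; have : F x * V x <= F x * (A * (1 + dotv x x)) by rewrite ler_pM2l.
    rewrite /F expr2; lra.
  by rewrite ler_pM2l.
have I5 : M * (ln M - ln s) <= 2 * s.
  apply: (@le_trans _ _ (M * 1)); last by rewrite mulr1.
  rewrite ler_pM2l//; have Ms : 0 < M / s by rewrite divr_gt0.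
  rewrite -ln_div ?posrE//; apply: le_trans (ln_le_subr1 Ms) _.
  by rewrite lerBlDr -[1 + 1]/(2 : R) ler_pdivrMr.
have I6 := entropy_box N0 N1 CF F0.
(* As [p = expR (- V)], the logarithm of [F] is [ln (g^2 + s) - V]; moreover the reference level
   changes from [s] to the mass [M]. *)
have -> : (fun x => (g x ^+ 2 + s) * (ln (g x ^+ 2 + s) - ln s) * p x) =
   (fun x => F x * (ln (F x) - ln M) + (F x * (ln M - ln s) + F x * V x)).
  apply/funext => x.
  have -> : ln (F x) = ln (g x ^+ 2 + s) - V x.
    by rewrite /F -expr2 (@lnM _ (g x ^+ 2 + s)) ?posrE// ?expRK// expr2.
  rewrite /F; ring.
rewrite RintegralD_bm//; [|by bmfun_tac|by bmfun_tac].
rewrite RintegralD_bm//; [|by bmfun_tac|by bmfun_tac].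
rewrite RintegralZr_bm// -/M; rewrite -/M in I6.
lra.
Qed.

End one_box.

Lemma bmfun_indic (D Q : set 'rV[R]_d) : measurable Q -> bmfun D (\1_Q : _ -> R).
Proof.
move=> mQ; split; first exact: measurable_indic.
by exists 1 => x _; rewrite indicE; case: (_ \in _); rewrite ?normr1 ?normr0.
Qed.

(** Chosen so that [1 + |x|^2] is everywhere at most [r 1_B + 2 |x|^2 - 4 (b + d) / a], where [B] is
    [box r]: inside [B] the constants leave 1, outside it [|x|^2 >= r^2 >= r]. *)
Let r := 1 + 4 * (b + d%:R) / a.

(** Away from [box r] the Lyapunov estimate controls the weighted norm. On [box r] the density lies
    between the two exponentials in the constant, so the Poincare inequality for Lebesgue measure
    applies. The centre [c] is the mean over [box r], hence the same for all [N]. *)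
Lemma weighted_poincare (f : 'rV[R]_d -> R) : C1 f ->
  exists c : R, forall N, r <= N ->
  \int[mu]_(x in box N) ((f x - c) ^+ 2 * (1 + dotv x x) * p x) <=
  (8 / a ^+ 2 + r * (expR A * (2 * r) ^+ 2 * expR (A * (1 + d%:R * r ^+ 2)))) *
  \int[mu]_(x in box N) (gradsq f x * p x).
Proof.
move=> Cf; set c := (2 * r) ^- d * \int[mu]_(x in box r) f x; exists c => N rN.
have r1 : 1 <= r.
  by rewrite /r lerDl divr_ge0// ?(ltW a0)// mulr_ge0// addr_ge0// ltW.
have r0 : 0 < r by lra.
have N0 : 0 < N by exact: lt_le_trans rN.
have [Cc dc] := @C1_cst R d (- c).
have [Cg dg] := C1D Cf Cc.
set g := fun x => f x - c in Cg dg.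
have gE : gradsq g = gradsq f.
  by apply/funext => x; apply: eq_bigr => j _; rewrite dg dc addr0.
have bg M := bmfun_box M Cg.1; have bgr M := bgrad_ M Cg.
have cst M (k : R) : bmfun (@box R d M) (fun=> k) by exact: bmfun_cst.
have bpN := bp_ N; have bpr := bp_ r; have bdN := bdot_ N; have bgN := bg N.
have bgrN := bgr N; have bgr' := bg r; have bgrr := bgr r.
have bi : bmfun (box N) (\1_(box r) : 'rV[R]_d -> R) by apply: bmfun_indic.
have rN' : box r `<=` @box R d N.
  move=> x h j; have := h j; rewrite /seg/= !in_itv/= => /andP[h1 h2].
  by apply/andP; split; [apply: le_trans h1; rewrite lerN2|exact: le_trans rN].
have Q1 : \int[mu]_(x in box N) (g x ^+ 2 * p x * \1_(box r) x) =
    \int[mu]_(x in box r) (g x ^+ 2 * p x).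
  rewrite -[X in _ = Rintegral _ X _](setIidr rN') Rintegral_mkcondr.
  by apply: eq_Rintegral => x _; rewrite patch_indic.
have Q2 : \int[mu]_(x in box r) (g x ^+ 2 * p x) <=
    expR A * \int[mu]_(x in box r) g x ^+ 2.
  rewrite -RintegralZl_bm//; last by bmfun_tac.
  apply: le_Rintegral_bm => //; [by bmfun_tac|by bmfun_tac|] => x _.
  by rewrite mulrC ler_wpM2r ?sqr_ge0// /p ler_expR lerNl.
have Q3 := poincare_box r0 Cf.
have Q4 : \sum_(j < d) \int[mu]_(x in box r) (partial j f x ^+ 2) <=
    expR (A * (1 + d%:R * r ^+ 2)) * \int[mu]_(x in box N) (gradsq f x * p x).
  have bpj j : bmfun (box r) (fun x => partial j f x ^+ 2).
    by apply: bmfunX; exact: bmfun_partial.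
  rewrite -Rintegral_sum_bm//.
  have bf : bmfun (box r) (gradsq f) by exact: bgrad_.
  have bfN : bmfun (box N) (gradsq f) by exact: bgrad_.
  apply: (@le_trans _ _ (expR (A * (1 + d%:R * r ^+ 2)) *
     \int[mu]_(x in box r) (gradsq f x * p x))).
    rewrite -RintegralZl_bm//; last by bmfun_tac.
    apply: le_Rintegral_bm => //; first by bmfun_tac.
    move=> x Bx; rewrite mulrCA ler_peMr ?gradsq_ge0//.
    rewrite /p -expRD -[leLHS]expR0 ler_expR subr_ge0.
    apply: le_trans (V_ub x) _; rewrite ler_pM2l// lerD2l /dotv.
    have -> : d%:R * r ^+ 2 = \sum_(j < d) r ^+ 2.
      by rewrite sumr_const card_ord mulr_natl.
    apply: ler_sum => j _; rewrite -expr2.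
    have := Bx j; rewrite /seg/= in_itv/= => /andP[h1 h2].
    rewrite -real_normK ?num_real// lerXn2r ?nnegrE// ?(ltW r0)//.
    by rewrite ler_norml h1.
  rewrite ler_pM2l ?expR_gt0//.
  rewrite -[X in Rintegral _ X _ <= _](setIidr rN') Rintegral_mkcondr.
  apply: le_Rintegral_bm => //; last 2 first.
  - by bmfun_tac.
  - move=> x _; rewrite patchE; case: ifPn => // _.
    by rewrite mulr_ge0// ltW.
  rewrite patch_indic; apply: bmfunM => //; by bmfun_tac.
have L := lyapunov_box N0 Cg; rewrite gE in L.
have bfN : bmfun (box N) (gradsq f) by rewrite -gE.
have : \int[mu]_(x in box N) (g x ^+ 2 * (1 + dotv x x) * p x) <=
   8 / a ^+ 2 * \int[mu]_(x in box N) (gradsq f x * p x) +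
   r * \int[mu]_(x in box N) (g x ^+ 2 * p x * \1_(box r) x).
  (* Subtracting [4 / a] times the nonnegative Lyapunov integral, a factor that turns
     [a / 2 * |x|^2] into [2 * |x|^2] and [2 / a] into [8 / a ^+ 2]. *)
  apply: (@le_trans _ _ (\int[mu]_(x in box N) (8 / a ^+ 2 * (gradsq f x * p x) +
      r * (g x ^+ 2 * p x * \1_(box r) x)) - 4 / a *
      \int[mu]_(x in box N) ((2 / a * gradsq f x -
         g x ^+ 2 * (a / 2 * dotv x x - b - d%:R)) * p x))).
    rewrite -RintegralZl_bm//; last by bmfun_tac.
    rewrite -RintegralB_bm//; [|by bmfun_tac|by bmfun_tac].
    apply: le_Rintegral_bm => //; [by bmfun_tac|by bmfun_tac|] => x _.
    have -> : 8 / a ^+ 2 * (gradsq f x * p x) + r * (g x ^+ 2 * p x * \1_(box r) x) -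
      4 / a * ((2 / a * gradsq f x - g x ^+ 2 * (a / 2 * dotv x x - b - d%:R)) * p x) =
      g x ^+ 2 * (r * \1_(box r) x + 2 * dotv x x - 4 * (b + d%:R) / a) * p x.
      by field; exact: lt0r_neq0.
    rewrite ler_pM2r// ler_wpM2l ?sqr_ge0// indicE.
    have dx := dot_ge0 x.
    have [Bx|Bx] := boolP (x \in box r); first by rewrite mulr1 /r; lra.
    rewrite mulr0 add0r; suff : r <= dotv x x by rewrite /r; lra.
    have [j Hj] : exists j, ~ seg r (x 0 j).
      by apply/existsNP => h; move/negP : Bx; apply; rewrite inE.
    apply: (@le_trans _ _ (r * r)); first by rewrite ler_peMr// ltW.
    apply: (@le_trans _ _ (x 0 j * x 0 j)).
      rewrite -!expr2 -[leRHS]real_normK ?num_real// lerXn2r ?nnegrE// ?(ltW r0)//.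
      rewrite leNgt; apply/negP => h; apply: Hj; rewrite /seg/= in_itv/=.
      by move: h; rewrite ltr_norml => /andP[? ?]; rewrite !ltW.
    rewrite /dotv (bigD1 j)//= lerDl; apply: sumr_ge0 => i _.
    by rewrite -expr2 sqr_ge0.
  rewrite RintegralD_bm//; [|by bmfun_tac|by bmfun_tac].
  rewrite !RintegralZl_bm//; [|by bmfun_tac|by bmfun_tac].
  rewrite lerBlDr lerDl mulr_ge0// divr_ge0// ltW//.
move=> h; apply: le_trans h _; rewrite [leRHS]mulrDl; apply: lerD => //.
rewrite -[leRHS]mulrA; apply: ler_wpM2l; first exact: ltW.
rewrite Q1; apply: le_trans Q2 _; rewrite -[leRHS]mulrA -[leRHS]mulrA ler_pM2l ?expR_gt0//.
apply: le_trans Q3 _; apply: ler_wpM2l; first exact: sqr_ge0.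
exact: Q4.
Qed.

Hypothesis p_int : mu.-integrable setT (EFin \o p).
Hypothesis p_mass : \int[mu]_x p x = 1.

Let mass_box N : \int[mu]_(x in box N) p x <= 1.
Proof.
rewrite -p_mass -[X in Rintegral _ X _ <= _]setTI Rintegral_mkcondr.
apply: le_Rintegral => //.
- by rewrite -restrict_EFin; apply/integrable_restrict => //; rewrite setTI; exact: integrableS p_int.
- by move=> x _; rewrite patchE; case: ifPn => // _; exact: ltW.
Qed.

(** Monotone convergence along boxes of integer size, then monotonicity in [N]. *)
Let mass_box_cvg (e : R) : 0 < e ->
  exists N1, forall N, N1 <= N -> 1 - e <= \int[mu]_(x in box N) p x.
Proof.
move=> e0; have le_box (M N : R) : M <= N -> box M `<=` @box R d N.
  move=> MN x h j; have := h j; rewrite /seg/= !in_itv/= => /andP[h1 h2].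
  by apply/andP; split; [apply: le_trans h1; rewrite lerN2|exact: le_trans MN].
have : (\int[mu]_(x in box i%:R) (p x)%:E)%E @[i --> \oo] --> (1 : R)%:E.
  have -> : (1 : R)%:E = (\int[mu]_(x in \bigcup_i box i%:R) (p x)%:E)%E.
    have -> : \bigcup_i @box R d i%:R = setT.
      apply/seteqP; split => // x _.
      exists (Num.bound (\sum_(j < d) `|x 0 j|)) => // j.
      have h : `|x 0 j| <= (Num.bound (\sum_(j < d) `|x 0 j|))%:R.
        apply: ltW; apply: le_lt_trans (archi_boundP _); last exact: sumr_ge0.
        by rewrite (bigD1 j)//= lerDl sumr_ge0.
      by rewrite /seg/= in_itv/= -ler_norml.
    by rewrite -p_mass /Rintegral fineK//; exact: integrable_fin_num p_int.
  apply: ge0_nondecreasing_set_cvg_integral => //.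
  - by move=> i j ij; apply/subsetPset; apply: le_box; rewrite ler_nat.
  - by move=> i; apply: measurable_funTS; exact: measurable_int p_int.
  - by move=> i x _; rewrite lee_fin ltW.
move=> /fine_cvgP[_ /cvgrPdist_le /(_ _ e0)] [n _ hn].
exists n%:R => N nN; have := hn n (leqnn n); rewrite /= -/(Rintegral _ _ _) => h.
have : \int[mu]_(x in box n%:R) p x <= \int[mu]_(x in box N) p x.
  rewrite -[X in Rintegral _ X _ <= _](setIidr (le_box _ _ nN)) Rintegral_mkcondr.
  apply: le_Rintegral_bm => //; last first.
    by move=> x _; rewrite patchE; case: ifPn => // _; exact: ltW.
  by rewrite patch_indic; apply: bmfunM; [exact: bp_|exact: bmfun_indic].
by move: h; rewrite ler_norml => /andP[_]; lra.
Qed.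

Let K := 8 / a ^+ 2 + r * (expR A * (2 * r) ^+ 2 * expR (A * (1 + d%:R * r ^+ 2))).
Let C4 := d%:R + 3 + (d%:R + 1) * A * (2 + 2 * (b + d%:R) / a).

Let lsi_arith (E m lm lt t P C s del : R) :
  E - lt * m - m + t * P <= 3 * (C * s) + 24 * s + 3 * s ->
  m - t <= m * lm - m * lt -> t - del <= t * P ->
  E - m * lm <= (3 * C + 27) * s + del.
Proof. lra. Qed.

(** For compactly supported [f] the integrals [m] and [E] stabilise on large boxes, whereas the mass
    of [p] only converges; the resulting error is let go to zero at the end. The factor
    [3 * C4 + 27] collects the constants of [rothaus_pt] once its three integrals are bounded by
    multiples of [s]. *)
Lemma lsi_gibbs (f : 'rV[R]_d -> R) (N1 D E m : R) : C1 f ->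
  (forall N, N1 <= N -> \int[mu]_(x in box N) (f x ^+ 2 * p x) = m) ->
  (forall N, N1 <= N ->
     \int[mu]_(x in box N) (f x ^+ 2 * ln (f x ^+ 2) * p x) = E) ->
  (forall N, \int[mu]_(x in box N) (gradsq f x * p x) <= D) ->
  E - m * ln m <= (3 * C4 + 27) * (K + 1) * D.
Proof.
move=> Cf hm hE hD.
have r1 : 1 <= r.
  by rewrite /r lerDl divr_ge0// ?(ltW a0)// mulr_ge0// addr_ge0// ltW.
have K0 : 0 <= K.
  apply: addr_ge0; first by rewrite divr_ge0// sqr_ge0.
  by rewrite mulr_ge0 ?mulr_ge0 ?expR_ge0 ?sqr_ge0//; lra.
have C40 : 0 <= C4.
  have ba : 0 <= 2 * (b + d%:R) / a.
    by rewrite divr_ge0 ?(ltW a0)// mulr_ge0// addr_ge0// ltW.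
  apply: addr_ge0; first by rewrite addr_ge0.
  by rewrite !mulr_ge0 ?addr_ge0// ltW.
have D0 : 0 <= D.
  apply: le_trans (hD 1); apply: Rintegral_ge0 => x _.
  by rewrite mulr_ge0 ?gradsq_ge0// ltW.
have [c hc] := weighted_poincare Cf.
suff h (del : R) : 0 < del -> E - m * ln m <= (3 * C4 + 27) * ((K + 1) * D + del) + del.
  apply/ler_addgt0Pr => e e0.
  have Q0 : 0 < 3 * C4 + 28 by lra.
  have := h (e / (3 * C4 + 28)) (divr_gt0 e0 Q0).
  have -> : (3 * C4 + 27) * ((K + 1) * D + e / (3 * C4 + 28)) + e / (3 * C4 + 28) =
    (3 * C4 + 27) * (K + 1) * D + e by field; exact: lt0r_neq0.
  by [].
(* [s] dominates both [K * D], the weighted norm of [f - c], and [D], its energy; [del] keeps it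
   positive when [D = 0]. The same [del] bounds [t] times the mass missing from the box. *)
move=> del0; pose s := (K + 1) * D + del; pose t := c ^+ 2 + s.
have KD : 0 <= K * D by exact: mulr_ge0.
have s0 : 0 < s by rewrite /s; lra.
have t0 : 0 < t by rewrite ltr_wpDl// sqr_ge0.
have [N2 hN2] := mass_box_cvg (divr_gt0 del0 t0).
pose N := Num.max N1 (Num.max N2 r).
have NN1 : N1 <= N by rewrite le_max lexx.
have NN2 : N2 <= N by rewrite !le_max lexx orbT.
have NNr : r <= N by rewrite !le_max lexx !orbT.
have N0 : 0 < N by lra.
have N12 : 1 <= 2 * N by lra.
have {}hm := hm _ NN1; have {}hE := hE _ NN1; have {}hD := hD N.
have {}hN2 := hN2 _ NN2; have {}hc := hc _ NNr.
have P1 := mass_box N.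
have [Cc dc] := @C1_cst R d (- c).
have [Cg dg] := C1D Cf Cc.
set g := fun x => f x - c in Cg dg.
have gE : gradsq g = gradsq f.
  by apply/funext => x; apply: eq_bigr => j _; rewrite dg dc addr0.
have bg := bmfun_box N Cg.1; have bf := bmfun_box N Cf.1; have bpN := bp_ N.
have bdN := bdot_ N.
have cst (k : R) : bmfun (@box R d N) (fun=> k) by exact: bmfun_cst.
have bl : bmfun (box N) (fun x => f x ^+ 2 * ln (f x ^+ 2)).
  by apply: bmfun_xlnx; [move=> x _; exact: sqr_ge0|bmfun_tac].
have bln : bmfun (box N) (fun x => ln (g x ^+ 2 + s)).
  apply: (bmfun_ln s0); last by bmfun_tac.
  by move=> x _; rewrite lerDr sqr_ge0.
have g1 : \int[mu]_(x in box N) (g x ^+ 2 * (1 + dotv x x) * p x) <= s.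
  apply: le_trans hc _; rewrite -/K.
  have : K * \int[mu]_(x in box N) (gradsq f x * p x) <= K * D by rewrite ler_wpM2l.
  rewrite /s; lra.
have g2 : \int[mu]_(x in box N) (gradsq g x * p x) <= s.
  rewrite gE; apply: le_trans hD _; rewrite /s; lra.
have g3 : \int[mu]_(x in box N) (g x ^+ 2 * p x) <= s.
  apply: le_trans g1; apply: le_Rintegral_bm => //; [by bmfun_tac|by bmfun_tac|].
  move=> x _; rewrite ler_pM2r// ler_peMr ?sqr_ge0// lerDl; exact: dot_ge0.
have EN := entropy_gibbs_box N0 P1 N12 s0 Cg g1 g2.
rewrite -/C4 in EN.
have I1 : \int[mu]_(x in box N)
    ((f x ^+ 2 * (ln (f x ^+ 2) - ln t) - f x ^+ 2 + t) * p x) <=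
    3 * (C4 * s) + 24 * s + 3 * s.
  apply: (@le_trans _ _ (\int[mu]_(x in box N)
      (3 * ((g x ^+ 2 + s) * (ln (g x ^+ 2 + s) - ln s) * p x) +
       24 * (g x ^+ 2 * p x) + 3 * s * p x))).
    apply: le_Rintegral_bm => //.
    - rewrite (_ : (fun x => _) = (fun x => (f x ^+ 2 * ln (f x ^+ 2) -
         f x ^+ 2 * ln t - f x ^+ 2 + t) * p x)); first by bmfun_tac.
      by apply/funext => x; ring.
    - by bmfun_tac.
    move=> x _; have := rothaus_pt (f x) c s0; rewrite -/t -/(g x) => h.
    have -> : 3 * ((g x ^+ 2 + s) * (ln (g x ^+ 2 + s) - ln s) * p x) +
        24 * (g x ^+ 2 * p x) + 3 * s * p x =
      (3 * ((g x ^+ 2 + s) * (ln (g x ^+ 2 + s) - ln s)) + 24 * g x ^+ 2 + 3 * s) * p x.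
      by ring.
    by rewrite ler_wpM2r// ltW.
  rewrite RintegralD_bm//; [|by bmfun_tac|by bmfun_tac].
  rewrite RintegralD_bm//; [|by bmfun_tac|by bmfun_tac].
  rewrite !RintegralZl_bm//; [|by bmfun_tac|by bmfun_tac].
  apply: lerD; first by apply: lerD; apply: ler_wpM2l.
  by rewrite ler_piMr// mulr_ge0// ltW.
have I2 : \int[mu]_(x in box N)
    ((f x ^+ 2 * (ln (f x ^+ 2) - ln t) - f x ^+ 2 + t) * p x) =
    E - ln t * m - m + t * \int[mu]_(x in box N) p x.
  rewrite (_ : (fun x => _) = (fun x => f x ^+ 2 * ln (f x ^+ 2) * p x -
         ln t * (f x ^+ 2 * p x) - f x ^+ 2 * p x + t * p x)); last first.
    by apply/funext => x; ring.
  rewrite RintegralD_bm//; [|by bmfun_tac|by bmfun_tac].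
  rewrite RintegralB_bm//; [|by bmfun_tac|by bmfun_tac].
  rewrite RintegralB_bm//; [|by bmfun_tac|by bmfun_tac].
  rewrite hE !RintegralZl_bm//; last by bmfun_tac.
  by rewrite hm.
have m0 : 0 <= m.
  rewrite -hm; apply: Rintegral_ge0 => x _.
  by rewrite mulr_ge0 ?sqr_ge0// ltW.
(* This replaces the level [t] of the pointwise comparison by the true mean [m]. *)
have mt : m - t <= m * ln m - m * ln t by exact: xlnx_sub_ge.
have tP : t - del <= t * \int[mu]_(x in box N) p x.
  have := ler_wpM2l (ltW t0) hN2.
  by rewrite mulrBr mulr1 mulrCA divff ?mulr1//; exact: lt0r_neq0.
rewrite I2 in I1; exact: lsi_arith I1 mt tP.
Qed.

End gibbs.

(** * Probability measures given by a density *)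

Section density_measure.
Context {R : realType} {d : nat} (p : 'rV[R]_d -> R).
Hypothesis hp : is_density p.
Local Notation mu := (lebesgue_rV d).

Lemma density_integrable : mu.-integrable setT (EFin \o p).
Proof.
have [mp p0 p1] := hp.
apply/integrableP; split; first exact/measurable_EFinP.
under eq_integral do rewrite gee0_abs ?lee_fin//.
by rewrite p1 ltry.
Qed.

(** The proof of [is_density p] is an argument so that the measure and probability structures can be
    attached to [density_measure hp]. *)
Definition density_measure (_ : is_density p) (A : set 'rV[R]_d) : \bar R :=
  (\int[mu]_(x in A) (p x)%:E)%E.

Let density0 : density_measure hp set0 = 0%E.
Proof. exact: integral_set0. Qed.

Let density_ge0 A : (0 <= density_measure hp A)%E.
Proof. by have [_ p0 _] := hp; apply: integral_ge0 => x _; rewrite lee_fin. Qed.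

Let density_sigma_additive : semi_sigma_additive (density_measure hp).
Proof.
have [_ p0 _] := hp => A mA tA mUA.
rewrite /density_measure integral_bigcup//; last first.
  exact: integrableS density_integrable.
apply: is_cvg_ereal_nneg_natsum_cond => n _ _.
by apply: integral_ge0 => x _; rewrite lee_fin.
Qed.

HB.instance Definition _ := isMeasure.Build _ _ _ (density_measure hp)
  density0 density_ge0 density_sigma_additive.

Let density_setT : density_measure hp [set: _] = 1%E.
Proof. by have [] := hp. Qed.

HB.instance Definition _ :=
  @Measure_isProbability.Build _ _ R (density_measure hp) density_setT.

Lemma has_density_measure :
  exists nu : probability 'rV[R]_d R, has_density nu p.
Proof. by exists (density_measure hp). Qed.

End density_measure.

Section integral_density.
Context {R : realType} {d : nat} (nu : probability 'rV[R]_d R) (p : 'rV[R]_d -> R).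
Hypotheses (mp : measurable_fun setT p) (p0 : forall x, 0 <= p x)
  (nup : has_density nu p).
Local Notation mu := (lebesgue_rV d).

Let numu : nu `<< mu.
Proof.
apply/null_content_dominatesP => A mA A0; rewrite nup//.
apply: null_set_integral => //; apply/measurable_EFinP.
exact: measurable_funTS.
Qed.

Let ip : mu.-integrable setT (EFin \o p).
Proof.
apply: density_integrable; split => //.
by rewrite -nup// probability_setT.
Qed.

Let ae_p : ae_eq mu setT (Radon_Nikodym_SigmaFinite.f nu mu) (EFin \o p).
Proof.
apply: integral_ae_eq => //.
- exact: Radon_Nikodym_SigmaFinite.f_integrable.
- exact/measurable_EFinP.
- by move=> A _ mA; rewrite -(Radon_Nikodym_SigmaFinite.f_integral numu mA); exact: nup.
Qed.

(** The Radon-Nikodym derivative of [nu] agrees almost everywhere with [p], as both have the same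
    integral over every measurable set; the change of variables for that derivative then gives the
    formula. *)
Lemma ge0_integral_density (h : 'rV[R]_d -> R) : (forall x, 0 <= h x) ->
  measurable_fun setT h ->
  (\int[nu]_x (h x)%:E = \int[mu]_x (h x * p x)%:E)%E.
Proof.
move=> h0 mh; rewrite -(Radon_Nikodym_SigmaFinite.change_of_variables numu)//.
- apply: ae_eq_integral => //.
  + apply: emeasurable_funM; first exact/measurable_EFinP.
    by apply: measurable_int; exact: Radon_Nikodym_SigmaFinite.f_integrable.
  + by apply/measurable_EFinP; exact: measurable_funM.
  + by move: ae_p; apply: filterS => x /= /(_ I) -> _; rewrite EFinM.
- exact/measurable_EFinP.
Qed.

Lemma integral_density (h : 'rV[R]_d -> R) : measurable_fun setT h ->
  bounded_on setT h ->
  (\int[nu]_x (h x)%:E = \int[mu]_x (h x * p x)%:E)%E.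
Proof.
move=> mh [k hk].
have k0 : 0 <= k by apply: le_trans (hk 0 I).
have inu (g : 'rV[R]_d -> R) : bmfun setT g -> nu.-integrable setT (EFin \o g).
  have nT : (nu setT < +oo)%E by rewrite probability_setT ltry.
  exact: (bmfun_integrable (mu := nu) measurableT nT).
have b1 : bmfun setT (fun x => h x + k).
  (* Adding the bound [k] makes [h] nonnegative, and [k] is subtracted again after the change of
     measure. *)
  by apply: bmfunD; [split => //; exists k|exact: bmfun_cst].
have ip_mul (g : 'rV[R]_d -> R) : bmfun setT g -> (forall x, 0 <= g x) ->
    mu.-integrable setT (fun x => (g x * p x)%:E).
  move=> bg g0; apply/integrableP; split.
    by apply/measurable_EFinP; apply: measurable_funM => //; exact: bg.1.
  under eq_integral do rewrite gee0_abs ?lee_fin ?mulr_ge0//.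
  rewrite -ge0_integral_density//; last exact: bg.1.
  have /integrableP[_] := inu _ bg; congr (_ < _)%E.
  by apply: eq_integral => x _; rewrite /= ger0_norm.
have hE x : (h x)%:E = ((h x + k)%:E - k%:E)%E by rewrite -EFinB addrK.
under eq_integral do rewrite hE.
rewrite integralB//; [|exact: (inu (fun x => h x + k))|exact: (inu (fun=> k) (bmfun_cst _ _))].
have hk0 x : 0 <= h x + k.
  by have := hk x I; rewrite ler_norml => /andP[h1 _]; rewrite -lerBlDr sub0r.
rewrite (ge0_integral_density hk0 b1.1).
rewrite (ge0_integral_density (fun=> k0) (measurable_cst _)).
rewrite -integralB//.
- by apply: eq_integral => x _; rewrite -EFinB; congr EFin; ring.
- by apply: ip_mul.
- by apply: ip_mul => //; exact: bmfun_cst.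
Qed.

End integral_density.

(** * The log-Sobolev inequality with a constant uniform in the potential *)

Section lsi.
Context {R : realType} {d : nat}.
Local Notation mu := (lebesgue_rV d).

Lemma smooth_C1 (f : 'rV[R]_d -> R) : smooth f -> C1 f.
Proof.
move=> sf; have [cf df] := sf [::]; split=> // j; split=> [x|]; first exact: df.
by have [cdf _] := sf [:: j].
Qed.

Lemma continuous_dotv : continuous (fun x : 'rV[R]_d => dotv x x).
Proof.
by apply: continuous_sumr => j; apply: continuous_mulr; exact: coord_continuous.
Qed.

Lemma compactly_supported_box (f : 'rV[R]_d -> R) : compactly_supported f ->
  exists N, forall x, ~ box N x -> f x = 0.
Proof.
move=> cf.
have /compact_bounded[M [_ hM]] : compact ((fun x : 'rV[R]_d => dotv x x) @`
    closure [set x | f x != 0]).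
  apply: continuous_compact => //; apply: continuous_subspaceT.
  exact: continuous_dotv.
exists (1 + (`|M| + 1)) => x; apply: contra_notP => /eqP fx j.
have : `|dotv x x| <= `|M| + 1.
  apply: hM; first by rewrite ltr_pwDr// ler_norm.
  by exists x => //; apply: subset_closure.
rewrite ger0_norm; last by apply: sumr_ge0 => i _; rewrite -expr2 sqr_ge0.
have : x 0 j * x 0 j <= dotv x x.
  by rewrite /dotv (bigD1 j)//= lerDl sumr_ge0// => i _; rewrite -expr2 sqr_ge0.
have := normr_ge0 M; rewrite /seg/= in_itv/=.
move: `|M| (dotv x x) (x 0 j) => m D y m0 h1 h2.
by apply/andP; split; nra.
Qed.

Lemma enorm_sqr (x : 'rV[R]_d) : enorm x ^+ 2 = dotv x x.
Proof. by rewrite sqr_sqrtr// sumr_ge0// => j _; rewrite -expr2 sqr_ge0. Qed.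

Lemma box_subset (M N : R) : M <= N -> box M `<=` @box R d N.
Proof.
move=> MN x h j; have := h j; rewrite /seg/= !in_itv/= => /andP[h1 h2].
by apply/andP; split; [apply: le_trans h1; rewrite lerN2|exact: le_trans MN].
Qed.

Lemma Rintegral_box_support (h : 'rV[R]_d -> R) (M N : R) : M <= N ->
  (forall x, ~ box M x -> h x = 0) ->
  \int[mu]_(x in box N) h x = \int[mu]_(x in box M) h x.
Proof.
move=> MN h0.
rewrite -[X in _ = Rintegral _ X _](setIidr (box_subset MN)) Rintegral_mkcondr.
apply: eq_Rintegral => x _; rewrite patchE; case: ifPn => // xM; rewrite h0// => xM'.
by move/negP : xM; apply; rewrite inE.
Qed.

Lemma integral_box_support (h : 'rV[R]_d -> R) (M : R) :
  continuous h \/ bmfun (box M) h ->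
  (forall x, ~ box M x -> h x = 0) ->
  (\int[mu]_x (h x)%:E = (\int[mu]_(x in box M) h x)%:E)%E.
Proof.
move=> ch h0; rewrite /Rintegral fineK.
  rewrite [RHS]integral_mkcond; apply: eq_integral => x _.
  rewrite patchE; case: ifPn => // xM; rewrite h0// => xM'.
  by move/negP : xM; apply; rewrite inE.
apply: integrable_fin_num => //; apply: bmfun_integrable => //.
by case: ch => //; exact: bmfun_box.
Qed.

Theorem lsi_of_potential (a b A : R) : 0 < a -> 0 < b -> 0 < A ->
  exists2 C, 0 < C & forall (V : 'rV[R]_d -> R) (nu : probability 'rV[R]_d R),
    C1 V -> (forall x, - A <= V x) -> (forall x, V x <= A * (1 + dotv x x)) ->
    (forall j x, `|partial j V x| <= A * (1 + dotv x x)) ->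
    (forall x, a * dotv x x - b <= \sum_(j < d) x 0 j * partial j V x) ->
    has_density nu (fun x => expR (- V x)) -> lsi_with nu C.
Proof.
move=> a0 b0 A0.
have [C hC] : exists C : R, forall (V : 'rV[R]_d -> R),
    C1 V -> (forall x, - A <= V x) -> (forall x, V x <= A * (1 + dotv x x)) ->
    (forall j x, `|partial j V x| <= A * (1 + dotv x x)) ->
    (forall x, a * dotv x x - b <= \sum_(j < d) x 0 j * partial j V x) ->
    mu.-integrable setT (EFin \o (fun x => expR (- V x))) ->
    \int[mu]_x expR (- V x) = 1 ->
    forall f (N1 D E m : R), C1 f ->
  (forall N, N1 <= N -> \int[mu]_(x in box N) (f x ^+ 2 * expR (- V x)) = m) ->
  (forall N, N1 <= N ->
     \int[mu]_(x in box N) (f x ^+ 2 * ln (f x ^+ 2) * expR (- V x)) = E) ->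
  (forall N, \int[mu]_(x in box N)
     ((\sum_(j < d) partial j f x ^+ 2) * expR (- V x)) <= D) ->
  E - m * ln m <= C * D.
  (* The constant is left to unification with the conclusion of [lsi_gibbs]; it mentions [a], [b],
     [A] and [d] but not [V]. *)
  eexists => V CV h1 h2 h3 h4 h5 h6 f N1 D E m; move=> Cf q1 q2 q3.
  exact: (lsi_gibbs a0 b0 A0 CV h1 h2 h3 h4 h5 h6 Cf q1 q2 q3).
exists (`|C| + 1) => [|V nu CV h1 h2 h3 h4 nuV f sf cf].
  by rewrite ltr_wpDl.
pose m := \int[nu]_y (f y ^+ 2).
suff : (\int[nu]_x (f x ^+ 2 * ln (f x ^+ 2 / m))%:E <=
   (`|C| + 1)%:E * \int[nu]_x (enorm (grad f x) ^+ 2)%:E)%E by [].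
have Cf := smooth_C1 sf.
have [M hM] := compactly_supported_box cf.
have cp : continuous (fun x => expR (- V x)).
  move=> x; apply: continuous_comp; last exact: continuous_expR.
  by apply: continuousN; exact: CV.1.
have p0 x : 0 <= expR (- V x) by exact: expR_ge0.
have mp := continuous_measurable_rV cp.
have dp : is_density (fun x => expR (- V x)).
  by split => //; rewrite -nuV// probability_setT.
have ip := density_integrable dp.
have p1 : \int[mu]_x expR (- V x) = 1 by rewrite /Rintegral; have [_ _ ->] := dp.
have cf2 : continuous (fun x => f x ^+ 2).
  by under eq_fun do rewrite expr2; apply: continuous_mulr; exact: Cf.1.
have bf2 : bmfun setT (fun x => f x ^+ 2).
  split; first exact: continuous_measurable_rV.
  have [K hK] := box_bounded M cf2; exists (Num.max K 0) => x _.
  have [xM|xM] := pselect (box M x); first by rewrite le_max hK.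
  by rewrite hM// expr0n normr0 le_max lexx orbT.
have f20 x : 0 <= f x ^+ 2 by exact: sqr_ge0.
have bp := bmfun_box M cp; have bfM := bmfun_box M cf2.
have mE : m = \int[mu]_(x in box M) (f x ^+ 2 * expR (- V x)).
  rewrite /m /Rintegral (ge0_integral_density mp nuV)//; last exact: bf2.1.
  rewrite (@integral_box_support (fun x => f x ^+ 2 * expR (- V x)) M)//.
    by right; exact: bmfunM.
  by move=> x xM; rewrite hM// expr0n mul0r.
have m0 : 0 <= m by rewrite mE; apply: Rintegral_ge0 => x _; rewrite mulr_ge0.
set G := (\int[nu]_x (enorm (grad f x) ^+ 2)%:E)%E.
have GE : G = (\int[mu]_x ((\sum_(j < d) partial j f x ^+ 2) * expR (- V x))%:E)%E.
  rewrite /G -(ge0_integral_density mp nuV)//.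
  - apply: eq_integral => x _; rewrite enorm_sqr /dotv; congr EFin.
    by apply: eq_bigr => j _; rewrite !mxE -expr2.
  - by move=> x; apply: sumr_ge0 => j _; exact: sqr_ge0.
  - apply: continuous_measurable_rV; apply: continuous_sumr => j.
    by under eq_fun do rewrite expr2; apply: continuous_mulr; exact: (Cf.2 j).2.
have g0 x : 0 <= (\sum_(j < d) partial j f x ^+ 2) * expR (- V x).
  by rewrite mulr_ge0// sumr_ge0// => j _; exact: sqr_ge0.
have G0 : (0 <= G)%E by rewrite GE; apply: integral_ge0 => x _; rewrite lee_fin.
have [m00|mN0] := eqVneq m 0.
  (* For [m = 0] the conventions [0^-1 = 0] and [ln 0 = 0] make the left integrand vanish. *)
  rewrite integral0_eq; first by rewrite mule_ge0// lee_fin; have := normr_ge0 C; lra.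
  by move=> x _; rewrite m00 invr0 mulr0 ln0// mulr0.
have mp0 : 0 < m by rewrite lt_def mN0.
(* An infinite right-hand side is trivial; treating it apart spares a bound on the support of the
   gradient. *)
have [Gy|GNy] := eqVneq G +oo%E.
  by rewrite Gy gt0_muley ?leey// lte_fin ltr_wpDl.
have Gfin : G \is a fin_num by rewrite ge0_fin_numE// ltey.
have bl : bmfun setT (fun x => f x ^+ 2 * ln (f x ^+ 2)) by exact: bmfun_xlnx.
have lE x : f x ^+ 2 * ln (f x ^+ 2 / m) =
    f x ^+ 2 * ln (f x ^+ 2) - f x ^+ 2 * ln m.
  have [->|fx] := eqVneq (f x ^+ 2) 0; first by rewrite !mul0r subrr.
  have f2p : 0 < f x ^+ 2 by rewrite lt_def fx f20.
  by rewrite ln_div ?posrE// mulrBr.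
under eq_integral do rewrite lE.
have bl2 : bmfun setT (fun x => f x ^+ 2 * ln (f x ^+ 2) - f x ^+ 2 * ln m).
  by apply: bmfunB => //; apply: bmfunM => //; exact: bmfun_cst.
rewrite (@integral_density _ _ _ _ mp p0 nuV _ bl2.1 bl2.2).
have blM : bmfun (box M) (fun x => f x ^+ 2 * ln (f x ^+ 2)) by exact: bmfun_xlnx.
rewrite (@integral_box_support (fun x => (f x ^+ 2 * ln (f x ^+ 2) -
   f x ^+ 2 * ln m) * expR (- V x)) M); last 2 first.
- by right; bmfun_tac.
- by move=> x xM; rewrite hM// expr0n !mul0r subrr mul0r.
have -> : \int[mu]_(x in box M) ((f x ^+ 2 * ln (f x ^+ 2) -
     f x ^+ 2 * ln m) * expR (- V x)) =
  \int[mu]_(x in box M) (f x ^+ 2 * ln (f x ^+ 2) * expR (- V x)) - m * ln m.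
  transitivity (\int[mu]_(x in box M) (f x ^+ 2 * ln (f x ^+ 2) * expR (- V x) -
     ln m * (f x ^+ 2 * expR (- V x)))).
    by apply: eq_Rintegral => x _; ring.
  have c : bmfun (@box R d M) (fun=> ln m) by exact: bmfun_cst.
  rewrite RintegralB_bm//; [|by bmfun_tac|by bmfun_tac].
  rewrite RintegralZl_bm//; last by bmfun_tac.
  by rewrite -mE mulrC.
rewrite -(fineK Gfin) -EFinM lee_fin.
apply: (@le_trans _ _ (C * fine G)); last first.
  rewrite ler_wpM2r ?fine_ge0//; have := ler_norm C; lra.
apply: (hC V CV h1 h2 h3 h4 ip p1 f M) => //.
- move=> N MN; rewrite mE; apply: (Rintegral_box_support MN) => x xM.
  by rewrite hM// expr0n mul0r.
- move=> N MN; apply: (Rintegral_box_support MN) => x xM.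
  by rewrite hM// expr0n !mul0r.
- move=> N; rewrite GE /Rintegral fine_le//.
  + apply: integrable_fin_num => //; apply: bmfun_integrable => //.
    apply: bmfunM; last exact: bmfun_box.
    by apply: bmfun_sum => j; apply: bmfunX; exact: bmfun_partial.
  + by rewrite -GE.
  apply: ge0_subset_integral => //; last by move=> x _; rewrite lee_fin.
  apply/measurable_EFinP; apply: measurable_funM => //.
  apply: continuous_measurable_rV; apply: continuous_sumr => j.
  by under eq_fun do rewrite expr2; apply: continuous_mulr; exact: (Cf.2 j).2.
Qed.

End lsi.

(** * Continuity and differentiability from explicit bounds *)

Section normed_module.
Context {R : realType} {V : normedModType R}.

Lemma lipschitz_sup_continuous (f : V -> R) (C : R) :
  (forall x y, `|f x - f y| <= C * `|x - y|) -> continuous f.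
Proof.
move=> lf x; apply/cvgrPdist_le => /= e e0.
have C0 : 0 < `|C| + 1 by rewrite ltr_wpDl.
near=> y; apply: le_trans (lf _ _) _.
apply: (@le_trans _ _ ((`|C| + 1) * `|x - y|)).
  by rewrite ler_wpM2r//; have := ler_norm C; lra.
rewrite -ler_pdivlMl//; near: y; apply: cvgr_dist_le => //.
by rewrite mulr_gt0 ?invr_gt0.
Unshelve. all: by end_near. Qed.

Lemma quadratic_littleo (f g : V -> R) (l : V -> R) (C : R) :
  (forall h, `|f h - (g h + l h)| <= C * `|h| ^+ 2) -> f = g + l +o_ (0 : V) id.
Proof.
move=> hf; apply/eqaddoP => /= e e0.
have C0 : 0 < `|C| + 1 by rewrite ltr_wpDl.
near=> h; apply: le_trans (hf _) _.
apply: (@le_trans _ _ ((`|C| + 1) * `|h| * `|h|)).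
  rewrite expr2 mulrA ler_wpM2r// ler_wpM2r//; have := ler_norm C; lra.
rewrite ler_wpM2r// -ler_pdivlMl//; near: h.
by apply: nbhs0_le; rewrite mulr_gt0 ?invr_gt0.
Unshelve. all: by end_near. Qed.

End normed_module.

(** * The Euclidean norm and its comparison with the sup norm *)

Section euclidean_norm.
Context {R : realType} {d : nat}.
Implicit Types (x y z : 'rV[R]_d).

Lemma dotvC x y : dotv x y = dotv y x.
Proof. by apply: eq_bigr => j _; rewrite mulrC. Qed.

Lemma dotv_linear z : linear (dotv z : 'rV[R]_d -> R).
Proof.
move=> a x y; rewrite /dotv scaler_sumr -big_split/=.
by apply: eq_bigr => j _; rewrite !mxE mulrDr mulrCA.
Qed.

HB.instance Definition _ z := GRing.isLinear.Build R 'rV[R]_d R *:%R (dotv z)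
  (dotv_linear z).

Lemma dotvDr x y z : dotv z (x + y) = dotv z x + dotv z y. Proof. exact: linearD. Qed.
Lemma dotvBr x y z : dotv z (x - y) = dotv z x - dotv z y. Proof. exact: linearB. Qed.
Lemma dotvZr a x z : dotv z (a *: x) = a * dotv z x. Proof. exact: linearZ. Qed.
Lemma dotvDl x y z : dotv (x + y) z = dotv x z + dotv y z.
Proof. by rewrite !(dotvC _ z) dotvDr. Qed.
Lemma dotvBl x y z : dotv (x - y) z = dotv x z - dotv y z.
Proof. by rewrite !(dotvC _ z) dotvBr. Qed.
Lemma dotvZl a x z : dotv (a *: x) z = a * dotv x z.
Proof. by rewrite !(dotvC _ z) dotvZr. Qed.
Lemma dotv0r z : dotv z 0 = 0. Proof. exact: linear0. Qed.

Lemma dotv_ge0 x : 0 <= dotv x x.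
Proof. by apply: sumr_ge0 => j _; rewrite -expr2 sqr_ge0. Qed.

Lemma dotv_delta x j : dotv x (delta_mx 0 j) = x 0 j.
Proof.
rewrite /dotv (bigD1 j)//= mxE !eqxx mulr1 big1 ?addr0// => i ij.
by rewrite mxE (negbTE ij) andbF mulr0.
Qed.

Lemma enorm_ge0 x : 0 <= enorm x. Proof. exact: sqrtr_ge0. Qed.

Lemma enormE x : dotv x x = enorm x ^+ 2. Proof. by rewrite enorm_sqr. Qed.

Lemma enorm0 : enorm (0 : 'rV[R]_d) = 0.
Proof. by rewrite /enorm dotv0r sqrtr0. Qed.

Lemma dotv_eq0 x : dotv x x = 0 -> x = 0.
Proof.
move=> h; apply/rowP => j; rewrite mxE; apply/eqP.
have := h; rewrite /dotv => /eqP; rewrite psumr_eq0; last first.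
  by move=> i _; rewrite -expr2 sqr_ge0.
by move=> /allP /(_ j); rewrite mem_index_enum => /(_ isT) /=; rewrite mulf_eq0 orbb.
Qed.

Lemma dotv_le x y : dotv x y <= enorm x * enorm y.
Proof.
have [->|y0] := eqVneq y 0; first by rewrite dotv0r enorm0 mulr0.
have yy : 0 < dotv y y.
  by rewrite lt_def dotv_ge0 andbT; apply: contraNneq y0 => /dotv_eq0 ->.
have h : dotv x y ^+ 2 <= dotv x x * dotv y y.
  (* Up to the factor [dotv y y], this is the component of [x] orthogonal to [y]; its square length
     gives Cauchy-Schwarz. *)
  have := dotv_ge0 (dotv y y *: x - dotv x y *: y).
  rewrite dotvBr !dotvBl !dotvZr !dotvZl (dotvC y x).
  rewrite [X in 0 <= X](_ : _ = dotv y y * (dotv x x * dotv y y - dotv x y ^+ 2)).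
    by rewrite pmulr_rge0// subr_ge0.
  by rewrite /= -!/(dotv _ _); ring.
apply: le_trans (ler_norm _) _.
rewrite -(@ler_pXn2r _ 2)// ?nnegrE ?mulr_ge0 ?enorm_ge0//.
by rewrite real_normK ?num_real// exprMn -!enormE.
Qed.

Lemma enormN x : enorm (- x) = enorm x.
Proof. by rewrite /enorm -scaleN1r dotvZl dotvZr mulrA mulrNN !mul1r. Qed.

Lemma dotv_norm_le x y : `|dotv x y| <= enorm x * enorm y.
Proof.
rewrite ler_norml dotv_le andbT lerNl -mulN1r -dotvZl scaleN1r.
by apply: le_trans (dotv_le _ _) _; rewrite enormN.
Qed.

Lemma enormZ a x : enorm (a *: x) = `|a| * enorm x.
Proof. by rewrite /enorm dotvZl dotvZr mulrA -expr2 sqrtrM ?sqr_ge0// sqrtr_sqr. Qed.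

Lemma enormD x y : enorm (x + y) <= enorm x + enorm y.
Proof.
rewrite -(@ler_pXn2r _ 2)// ?nnegrE ?addr_ge0 ?enorm_ge0//.
rewrite -enormE dotvDr !dotvDl sqrrD -!enormE (dotvC y x).
have := dotv_le x y; lra.
Qed.

Lemma enormBC x y : enorm (x - y) = enorm (y - x).
Proof. by rewrite -enormN opprB. Qed.

Lemma enormB_le x y : enorm x <= enorm y + enorm (x - y).
Proof. by rewrite -{1}(subrK y x) addrC enormD. Qed.

Lemma coord_le_enorm x j : `|x 0 j| <= enorm x.
Proof.
rewrite -(@ler_pXn2r _ 2)// ?nnegrE ?enorm_ge0// real_normK ?num_real//.
by rewrite -enormE /dotv (bigD1 j)//= expr2 lerDl sumr_ge0// => i _; rewrite -expr2 sqr_ge0.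
Qed.

Lemma enorm_le_norm x : enorm x <= d%:R * `|x|.
Proof.
apply: (@le_trans _ _ (\sum_(j < d) `|x 0 j|)); last first.
  rewrite mulr_natl -[X in _ *+ X]card_ord -sumr_const; apply: ler_sum => j _.
  suff : `|x 0 j| <= mx_norm x by [].
  by rewrite mx_normrE; exact: (le_bigmax _ (fun ij => `|x ij.1 ij.2|) (0, j)).
rewrite -(@ler_pXn2r _ 2)// ?nnegrE ?enorm_ge0 ?sumr_ge0//.
rewrite -enormE /dotv expr2 big_distrl/=; apply: ler_sum => j _.
rewrite -expr2 -real_normK ?num_real// expr2 ler_wpM2l//.
by rewrite (bigD1 j)//= lerDl sumr_ge0.
Qed.

Lemma lipschitz_coord_continuous (v : 'rV[R]_d -> 'rV[R]_d) (k : R) j :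
  lipschitz_with k v -> continuous (fun x => v x 0 j).
Proof.
move=> lv; have k0 : 0 <= `|k| + 1 by have := normr_ge0 k; lra.
have lv' (x y : 'rV[R]_d) : `|v x 0 j - v y 0 j| <= (`|k| + 1) * d%:R * `|x - y|.
  have := coord_le_enorm (v x - v y) j; rewrite !mxE => h; apply: le_trans h _.
  apply: le_trans (lv _ _) _; rewrite -mulrA.
  apply: (@le_trans _ _ ((`|k| + 1) * enorm (x - y))).
    by apply: ler_wpM2r; [exact: enorm_ge0|have := ler_norm k; lra].
  by rewrite ler_wpM2l// enorm_le_norm.
exact: lipschitz_sup_continuous lv'.
Qed.

Lemma lipschitz_continuous_rV (v : 'rV[R]_d -> 'rV[R]_d) (k : R) :
  lipschitz_with k v -> continuous v.
Proof. by move=> lv; apply: continuous_rV => j; exact: lipschitz_coord_continuous lv. Qed.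

Lemma continuous_enorm : continuous (enorm : 'rV[R]_d -> R).
Proof.
by move=> x; apply: continuous_comp; [exact: continuous_dotv|exact: sqrt_continuous].
Qed.

End euclidean_norm.

(** * A quadratic expansion identifies the gradient *)

Section quadratic_expansion.
Context {R : realType} {d : nat} (f : 'rV[R]_d -> R) (u : 'rV[R]_d -> 'rV[R]_d) (K : R).
Hypothesis hf : forall x h, `|f (x + h) - f x - dotv (u x) h| <= K * enorm h ^+ 2.

Let expansion x : f \o shift x =
  cst (f x) + (dotv (u x) : 'rV[R]_d -> R) +o_ (0 : 'rV[R]_d) id.
Proof.
apply: (@quadratic_littleo _ _ _ _ _ (`|K| * d%:R ^+ 2)) => h /=.
have -> : f (h + x) - (f x + dotv (u x) h) = f (x + h) - f x - dotv (u x) h.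
  by rewrite [h + x]addrC opprD addrA.
apply: le_trans (hf _ _) _.
apply: (@le_trans _ _ (`|K| * enorm h ^+ 2)).
  by rewrite ler_wpM2r ?sqr_ge0// ler_norm.
apply: (@le_trans _ _ (`|K| * (d%:R * `|h|) ^+ 2)).
  by rewrite ler_wpM2l// ler_pXn2r ?nnegrE ?enorm_ge0 ?mulr_ge0// enorm_le_norm.
by rewrite exprMn mulrA.
Qed.

Let cdot z : continuous (dotv z : 'rV[R]_d -> R).
Proof.
apply: continuous_sumr => j; apply: continuous_mulr; first exact: cst_continuous.
exact: coord_continuous.
Qed.

Lemma differentiable_of_expansion x : differentiable f x.
Proof.
have E := diff_unique (@cdot (u x)) (expansion x).
by apply/diff_locallyP; rewrite E; split; [exact: cdot|exact: expansion].
Qed.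

Lemma grad_of_expansion x : grad f x = u x.
Proof.
apply/rowP => j; rewrite mxE /partial deriveE; last exact: differentiable_of_expansion.
rewrite (diff_unique (@cdot (u x)) (expansion x)); exact: dotv_delta.
Qed.

Lemma C1_of_expansion : (exists k, lipschitz_with k u) -> C1 f /\
  forall j x, partial j f x = u x 0 j.
Proof.
move=> [k lu]; have pE j x : partial j f x = u x 0 j.
  by rewrite -(grad_of_expansion x) mxE.
split => //; split.
  by move=> x; apply: differentiable_continuous; exact: differentiable_of_expansion.
move=> j; split; first by move=> x; apply: diff_derivable; exact: differentiable_of_expansion.
rewrite (_ : partial j f = fun x => u x 0 j); last exact/funext.
exact: lipschitz_coord_continuous lu.
Qed.

End quadratic_expansion.

(** * Real arithmetic of the envelope estimates, with norms and scalar products as variables *)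

Section real_arithmetic.
Context {R : realType}.
Implicit Types (a b c k q t s D E L U W X Y : R).

Lemma residual_arith X Y E D W k : X <= Y + E -> Y <= D + W -> W <= k * X ->
  2 * D + 1 <= X * (1 - k) -> D <= E.
Proof. lra. Qed.

Lemma envelope_arith L t U0 U1 n0 D n1 W : 0 <= t -> L * t <= 1 -> 0 <= W ->
  W = n0 - 2 * D + n1 -> - (L / 2 * (t ^+ 2 * W)) <= U1 - U0 - t * (n0 - D) ->
  U0 + t / 2 * n0 <= U1 + t / 2 * n1.
Proof.
move=> t0 Lt W0 WE h.
have h1 : t * (L * t) * W <= t * W by rewrite ler_wpM2r// ler_piMr.
have h2 : t * W = t * n0 - 2 * (t * D) + t * n1 by rewrite WE; ring.
have h3 : t * (L * t) * W = L * (t ^+ 2 * W) by ring.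
rewrite h3 in h1; lra.
Qed.

Lemma expansion_ub_arith a b c q D E : a <= b + q -> b - c - D <= E ->
  a - (c + q) <= D + E.
Proof. lra. Qed.

Lemma expansion_arith a b c D E W : b - a <= D + E -> a - b <= - c + E ->
  `|c - D| <= W -> `|b - a - D| <= E + W.
Proof.
move=> h1 h2 h3; have := normr_ge0 (c - D); move: h3.
by rewrite !ler_norml => /andP[h3 h4] h5; apply/andP; split; lra.
Qed.

Lemma time_ub_arith a b c n s t E : a <= b + s / 2 * n ->
  b - c - - (s - t) * n <= E -> a - (c + t / 2 * n) <= - ((s - t) / 2 * n) + E.
Proof. lra. Qed.

(** [X] and [Y] are the norms of the gradients at times [s] and [t]. Two one-sided estimates are
    joined into a two-sided one; replacing [X ^+ 2] by [Y ^+ 2] costs a second factor [|s - t|],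
    hence only a quadratic error. *)
Lemma time_arith a b s t X Y L k G : 0 <= L -> 0 <= k -> 0 <= G ->
  0 <= X <= G -> 0 <= Y <= G -> `|X - Y| <= k * `|s - t| * G ->
  a - b <= - ((s - t) / 2 * Y ^+ 2) + L / 2 * ((s - t) ^+ 2 * Y ^+ 2) ->
  b - a <= - ((t - s) / 2 * X ^+ 2) + L / 2 * ((t - s) ^+ 2 * X ^+ 2) ->
  `|a - b + (s - t) / 2 * Y ^+ 2| <= (L / 2 + k) * G ^+ 2 * (s - t) ^+ 2.
Proof.
move=> L0 k0 G0 /andP[X0 XG] /andP[Y0 YG] XY h1 h2.
have X2 : X ^+ 2 <= G ^+ 2 by rewrite ler_pXn2r ?nnegrE.
have Y2 : Y ^+ 2 <= G ^+ 2 by rewrite ler_pXn2r ?nnegrE.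
have L20 : 0 <= L / 2 by rewrite divr_ge0.
have h3 : L / 2 * ((s - t) ^+ 2 * X ^+ 2) <= L / 2 * ((s - t) ^+ 2 * G ^+ 2).
  by rewrite ler_wpM2l// ler_wpM2l// sqr_ge0.
have h4 : L / 2 * ((s - t) ^+ 2 * Y ^+ 2) <= L / 2 * ((s - t) ^+ 2 * G ^+ 2).
  by rewrite ler_wpM2l// ler_wpM2l// sqr_ge0.
have h5 : `|(s - t) / 2 * (X ^+ 2 - Y ^+ 2)| <= k * G ^+ 2 * (s - t) ^+ 2.
  rewrite normrM normrM [ `|2^-1|]gtr0_norm// subr_sqr normrM.
  apply: (@le_trans _ _ (`|s - t| / 2 * (k * `|s - t| * G * (G + G)))).
    rewrite ler_wpM2l ?divr_ge0//; apply: ler_pM => //.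
    by rewrite ger0_norm ?addr_ge0// lerD.
  rewrite -[(s - t) ^+ 2]real_normK ?num_real// le_eqVlt; apply/orP; left.
  by apply/eqP; field.
have h6 : 0 <= k * G ^+ 2 * (s - t) ^+ 2.
  by apply: mulr_ge0 (sqr_ge0 _); exact: mulr_ge0 k0 (sqr_ge0 _).
move: h5; rewrite !ler_norml => /andP[h5 h7].
have e1 : (t - s) ^+ 2 = (s - t) ^+ 2 by ring.
rewrite e1 in h2.
have e2 : (t - s) / 2 * X ^+ 2 = - ((s - t) / 2 * X ^+ 2) by ring.
rewrite e2 mulrBr in h2 h5 h7.
have -> : (L / 2 + k) * G ^+ 2 * (s - t) ^+ 2 =
  L / 2 * ((s - t) ^+ 2 * G ^+ 2) + k * G ^+ 2 * (s - t) ^+ 2 by ring.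
move: h1 h2 h3 h4 h5 h6 h7.
move: (L / 2 * _) (L / 2 * _) (L / 2 * _) (k * _ * _) => a1 a2 a3 a4.
move: (_ * X ^+ 2) (_ * Y ^+ 2) => a5 a6 *.
by apply/andP; split; lra.
Qed.

Lemma radial_arith a b L r V Z D : - (V * Z) <= D -> V * Z <= (b + L * r) * Z ->
  a * Z ^+ 2 <= a * r * Z -> a * Z ^+ 2 - (b + L * r + a * r) * Z <= D.
Proof. lra. Qed.

Lemma ray_arith a k c X D : 0 < c -> a * (c ^+ 2 * X ^+ 2) - k * (c * X) <= c * D ->
  0 <= D - - (k * X) - a * X ^+ 2 * c.
Proof.
move=> c0 h; rewrite -(pmulr_rge0 _ c0).
have -> : c * (D - - (k * X) - a * X ^+ 2 * c) =
   c * D - (a * (c ^+ 2 * X ^+ 2) - k * (c * X)) by ring.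
by rewrite subr_ge0.
Qed.

Lemma growth_arith a k c q X D U0 U1 :
  U1 - U0 - (- (k * X) + a * X ^+ 2 / 2) = D - - (k * X) - a * X ^+ 2 * c ->
  0 <= D - - (k * X) - a * X ^+ 2 * c -> k * X <= a / 4 * X ^+ 2 + q ->
  a / 4 * X ^+ 2 - (q + `|U0|) <= U1.
Proof.
move=> E h1 h2; have := ler_norm (- U0); rewrite normrN; lra.
Qed.

Lemma split_arith t tb X Y W : 0 <= t -> t <= tb -> 0 <= X -> 0 <= Y -> 0 <= W ->
  X <= Y + t * W -> X ^+ 2 <= 2 * Y ^+ 2 + 2 * tb * (t * W ^+ 2).
Proof.
move=> t0 t1 X0 Y0 W0 h.
have h1 : X ^+ 2 <= (Y + t * W) ^+ 2.
  by rewrite ler_pXn2r ?nnegrE// addr_ge0// mulr_ge0.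
have h2 : 0 <= (Y - t * W) ^+ 2 by exact: sqr_ge0.
have h3 : t * (t * W ^+ 2) <= tb * (t * W ^+ 2).
  by rewrite ler_wpM2r// mulr_ge0// sqr_ge0.
rewrite sqrrD in h1; rewrite sqrrB in h2.
have e : (t * W) ^+ 2 = t * (t * W ^+ 2) by ring.
rewrite e in h1 h2; lra.
Qed.

Lemma split_lb_arith a b k q X Y W U : a * Y - b <= U -> X <= 2 * Y + W ->
  0 <= k -> 0 <= Y -> k * 2 <= a -> k * W <= q -> k * X - b <= U + q.
Proof.
move=> h1 h2 k0 Y0 ka kW; have h3 := ler_wpM2l k0 h2.
have h4 := ler_wpM2r Y0 ka; lra.
Qed.

End real_arithmetic.

Lemma subrBB (V : zmodType) (x y a b : V) : x - a - (y - b) = x - y - (a - b).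
Proof.
by rewrite !opprB addrACA [RHS]addrACA; congr (_ + _); exact: addrC.
Qed.

(** * The Moreau envelope: proximal gradient, regularity and growth *)

Section moreau_envelope.
Context {R : realType} {d : nat} (U : 'rV[R]_d -> R) (L tb : R).
Local Notation v := (grad U).
Hypotheses (L0 : 0 < L) (tb0 : 0 < tb) (Ltb : L * tb < 1).
Hypothesis dU : forall x, differentiable U x.
Hypothesis lv : lipschitz_with L v.

Let derive_dotv x h : 'D_h U x = dotv (v x) h.
Proof.
rewrite deriveE// {1}(row_sum_delta h) linear_sum /dotv; apply: eq_bigr => j _.
by rewrite linearZ mxE /partial deriveE// mulrC.
Qed.

(** The mean value theorem for [U] along a segment minus the polynomial [p s + q s^2 / 2]. If [p]
    and [q] fix the sign of the right-hand side for every [c], a quadratic bound on [U] follows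
    without integrating. *)
Lemma path_MVT x h (p q : R) : exists2 c, 0 < c < 1 &
  U (x + h) - U x - (p + q / 2) = dotv (v (x + c *: h)) h - p - q * c.
Proof.
pose psi (s : R) := U (x + s *: h) - (p * s + q / 2 * s ^+ 2).
pose g (s : R) := x + s *: h.
have gE (s r : R) : g (r *: 1 + s) = r *: h + g s.
  by rewrite /g [r%:A]mulr1 scalerDl addrCA.
have dg (s : R) : is_derive s 1 (U \o g) (dotv (v (g s)) h).
  apply: DeriveDef.
    by rewrite (derivable_affine U (gE s)); exact: diff_derivable.
  by rewrite (derive_affine U (gE s)) derive_dotv.
have dpsi (s : R) : is_derive s 1 psi (dotv (v (g s)) h - p - q * s).
  have h1 : is_derive s 1 (fun s : R => p * s + q / 2 * s ^+ 2) (p + q * s).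
    by apply: is_derive_eq; rewrite /GRing.scale/=; field.
  have h2 := is_deriveB (dg s) h1.
  by rewrite -addrA -opprD.
have [||c c01] := @MVT R psi (fun s => dotv (v (g s)) h - p - q * s) 0 1.
- exact: ltr01.
- apply: continuous_subspaceT => s; apply: differentiable_continuous.
  by apply/derivable1_diffP; have := dpsi s => ?; exact: ex_derive.
rewrite subr0 mulr1 => E; exists c; first by rewrite in_itv/= in c01.
rewrite -/(g c) -E /psi !scale1r scale0r addr0 mulr0 expr0n/= mulr0 addr0 subr0.
by rewrite mulr1 expr1n mulr1 addrAC.
Qed.

Lemma descent x h : `|U (x + h) - U x - dotv (v x) h| <= L / 2 * enorm h ^+ 2.
Proof.
have E c : 0 < c < 1 ->
    `|dotv (v (x + c *: h)) h - dotv (v x) h| <= L * enorm h ^+ 2 * c.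
  move=> /andP[c0 c1]; rewrite -dotvBl; apply: le_trans (dotv_norm_le _ _) _.
  have := lv (x + c *: h) x; rewrite addrAC subrr add0r enormZ (gtr0_norm c0) => h1.
  apply: (@le_trans _ _ (L * (c * enorm h) * enorm h)).
    by rewrite ler_wpM2r// enorm_ge0.
  by rewrite expr2; lra.
rewrite ler_norml; apply/andP; split.
  have [c c01] := path_MVT x h (dotv (v x) h) (- (L * enorm h ^+ 2)).
  have := E c c01; rewrite ler_norml => /andP[h1 _]; lra.
have [c c01] := path_MVT x h (dotv (v x) h) (L * enorm h ^+ 2).
have := E c c01; rewrite ler_norml => /andP[_ h1]; lra.
Qed.

(* A minimiser of the residual [|u - T u|] is a fixed point of the contraction
   [T u = v (x - t u)]. *)
Lemma prox_exists t x : 0 <= t <= tb -> exists u, u = v (x - t *: u).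
Proof.
move=> /andP[t0 t1]; pose T u := v (x - t *: u); set q := L * tb.
have q0 : 0 <= q by rewrite mulr_ge0// ltW.
have lT : lipschitz_with q T.
  move=> u w; apply: le_trans (lv _ _) _.
  rewrite subrBB subrr sub0r enormN -scalerBr enormZ (ger0_norm t0) mulrA.
  by rewrite ler_wpM2r ?enorm_ge0// ler_wpM2l// ltW.
pose g u := enorm (u - T u).
have cg : continuous g.
  have cT : continuous (fun w : 'rV[R]_d => w - T w).
    apply: (@lipschitz_continuous_rV _ _ _ (1 + q)) => y z.
    rewrite subrBB; apply: le_trans (enormD _ _) _.
    by rewrite mulrDl mul1r enormN lerD2l; exact: lT.
  move=> u; apply: (@continuous_comp _ _ _ (fun w : 'rV[R]_d => w - T w) enorm).
    exact: cT.
  exact: continuous_enorm.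
(* From [|u| <= g u + |T u|] and [|T u| <= |T 0| + q |u|], the residual exceeds its value at 0 as
   soon as [|u| >= M]; so a minimiser on a compact box is global. *)
pose M := (2 * enorm (T 0) + 1) / (1 - q).
have q1 : 0 < 1 - q by rewrite subr_gt0.
have M0 : 0 <= M by rewrite divr_ge0 ?(ltW q1)// addr_ge0// mulr_ge0// enorm_ge0.
have gM u : enorm u >= M -> g 0 <= g u.
  move=> Mu; rewrite /g sub0r enormN.
  have h1 := enormB_le u (T u); have h2 := enormB_le (T u) (T 0).
  have h3 := lT u 0; rewrite subr0 in h3.
  have h4 : 2 * enorm (T 0) + 1 <= enorm u * (1 - q) by rewrite -ler_pdivrMr.
  exact: residual_arith h1 h2 h3 h4.
have [||u _ umin] := @EVT_min_rV R d g (box M) _ _ (continuous_subspaceT cg).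
- by exists 0 => j; rewrite /seg/= in_itv/= mxE oppr_le0 M0.
- exact: compact_box.
have gu w : g u <= g w.
  have [wM|wM] := pselect (box M w); first by have := umin w; rewrite inE; apply.
  have [j Hj] : exists j, ~ seg M (w 0 j) by apply/existsNP.
  have hw : M <= enorm w.
    apply: le_trans (coord_le_enorm w j); rewrite leNgt; apply/negP => hl; apply: Hj.
    by move: hl; rewrite ltr_norml /seg/= in_itv/= => /andP[? ?]; rewrite !ltW.
  apply: le_trans (gM w hw); have := umin 0; rewrite inE; apply.
  by move=> i; rewrite /seg/= in_itv/= mxE oppr_le0 M0.
(* Minimality against [T u] gives [g u <= g (T u) <= q * g u] with [q < 1], hence [g u = 0]. *)
exists u; have h1 := gu (T u); have h2 := lT u (T u).
have gu0 : g u = 0.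
  apply/eqP; rewrite eq_le enorm_ge0 andbT -(pmulr_rle0 _ q1) mulrBl mul1r subr_le0.
  exact: le_trans h1 h2.
by apply/eqP; rewrite -subr_eq0; apply/eqP/dotv_eq0; rewrite enormE -/(g u) gu0 expr0n.
Qed.

Definition prox_grad t x : 'rV[R]_d := xget 0 [set u | u = v (x - t *: u)].
Local Notation u := prox_grad.

Lemma prox_gradE t x : 0 <= t <= tb -> u t x = v (x - t *: u t x).
Proof.
move=> ht; rewrite {1}/prox_grad; case: xgetP => [w -> //|nw].
by have [w wE] := prox_exists x ht; have := nw w.
Qed.

(** The objective of the Moreau envelope at its proximal point [x - t *: u t x], rescaled so as to
    make sense at [t = 0]. *)
Definition envelope t x : R := U (x - t *: u t x) + t / 2 * enorm (u t x) ^+ 2.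
Local Notation M := envelope.

(** The gradient of [U] at the proximal point is [u], so [descent] there leaves the surplus
    [t / 2 * (1 - L * t) * |u - w|^2], which is nonnegative. *)
Lemma envelope_le t x w : 0 <= t <= tb ->
  M t x <= U (x - t *: w) + t / 2 * enorm w ^+ 2.
Proof.
move=> ht; have /andP[t0 t1] := ht; rewrite /M.
set u0 := u t x; have uE : v (x - t *: u0) = u0 by rewrite -prox_gradE.
have := descent (x - t *: u0) (t *: (u0 - w)).
have -> : x - t *: u0 + t *: (u0 - w) = x - t *: w.
  by rewrite scalerBr addrA subrK.
rewrite uE enormZ exprMn (ger0_norm t0) dotvZr dotvBr enormE ler_norml => /andP[h _].
have Lt : L * t <= 1.
  by apply: le_trans (ltW Ltb); rewrite ler_wpM2l// ltW.
apply: (envelope_arith t0 Lt (sqr_ge0 (enorm (u0 - w))) _ h).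
by rewrite -!enormE dotvBr !dotvBl (dotvC w u0); ring.
Qed.

Lemma moreauE t x : 0 <= t <= tb -> moreau U t x = M t x.
Proof.
move=> ht; rewrite /moreau; case: eqVneq => [->|tn0].
  by rewrite /M scale0r subr0 !mul0r addr0.
have /andP[t0 t1] := ht.
have tp : 0 < t by rewrite lt_def tn0.
(* [envelope_le] at [w = (x - y) / t]. This also shows that the set is bounded below, so that [inf]
   is a genuine infimum. *)
have lb y : M t x <= U y + (2 * t)^-1 * enorm (x - y) ^+ 2.
  have := envelope_le x (t^-1 *: (x - y)) ht.
  rewrite scalerA divff// scale1r subKr enormZ exprMn (gtr0_norm (_ : 0 < t^-1)) ?invr_gt0//.
  by have -> : t / 2 * (t^-1 ^+ 2 * enorm (x - y) ^+ 2) =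
    (2 * t)^-1 * enorm (x - y) ^+ 2 by field.
apply/eqP; rewrite eq_le; apply/andP; split.
  have -> : M t x = U (x - t *: u t x) +
      (2 * t)^-1 * enorm (x - (x - t *: u t x)) ^+ 2.
    by rewrite subKr enormZ exprMn (gtr0_norm tp) /M; congr (_ + _); field.
  apply: ge_inf; last by exists (x - t *: u t x).
  by exists (M t x) => _ [y _ <-].
apply: lb_le_inf; first by exists (U x + (2 * t)^-1 * enorm (x - x) ^+ 2); exists x.
by move=> _ [y _ <-].
Qed.

(** The fixed-point equation has [u] on both sides, so its estimates take the form
    [X <= Y + L * tb * X]; [absorb] solves them at the price of [kap]. *)
Let kap := (1 - L * tb)^-1.
Let L' := L * kap.

Let kap0 : 0 < kap. Proof. by rewrite invr_gt0 subr_gt0. Qed.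

Let absorb (X Y : R) : X <= Y + L * tb * X -> X <= kap * Y.
Proof. by move=> h; rewrite ler_pdivlMl ?subr_gt0//; lra. Qed.

Let Lt t (X : R) : 0 <= t <= tb -> 0 <= X -> L * (t * X) <= L * tb * X.
Proof.
by move=> /andP[t0 t1] X0; rewrite mulrA ler_wpM2r// ler_wpM2l// ltW.
Qed.

Lemma prox_grad_lipschitz t : 0 <= t <= tb -> lipschitz_with L' (u t).
Proof.
move=> ht x y; rewrite /L' [L * _]mulrC -mulrA; apply: absorb.
rewrite {1}(prox_gradE x ht) {1}(prox_gradE y ht).
apply: le_trans (lv _ _) _.
have /andP[t0 t1] := ht.
rewrite subrBB -scalerBr.
apply: (@le_trans _ _ (L * (enorm (x - y) + t * enorm (u t x - u t y)))).
  rewrite ler_wpM2l ?(ltW L0)//; apply: le_trans (enormD _ _) _.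
  by rewrite enormN enormZ (ger0_norm t0).
by rewrite mulrDr lerD2l Lt// enorm_ge0.
Qed.

Lemma prox_grad_le t x : 0 <= t <= tb -> enorm (u t x) <= kap * enorm (v x).
Proof.
move=> ht; apply: absorb; rewrite {1}(prox_gradE x ht).
apply: le_trans (enormB_le _ (v x)) _; rewrite lerD2l.
apply: le_trans (lv _ _) _; have /andP[t0 t1] := ht.
by rewrite addrAC subrr add0r enormN enormZ (ger0_norm t0) Lt// enorm_ge0.
Qed.

Lemma grad_le x : enorm (v x) <= enorm (v 0) + L * enorm x.
Proof.
by apply: le_trans (enormB_le _ (v 0)) _; rewrite lerD2l -[X in L * enorm X]subr0.
Qed.

Lemma prox_grad_time s t x : 0 <= s <= tb -> 0 <= t <= tb ->
  enorm (u s x - u t x) <= L' * `|s - t| * enorm (u t x).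
Proof.
move=> hs ht; rewrite /L' [L * _]mulrC -!mulrA; apply: absorb.
rewrite {1}(prox_gradE x hs) {1}(prox_gradE x ht).
apply: le_trans (lv _ _) _.
have -> : x - s *: u s x - (x - t *: u t x) =
   - (s *: (u s x - u t x) + (s - t) *: u t x).
  by rewrite subrBB subrr sub0r scalerBr scalerBl addrA subrK.
have /andP[s0 s1] := hs.
apply: (@le_trans _ _ (L * (s * enorm (u s x - u t x) + `|s - t| * enorm (u t x)))).
  rewrite ler_wpM2l ?(ltW L0)// enormN; apply: le_trans (enormD _ _) _.
  by rewrite !enormZ (ger0_norm s0).
by rewrite mulrDr addrC lerD2l Lt// enorm_ge0.
Qed.

(** Testing the envelope at [x + h] with the [u] of [x] gives the upper bound. The lower bound is
    the same estimate started from [x + h], corrected by the Lipschitz continuity of [u]. *)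
Lemma envelope_expansion t x h : 0 <= t <= tb ->
  `|M t (x + h) - M t x - dotv (u t x) h| <= (L / 2 + L') * enorm h ^+ 2.
Proof.
move=> ht; have L'0 : 0 <= L' by rewrite mulr_ge0// ltW.
have up y k : M t (y + k) - M t y <= dotv (u t y) k + L / 2 * enorm k ^+ 2.
  have h1 := envelope_le (y + k) (u t y) ht.
  have := descent (y - t *: u t y) k.
  rewrite -(prox_gradE y ht) [y - _ + k]addrAC ler_norml => /andP[_ h2].
  exact: expansion_ub_arith h1 h2.
have h1 := up x h; have := up (x + h) (- h).
rewrite addrK enormN => h2.
have h3 : `|dotv (u t (x + h) - u t x) h| <= L' * enorm h ^+ 2.
  apply: le_trans (dotv_norm_le _ _) _; rewrite expr2 mulrA ler_wpM2r ?enorm_ge0//.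
  by have := prox_grad_lipschitz ht (x + h) x; rewrite addrAC subrr add0r.
have e1 : dotv (u t (x + h)) (- h) = - dotv (u t (x + h)) h.
  by rewrite -scaleN1r dotvZr mulN1r.
rewrite e1 in h2; rewrite dotvBl in h3; rewrite mulrDl.
exact: expansion_arith h1 h2 h3.
Qed.

(** Testing time [s] with the [u] of time [t] moves the point by [(s - t) u], which contributes
    [- (s - t) |u|^2], while the penalty contributes half of that with the opposite sign. Exchanging
    [s] and [t] gives the other side. *)
Lemma envelope_time s t x : 0 <= s <= tb -> 0 <= t <= tb ->
  `|M s x - M t x + (s - t) / 2 * enorm (u t x) ^+ 2| <=
  (L / 2 + L') * (kap * enorm (v x)) ^+ 2 * (s - t) ^+ 2.
Proof.
have up s' t' : 0 <= s' <= tb -> 0 <= t' <= tb ->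
    M s' x - M t' x <= - ((s' - t') / 2 * enorm (u t' x) ^+ 2) +
      L / 2 * ((s' - t') ^+ 2 * enorm (u t' x) ^+ 2).
  move=> hs ht; have h1 := envelope_le x (u t' x) hs.
  have := descent (x - t' *: u t' x) (- ((s' - t') *: u t' x)).
  rewrite -(prox_gradE x ht).
  have -> : x - t' *: u t' x - (s' - t') *: u t' x = x - s' *: u t' x.
    by rewrite -addrA -opprD -scalerDl [t' + _]addrC subrK.
  rewrite enormN enormZ exprMn real_normK ?num_real//.
  have -> : dotv (u t' x) (- ((s' - t') *: u t' x)) =
      - (s' - t') * enorm (u t' x) ^+ 2 by rewrite -scaleNr dotvZr enormE.
  rewrite ler_norml => /andP[_ h2].
  exact: time_ub_arith h1 h2.
move=> hs ht; have h1 := up s t hs ht; have h2 := up t s ht hs.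
set G := kap * enorm (v x).
have G0 : 0 <= G by rewrite mulr_ge0 ?enorm_ge0// ltW.
have us := prox_grad_le x hs; have ut := prox_grad_le x ht.
have ust := prox_grad_time x hs ht.
have us0 := enorm_ge0 (u s x); have ut0 := enorm_ge0 (u t x).
have L'0 : 0 <= L' by rewrite mulr_ge0// ltW.
have hX : 0 <= enorm (u s x) <= G by apply/andP; split; [exact: us0|exact: us].
have hY : 0 <= enorm (u t x) <= G by apply/andP; split; [exact: ut0|exact: ut].
have hXY : `|enorm (u s x) - enorm (u t x)| <= L' * `|s - t| * G.
  have d1 := enormB_le (u s x) (u t x).
  have d2 := enormB_le (u t x) (u s x); rewrite enormBC in d2.
  apply: (@le_trans _ _ (enorm (u s x - u t x))).
    by rewrite ler_norml lerBlDl d1 andbT lerNl opprB lerBlDl.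
  apply: le_trans ust _; apply: ler_wpM2l; last exact: ut.
  exact: mulr_ge0 L'0 (normr_ge0 _).
exact: (time_arith (ltW L0) L'0 G0 hX hY hXY h1 h2).
Qed.

Section growth.
Variables (a b r : R).
Hypothesis hd : dissipative_with a b r v.

Lemma dissipative_potential_lb : exists2 C, 0 <= C &
  forall x, a / 4 * dotv x x - C <= U x.
Proof.
have [a0 b0 r0 hv] := hd.
pose C1 := enorm (v 0) + L * r + a * r.
have C10 : 0 <= C1.
  by rewrite !addr_ge0 ?enorm_ge0// mulr_ge0// ltW.
exists (C1 ^+ 2 / a + `|U 0|).
  by rewrite addr_ge0// divr_ge0 ?sqr_ge0// ltW.
(* The constant loss [b] is traded for a loss linear in [|z|]: at [z = c *: x] the estimate is
   divided by [c], and only such a loss stays bounded as [c] tends to 0. *)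
have radial z : a * enorm z ^+ 2 - C1 * enorm z <= dotv (v z) z.
  have [zr|zr] := ltP (enorm z) r; last first.
    have := hv z; rewrite indicE memNset/=; last by rewrite ltNge zr.
    rewrite mulr0 subr0 dotvC => h; apply: le_trans h.
    by rewrite lerBlDr lerDl mulr_ge0// enorm_ge0.
  have z0 := enorm_ge0 z.
  have h1 : - (enorm (v z) * enorm z) <= dotv (v z) z.
    by have := dotv_norm_le (v z) z; rewrite ler_norml => /andP[].
  have h2 : enorm (v z) <= enorm (v 0) + L * r.
    by apply: le_trans (grad_le z) _; rewrite lerD2l ler_wpM2l// ltW.
  have h3 : enorm (v z) * enorm z <= (enorm (v 0) + L * r) * enorm z by rewrite ler_wpM2r.
  have h4 : a * enorm z ^+ 2 <= a * r * enorm z.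
    by rewrite expr2 mulrA ler_wpM2r// ler_wpM2l// ltW.
  exact: radial_arith h1 h3 h4.
move=> x; have [c /andP[c0 c1]] := path_MVT 0 x (- (C1 * enorm x)) (a * enorm x ^+ 2).
rewrite !add0r => E.
have h1 : 0 <= dotv (v (c *: x)) x - - (C1 * enorm x) - a * enorm x ^+ 2 * c.
  have := radial (c *: x); rewrite enormZ (gtr0_norm c0) dotvZr exprMn.
  exact: ray_arith.
have h2 : C1 * enorm x <= a / 4 * enorm x ^+ 2 + C1 ^+ 2 / a.
  rewrite -subr_ge0.
  have -> : a / 4 * enorm x ^+ 2 + C1 ^+ 2 / a - C1 * enorm x =
     a^-1 * (a / 2 * enorm x - C1) ^+ 2 by field; exact: lt0r_neq0.
  by rewrite mulr_ge0 ?sqr_ge0// invr_ge0 ltW.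
rewrite enormE; exact: growth_arith E h1 h2.
Qed.

Let split_sq t x : 0 <= t <= tb -> enorm x ^+ 2 <=
  2 * enorm (x - t *: u t x) ^+ 2 + 2 * tb * (t * enorm (u t x) ^+ 2).
Proof.
move=> /andP[t0 t1].
have h : enorm x <= enorm (x - t *: u t x) + t * enorm (u t x).
  have -> : t * enorm (u t x) = enorm (t *: u t x) by rewrite enormZ ger0_norm.
  by rewrite -{1}(subrK (t *: u t x) x); exact: enormD.
by apply: split_arith h => //; exact: enorm_ge0.
Qed.

Lemma envelope_lb : exists k C, [/\ 0 < k, 0 <= C &
  forall t x, 0 <= t <= tb -> k * dotv x x - C <= M t x].
Proof.
have [a0 _ _ _] := hd; have [C C0 hC] := dissipative_potential_lb.
(* By [split_sq], [k |x|^2] is at most [2 k |y|^2 + 2 tb k t |u|^2], with [y] the proximal point.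
   The two entries keep these below [a / 4 * |y|^2] and [t / 2 * |u|^2]. *)
pose k := Num.min (a / 8) (4 * tb)^-1.
have k0 : 0 < k by rewrite lt_min divr_gt0// invr_gt0 mulr_gt0.
exists k, C; split => // t x ht; rewrite /M enormE.
have /andP[t0 t1] := ht.
have h1 := hC (x - t *: u t x); rewrite enormE in h1.
apply: (split_lb_arith h1 (split_sq x ht) (ltW k0)); first exact: sqr_ge0.
  by rewrite -ler_pdivlMr// (_ : a / 4 / 2 = a / 8) ?ge_min ?lexx//; field.
have -> : t / 2 * enorm (u t x) ^+ 2 =
    (4 * tb)^-1 * (2 * tb * (t * enorm (u t x) ^+ 2)).
  by field; exact: lt0r_neq0.
rewrite ler_wpM2r//; last by rewrite ge_min lexx orbT.
by apply: mulr_ge0; [rewrite mulr_ge0// ltW|exact: mulr_ge0 t0 (sqr_ge0 _)].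
Qed.

Lemma prox_grad_dissipative : exists a', 0 < a' /\
  forall t x, 0 <= t <= tb -> a' * enorm x ^+ 2 - b <= dotv x (u t x).
Proof.
have [a0 b0 r0 hv] := hd.
pose k := Num.min (a / 2) (2 * tb)^-1.
have k0 : 0 < k by rewrite lt_min divr_gt0// invr_gt0 mulr_gt0.
exists k; split=> // t x ht; have /andP[t0 t1] := ht.
have h1 : a * enorm (x - t *: u t x) ^+ 2 - b <= dotv (x - t *: u t x) (u t x).
  have := hv (x - t *: u t x); rewrite -(prox_gradE x ht); apply: le_trans.
  by rewrite lerD2l lerN2 ler_piMr ?(ltW b0)// indicE lern1 leq_b1.
(* Since [x] is the proximal point plus [t u], its product with [u] gains [t |u|^2], which pays for
   the displacement. *)
rewrite dotvBl dotvZl (enormE (u t x)) in h1.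
rewrite -[leRHS](subrK (t * enorm (u t x) ^+ 2)).
apply: (split_lb_arith h1 (split_sq x ht) (ltW k0)); first exact: sqr_ge0.
  by rewrite -ler_pdivlMr// ge_min lexx.
have {2}-> : t * enorm (u t x) ^+ 2 =
    (2 * tb)^-1 * (2 * tb * (t * enorm (u t x) ^+ 2)).
  by field; exact: lt0r_neq0.
rewrite ler_wpM2r//; last by rewrite ge_min lexx orbT.
by apply: mulr_ge0; [rewrite mulr_ge0// ltW|exact: mulr_ge0 t0 (sqr_ge0 _)].
Qed.

End growth.
End moreau_envelope.

(** * Gaussian domination *)

Section gaussian_domination.
Context {R : realType}.

Lemma integrable_gaussian1 (k : R) : 0 < k ->
  (@lebesgue_measure R).-integrable setT (EFin \o (fun x : R => expR (- (k * x ^+ 2)))).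
Proof.
move=> k0; pose s := Num.sqrt (2 * k)^-1.
have k20 : 0 < (2 * k)^-1 by rewrite invr_gt0 mulr_gt0.
have s0 : s != 0 by rewrite gt_eqF// sqrtr_gt0.
have s2 : s ^+ 2 = (2 * k)^-1 by rewrite sqr_sqrtr// ltW.
have := integrableZl measurableT (normal_peak s)^-1 (@integrable_normal_pdf R 0 s).
congr (_.-integrable _ _); apply/funext => x /=; congr EFin.
rewrite normal_pdfE// mulrA mulVf; last first.
  by rewrite gt_eqF// normal_peak_gt0.
rewrite mul1r /normal_fun subr0 s2; congr expR.
by field; exact: lt0r_neq0.
Qed.

Lemma continuous_gaussian d (k : R) :
  continuous (fun x : 'rV[R]_d => expR (- (k * dotv x x))).
Proof.
move=> x; apply: continuous_comp; last exact: continuous_expR.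
apply: continuousN; apply: continuous_mulr; first exact: cst_continuous.
exact: continuous_dotv.
Qed.

Lemma measurable_gaussian d (k : R) :
  measurable_fun setT (fun x : 'rV[R]_d => (expR (- (k * dotv x x)))%:E).
Proof.
apply/measurable_EFinP; apply: continuous_measurable_rV.
exact: continuous_gaussian.
Qed.

Lemma integrable_gaussian d (k : R) : 0 < k ->
  (lebesgue_rV d).-integrable setT (EFin \o (fun x : 'rV[R]_d => expR (- (k * dotv x x)))).
Proof.
move=> k0; apply/integrableP; split; first exact: measurable_gaussian.
under eq_integral do rewrite /= ger0_norm ?expR_ge0//.
elim: d => [|n IH].
  under eq_integral => x _ do rewrite (rV0_cst (fun x => expR (- (k * dotv x x)))).
  rewrite integral_cst// lte_mul_pinfty ?lee_fin ?expR_ge0//.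
  by rewrite (_ : setT = @box R 0 0)//; apply/seteqP; split => // x _ [].
have mE := @measurable_gaussian n.+1 k.
have -> : (\int[lebesgue_rV n.+1]_x (expR (- (k * dotv x x)))%:E)%E =
   (\int[(lebesgue_measure \x lebesgue_rV n)%E]_z
      (expR (- (k * dotv (cons_rV z) (cons_rV z))))%:E)%E.
  rewrite [LHS](@ge0_integral_pushforward _ _ _ _ _ _ (@measurable_cons_rV _ n)
    (lebesgue_measure \x lebesgue_rV n)%E setT)//.
rewrite fubini_tonelli1//=; last first.
  exact: measurableT_comp mE (@measurable_cons_rV _ n).
rewrite /fubini_F.
have E (t : R) (w : 'rV[R]_n) : expR (- (k * dotv (cons_rV (t, w)) (cons_rV (t, w)))) =
    expR (- (k * t ^+ 2)) * expR (- (k * dotv w w)).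
  rewrite -expRD; congr expR; rewrite /dotv big_ord_recl !cons_rV0.
  under eq_bigr do rewrite !cons_rVS.
  ring.
under eq_integral => t _.
  under eq_integral => w _ do rewrite E EFinM.
  rewrite ge0_integralZl//; last exact: measurable_gaussian.
  over.
have /integrableP[m1 i1] := integrable_gaussian1 k0.
rewrite ge0_integralZr//; last first.
  by apply: integral_ge0 => w _; rewrite lee_fin expR_ge0.
apply: lte_mul_pinfty => //.
- by apply: integral_ge0 => w _; rewrite lee_fin expR_ge0.
- rewrite ge0_fin_numE; last by apply: integral_ge0 => w _; rewrite lee_fin expR_ge0.
  apply: le_lt_trans i1; rewrite le_eqVlt; apply/orP; left; apply/eqP.
  by apply: eq_integral => t _; rewrite /= ger0_norm ?expR_ge0.
Qed.

Lemma gaussian_dominated d (h : 'rV[R]_d -> R) (c k : R) : 0 < k -> continuous h ->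
  (forall x, `|h x| <= c * expR (- (k * dotv x x))) ->
  (lebesgue_rV d).-integrable setT (EFin \o h) /\
  `|\int[lebesgue_rV d]_x h x| <= c * \int[lebesgue_rV d]_x expR (- (k * dotv x x)).
Proof.
move=> k0 ch hb.
have mh : measurable_fun setT (EFin \o h).
  by apply/measurable_EFinP; exact: continuous_measurable_rV.
have ig := integrableZl measurableT c (@integrable_gaussian d _ k0).
have ih : (lebesgue_rV d).-integrable setT (EFin \o h).
  apply: le_integrable ig => // x _.
  by rewrite /= lee_fin (le_trans (hb x))// ler_norm.
split=> //; apply: le_trans (le_normr_Rintegral _ ih) _ => //.
rewrite -RintegralZl//; last exact: integrable_gaussian.
by apply: le_Rintegral => //; exact: integrable_norm ih.
Qed.

(** Half of the exponent absorbs the polynomial: [1 + q <= (1 + 4 / k) * expR (k / 4 * q)], then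
    squared. *)
Lemma one_add_sqr_gaussian (k q : R) : 0 < k -> 0 <= q ->
  (1 + q) ^+ 2 * expR (- (k * q)) <= (1 + 4 / k) ^+ 2 * expR (- (k / 2 * q)).
Proof.
move=> k0 q0; have kq : 0 <= k / 4 * q by rewrite mulr_ge0// divr_ge0// ltW.
have k4 : 0 <= 4 / k by rewrite divr_ge0// ltW.
have h : 1 + q <= (1 + 4 / k) * expR (k / 4 * q).
  have := expR_ge1Dx (k / 4 * q) => h1.
  apply: (@le_trans _ _ ((1 + 4 / k) * (1 + k / 4 * q))).
    have -> : (1 + 4 / k) * (1 + k / 4 * q) = 1 + q + (4 / k + k / 4 * q).
      by field; exact: lt0r_neq0.
    by rewrite lerDl addr_ge0.
  by rewrite ler_wpM2l// addr_ge0.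
have h2 : (1 + q) ^+ 2 <= ((1 + 4 / k) * expR (k / 4 * q)) ^+ 2.
  by rewrite ler_pXn2r ?nnegrE ?addr_ge0// mulr_ge0 ?expR_ge0// addr_ge0.
apply: (@le_trans _ _ (((1 + 4 / k) * expR (k / 4 * q)) ^+ 2 * expR (- (k * q)))).
  by rewrite ler_wpM2r ?expR_ge0.
rewrite exprMn -[leLHS]mulrA ler_wpM2l ?sqr_ge0// expr2 -!expRD ler_expR.
by rewrite le_eqVlt; apply/orP; left; apply/eqP; field.
Qed.

End gaussian_domination.

(** * Quantitative first-order expansions *)

Section derivative_estimates.
Context {R : realType}.

(** The remainder is shaped for multiplication by [expR (- m0)] with [y = m0 - m1]: it becomes a sum
    of two weights, each under the same Gaussian. *)
Lemma expR_sub1_le (y : R) : `|expR y - 1 - y| <= y ^+ 2 * (1 + expR y).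
Proof.
have h1 := expR_ge1Dx y; have h2 := expR_ge1Dx (- y).
have e0 := expR_gt0 y.
have h3 : (1 - y) * expR y <= 1.
  have := ler_wpM2r (ltW e0) h2; rewrite -expRD addNr expR0; lra.
rewrite ger0_norm; last lra.
have [y0|y0] := leP 0 y.
  have : y * (expR y - 1) <= y * (y * expR y) by rewrite ler_wpM2l//; lra.
  have := sqr_ge0 y; rewrite expr2; lra.
have : (- y) * (1 - expR y) <= (- y) * (- y) by rewrite ler_wpM2l//; lra.
have : 0 <= y ^+ 2 * expR y by rewrite mulr_ge0 ?sqr_ge0// ltW.
rewrite expr2; lra.
Qed.

Lemma ln_linearization (z0 y z : R) : 0 < z0 -> z0 <= y -> z0 <= z ->
  `|ln y - ln z - (y - z) / z| <= (y - z) ^+ 2 / z0 ^+ 2.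
Proof.
move=> z00 zy zz; have y0 : 0 < y by exact: lt_le_trans zy.
have zp : 0 < z by exact: lt_le_trans zz.
have h1 : ln y - ln z <= (y - z) / z.
  rewrite -ln_div ?posrE//; apply: le_trans (ln_le_subr1 (divr_gt0 y0 zp)) _.
  by rewrite mulrBl divff// lt0r_neq0.
have h2 : (y - z) / y <= ln y - ln z.
  rewrite -[leRHS]opprB -ln_div ?posrE// lerNr.
  apply: le_trans (ln_le_subr1 (divr_gt0 zp y0)) _.
  by rewrite mulrBl divff ?opprB// lt0r_neq0.
have h3 : (y - z) / z - (y - z) / y <= (y - z) ^+ 2 / z0 ^+ 2.
  have -> : (y - z) / z - (y - z) / y = (y - z) ^+ 2 / (y * z).
    by field; rewrite !lt0r_neq0.
  rewrite ler_wpM2l ?sqr_ge0// lef_pV2 ?posrE ?exprn_gt0 ?mulr_gt0//.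
  by rewrite expr2 ler_pM// ltW.
rewrite ler0_norm; lra.
Qed.

Lemma is_derive_within_quadratic (I : set R) (g : R -> R) (t l K : R) : I t ->
  (forall s, I s -> `|g s - g t - (s - t) * l| <= K * (s - t) ^+ 2) ->
  is_derive_within I g t l.
Proof.
move=> It hg; apply/cvgrPdist_le => e e0; rewrite !near_withinE ?near_simpl.
have K0 : 0 < `|K| + 1 by rewrite ltr_wpDl.
near=> s => st Is.
have st0 : s - t != 0 by rewrite subr_eq0.
have -> : l - (g s - g t) / (s - t) = - ((g s - g t - (s - t) * l) / (s - t)).
  by field.
rewrite normrN normrM normfV ler_pdivrMr ?normr_gt0//.
apply: le_trans (hg s Is) _.
apply: (@le_trans _ _ ((`|K| + 1) * `|s - t| * `|s - t|)).
  rewrite -mulrA -expr2 real_normK ?num_real// ler_wpM2r ?sqr_ge0//.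
  by have := ler_norm K; lra.
rewrite ler_wpM2r// -ler_pdivlMl// distrC; near: s.
by apply: cvgr_dist_le => //; rewrite mulr_gt0 ?invr_gt0.
Unshelve. all: by end_near. Qed.

End derivative_estimates.

(** * Time derivative of the weight, of the normalising constant and of the potential *)

Section partition_function_derivative.
Context {R : realType}.

Lemma time_weight_arith (m0 m1 s t H K3 K1 q g : R) (w := m1 - m0) :
  0 <= H -> 0 <= q -> 0 <= g -> expR (- m0) <= g -> expR (- m1) <= g ->
  1 <= q -> 0 <= K1 -> `|w| <= `|s - t| * (K3 * q) ->
  `|w + (s - t) * H| <= K1 * q * (s - t) ^+ 2 ->
  `|expR (- m1) - expR (- m0) - (s - t) * (H * expR (- m0))| <=
    (2 * K3 ^+ 2 + K1) * (q ^+ 2 * g) * (s - t) ^+ 2.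
Proof.
move=> H0 q0 g0 g1 g2 q1 K10 hw hq.
have e1 : expR (- m1) = expR (- m0) * expR (- w).
  by rewrite -expRD; congr expR; rewrite /w; ring.
have e0 := expR_gt0 (- m0).
have -> : expR (- m1) - expR (- m0) - (s - t) * (H * expR (- m0)) =
    expR (- m0) * (expR (- w) - 1 - - w) - expR (- m0) * (w + (s - t) * H).
  by rewrite e1; ring.
apply: le_trans (ler_normB _ _) _; rewrite !normrM (gtr0_norm e0).
have h1 : expR (- m0) * `|expR (- w) - 1 - - w| <= w ^+ 2 * (g + g).
  apply: (@le_trans _ _ (expR (- m0) * ((- w) ^+ 2 * (1 + expR (- w))))).
    by rewrite ler_pM2l// expR_sub1_le.
  rewrite sqrrN mulrCA ler_wpM2l ?sqr_ge0// mulrDr mulr1 -e1; exact: lerD.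
have h2 : w ^+ 2 <= (s - t) ^+ 2 * (K3 ^+ 2 * q ^+ 2).
  rewrite -exprMn -[leLHS]real_normK ?num_real// -[(s - t) ^+ 2]real_normK ?num_real//.
  rewrite -exprMn ler_pXn2r ?nnegrE//.
  exact: le_trans (normr_ge0 _) hw.
have h3 : expR (- m0) * `|w + (s - t) * H| <= g * (K1 * q * (s - t) ^+ 2).
  by apply: ler_pM => //; exact: ltW.
have h4 : w ^+ 2 * (g + g) <= (s - t) ^+ 2 * (K3 ^+ 2 * q ^+ 2) * (g + g).
  by rewrite ler_wpM2r// addr_ge0.
have h5 : g * (K1 * q * (s - t) ^+ 2) <= g * (K1 * q ^+ 2 * (s - t) ^+ 2).
  rewrite ler_wpM2l// ler_wpM2r ?sqr_ge0// ler_wpM2l//.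
  by rewrite expr2 ler_peMr.
apply: (@le_trans _ _ ((s - t) ^+ 2 * (K3 ^+ 2 * q ^+ 2) * (g + g) +
   g * (K1 * q ^+ 2 * (s - t) ^+ 2))).
  by apply: lerD; [exact: le_trans h1 h4|exact: le_trans h3 h5].
by rewrite le_eqVlt; apply/orP; left; apply/eqP; ring.
Qed.

Lemma potential_time_arith (m0 m1 z0 z1 zm d h s t A B C : R) :
  0 < zm -> zm <= z0 -> zm <= z1 -> 0 <= C ->
  `|m1 - m0 + (s - t) * h| <= A * (s - t) ^+ 2 ->
  `|z1 - z0 - (s - t) * d| <= B * (s - t) ^+ 2 ->
  `|z1 - z0| <= C * `|s - t| ->
  `|m1 + ln z1 - (m0 + ln z0) - (s - t) * (d / z0 - h)| <=
    (A + C ^+ 2 / zm ^+ 2 + B / zm) * (s - t) ^+ 2.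
Proof.
move=> zm0 hz0 hz1 C0 h1 h2 h3; have l := ln_linearization zm0 hz1 hz0.
have z00 : 0 < z0 by exact: lt_le_trans hz0.
have -> : m1 + ln z1 - (m0 + ln z0) - (s - t) * (d / z0 - h) =
   (m1 - m0 + (s - t) * h) + (ln z1 - ln z0 - (z1 - z0) / z0) +
   (z1 - z0 - (s - t) * d) / z0 by field; exact: lt0r_neq0.
apply: le_trans (ler_normD _ _) _.
rewrite [leRHS]mulrDl [X in _ <= X + _]mulrDl; apply: lerD.
  apply: le_trans (ler_normD _ _) _; apply: lerD => //.
  apply: le_trans l _; rewrite [leRHS]mulrAC ler_wpM2r ?invr_ge0 ?sqr_ge0//.
  rewrite -[leLHS]real_normK ?num_real// -[(s - t) ^+ 2]real_normK ?num_real//.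
  by rewrite -exprMn ler_pXn2r ?nnegrE// mulr_ge0.
rewrite normrM normfV (gtr0_norm z00) [leRHS]mulrAC.
apply: ler_pM => //; first by rewrite invr_ge0 ltW.
by rewrite lef_pV2 ?posrE.
Qed.

(** Giving up half of [a] confines the loss [b] to a ball: beyond the radius [1 + 2 * b / a] one has
    [e ^+ 2 >= e >= 2 * b / a]. *)
Lemma dissipative_indicator_arith (a b e : R) : 0 < a -> 0 < b -> 0 <= e ->
  a / 2 * e ^+ 2 - b * (e < 1 + 2 * b / a)%R%:R <= a * e ^+ 2 - b.
Proof.
move=> a0 b0 e0; have h : 0 <= a / 2 * e ^+ 2 by rewrite mulr_ge0 ?sqr_ge0// divr_ge0// ltW.
have h' : a * e ^+ 2 = a / 2 * e ^+ 2 + a / 2 * e ^+ 2 by field.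
rewrite h'; case: ltP => [_|he]; first by rewrite mulr1; lra.
have ba : 0 < 2 * b / a by rewrite divr_gt0// mulr_gt0.
have e2 : 2 * b / a <= e ^+ 2.
  apply: (@le_trans _ _ e); first lra.
  by rewrite expr2 ler_peMr//; lra.
have : a / 2 * (2 * b / a) <= a / 2 * e ^+ 2 by rewrite ler_wpM2l// divr_ge0// ltW.
have -> : a / 2 * (2 * b / a) = b by field; exact: lt0r_neq0.
rewrite mulr0; lra.
Qed.

Lemma shift_arith (y0 y1 z l e : R) :
  `|y1 - y0 - l| <= e -> `|y1 + z - (y0 + z) - l| <= e.
Proof. by rewrite opprD addrACA subrr addr0. Qed.

Lemma potential_bound_gt0 (C AU n0 n1 G : R) :
  0 <= C -> 0 <= AU -> 0 <= n0 -> 0 <= n1 -> 0 <= G -> 0 < C + AU + n0 + n1 + G + 1.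
Proof. lra. Qed.

Lemma potential_lb_arith (C AU n0 n1 G m l : R) :
  0 <= AU -> 0 <= n1 -> 0 <= G -> - C <= m -> - n0 <= l ->
  - (C + AU + n0 + n1 + G + 1) <= m + l.
Proof. lra. Qed.

Lemma potential_ub_arith (C AU n0 n1 G m l q : R) :
  0 <= C -> 0 <= n0 -> 0 <= G -> 1 <= q -> 0 <= n1 -> m <= AU * q -> l <= n1 ->
  m + l <= (C + AU + n0 + n1 + G + 1) * q.
Proof.
move=> C0 n00 G0 q1 n10 h1 h2.
have -> : (C + AU + n0 + n1 + G + 1) * q = AU * q + n1 * q + (C + n0 + G + 1) * q by ring.
have h3 : n1 <= n1 * q by rewrite ler_peMr.
have h4 : 0 <= (C + n0 + G + 1) * q by apply: mulr_ge0; lra.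
lra.
Qed.

Lemma gradient_ub_arith (C AU n0 n1 G q : R) :
  0 <= C -> 0 <= AU -> 0 <= n0 -> 0 <= n1 -> 0 <= q ->
  (1 + G) * q <= (C + AU + n0 + n1 + G + 1) * q.
Proof. by move=> *; rewrite ler_wpM2r//; lra. Qed.

End partition_function_derivative.

(** * The Path Assumption for the Moreau path *)

Section moreau_path_assumption.
Context {R : realType} {d : nat} (U : 'rV[R]_d -> R) (L tb : R).
Local Notation v := (grad U).
Local Notation mu := (lebesgue_rV d).
Hypotheses (L0 : 0 < L) (tb0 : 0 < tb) (Ltb : L * tb < 1).
Hypothesis dU : forall x, differentiable U x.
Hypothesis lv : lipschitz_with L v.
Variables (a b r : R).
Hypothesis hd : dissipative_with a b r v.

Local Notation M := (envelope U).
Local Notation u := (prox_grad U).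
Let I : set R := [set t | 0 <= t <= tb].
Let kap := (1 - L * tb)^-1.
Let L' := L * kap.
Let kap0 : 0 < kap. Proof. by rewrite invr_gt0 subr_gt0. Qed.
Let L'0 : 0 < L'. Proof. exact: mulr_gt0. Qed.
Let q (x : 'rV[R]_d) := 1 + dotv x x.
Let q1 x : 1 <= q x. Proof. by rewrite lerDl dotv_ge0. Qed.
Let q0 x : 0 <= q x. Proof. by apply: le_trans (q1 x). Qed.

Let C1_envelope t : I t -> C1 (M t) /\ forall j x, partial j (M t) x = u t x 0 j.
Proof.
move=> It; apply: (@C1_of_expansion _ _ _ _ (L / 2 + L')).
  by move=> x h; exact: envelope_expansion.
by exists L'; exact: prox_grad_lipschitz.
Qed.

Let cM t : I t -> continuous (M t). Proof. by move=> /C1_envelope[[]]. Qed.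

Let I0 : I 0. Proof. by rewrite /I/= lexx ltW. Qed.

Let M_le_U t x : I t -> M t x <= U x.
Proof.
move=> It; have := envelope_le L0 tb0 Ltb dU lv x 0 It.
by rewrite scaler0 subr0 enorm0 expr0n mulr0 addr0.
Qed.

Let cU : continuous U.
Proof. by move=> x; exact: differentiable_continuous. Qed.

Let enorm_le_q x : enorm x <= q x.
Proof.
rewrite /q enormE; have := enorm_ge0 x; move: (enorm x) => y y0.
have : 0 <= (y - 1) ^+ 2 by exact: sqr_ge0.
rewrite sqrrB expr1n; lra.
Qed.

Let abs_growth_arith (U0 Ux D X Q n0 c : R) : Ux - U0 - D <= c * X -> X <= Q ->
  `|D| <= n0 * Q -> 1 <= Q -> 0 <= c -> Ux <= (`|U0| + n0 + c) * Q.
Proof.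
move=> h XQ hD Q1 c0; have h1 : `|U0| <= `|U0| * Q by rewrite ler_peMr.
have h2 : c * X <= c * Q by rewrite ler_wpM2l.
have h3 := ler_norm U0; have h4 := ler_norm D; rewrite !mulrDl; lra.
Qed.

Let U_ub : exists2 A, 0 <= A & forall x, U x <= A * q x.
Proof.
exists (`|U 0| + enorm (v 0) + L / 2).
  by rewrite !addr_ge0 ?enorm_ge0// divr_ge0// ltW.
move=> x; have := descent dU lv 0 x; rewrite add0r ler_norml => /andP[_ h].
apply: (abs_growth_arith h _ _ (q1 x)).
- by rewrite -enormE lerDr.
- apply: le_trans (dotv_norm_le _ _) _; apply: ler_wpM2l; first exact: enorm_ge0.
  exact: enorm_le_q.
- by rewrite divr_ge0// ltW.
Qed.

Let sqr_growth_arith (n0 X Q k : R) : 0 <= n0 -> 0 <= X -> X ^+ 2 <= Q -> 1 <= Q ->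
  0 <= k -> (k * (n0 + L * X)) ^+ 2 <= k ^+ 2 * (2 * n0 ^+ 2 + 2 * L ^+ 2) * Q.
Proof.
move=> n00 X0 XQ Q1 k0; rewrite exprMn -mulrA ler_wpM2l ?sqr_ge0//.
have h1 : n0 ^+ 2 <= n0 ^+ 2 * Q by rewrite ler_peMr// sqr_ge0.
have h2 : L ^+ 2 * X ^+ 2 <= L ^+ 2 * Q by rewrite ler_wpM2l// sqr_ge0.
have h3 : 0 <= (n0 - L * X) ^+ 2 by exact: sqr_ge0.
rewrite sqrrB exprMn in h3; rewrite sqrrD exprMn mulrDl -!mulrA; lra.
Qed.

Let G := kap ^+ 2 * (2 * enorm (v 0) ^+ 2 + 2 * L ^+ 2).

Let G0 : 0 <= G.
Proof. by rewrite mulr_ge0 ?sqr_ge0// addr_ge0// mulr_ge0// sqr_ge0. Qed.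

Let v_sqr_le x : (kap * enorm (v x)) ^+ 2 <= G * q x.
Proof.
apply: (@le_trans _ _ ((kap * (enorm (v 0) + L * enorm x)) ^+ 2)).
  have h : kap * enorm (v x) <= kap * (enorm (v 0) + L * enorm x).
    by rewrite ler_pM2l//; exact: grad_le.
  have p1 : 0 <= kap * enorm (v x) := mulr_ge0 (ltW kap0) (enorm_ge0 _).
  by rewrite ler_pXn2r ?nnegrE// (le_trans p1).
apply: sqr_growth_arith (q1 x) (ltW kap0); try exact: enorm_ge0.
by rewrite -enormE lerDr.
Qed.

Let u_sqr_le t x : I t -> enorm (u t x) ^+ 2 <= G * q x.
Proof.
move=> It; apply: le_trans (v_sqr_le x).
have p1 : 0 <= kap * enorm (v x) := mulr_ge0 (ltW kap0) (enorm_ge0 _).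
rewrite ler_pXn2r ?nnegrE ?enorm_ge0//; exact: prox_grad_le.
Qed.

Let u_le t x : I t -> enorm (u t x) <= (1 + G) * q x.
Proof.
move=> It; have h := u_sqr_le x It; have Q1 := q1 x.
have := enorm_ge0 (u t x); move: h Q1; move: (enorm (u t x)) (q x) => y Q h Q1 y0.
have : 0 <= (y - 1) ^+ 2 by exact: sqr_ge0.
rewrite sqrrB expr1n mulrDl => ?; lra.
Qed.

Let Z t := \int[mu]_x expR (- M t x).

Let gauss (k : R) := \int[mu]_x expR (- (k * dotv x x)).

Let gauss_ge0 (k : R) : 0 <= gauss k.
Proof. by apply: Rintegral_ge0 => x _; exact: expR_ge0. Qed.

Let dom : exists k C, [/\ 0 < k, 0 <= C &
  forall t x, I t -> - C <= M t x /\ expR (- M t x) <= expR C * expR (- (k * dotv x x))].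
Proof.
have [k [C [k0 C0 h]]] := envelope_lb L0 tb0 dU lv hd.
exists k, C; split=> // t x It; have := h t x It => h1; split.
  by apply: le_trans h1; rewrite lerBrDr addNr mulr_ge0 ?dotv_ge0// ltW.
by rewrite -expRD ler_expR; move: h1; move: (M t x) (k * _) => y z; lra.
Qed.

Let cE t : I t -> continuous (fun x => expR (- M t x)).
Proof.
move=> It x; apply: continuous_comp; last exact: continuous_expR.
by apply: continuousN; exact: cM.
Qed.

(** Uniform bounds: below, the envelope is at most [U], so the mass of [expR (- U)] on a fixed box
    serves; above, [dom] provides a Gaussian. *)
Let Z_facts : exists z0 z1, 0 < z0 /\ forall t, I t ->
  [/\ mu.-integrable setT (EFin \o (fun x => expR (- M t x))), z0 <= Z t & Z t <= z1].
Proof.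
have [k [C [k0 C0 hdom]]] := dom.
have cEU : continuous (fun x => expR (- U x)).
  by move=> x; apply: continuous_comp; [apply: continuousN; exact: cU|exact: continuous_expR].
exists (\int[mu]_(x in box 1) expR (- U x)), (expR C * gauss k).
have bU := bmfun_box 1 cEU.
split.
  have [e e0 he] := box_gt0_lb (ltr01 : 0 < 1 :> R) cEU (fun x => expR_gt0 _).
  apply: (@lt_le_trans _ _ (\int[mu]_(x in @box R d 1) e)).
    by rewrite Rintegral_cst// fine_box// mulr_gt0// exprn_gt0// mulr_gt0.
  by apply: le_Rintegral_bm => //; exact: bmfun_cst.
move=> t It.
have hb x : `|expR (- M t x)| <= expR C * expR (- (k * dotv x x)).
  by rewrite ger0_norm ?expR_ge0//; exact: (hdom t x It).2.
have [iM bM] := gaussian_dominated k0 (cE It) hb.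
split => //; last by apply: le_trans (ler_norm _) bM.
rewrite -[X in Rintegral _ X _ <= _]setTI Rintegral_mkcondr; apply: le_Rintegral => //.
- rewrite -restrict_EFin; apply/integrable_restrict => //; rewrite setTI.
  by apply: bmfun_integrable bU.
- move=> x _; rewrite patchE; case: ifPn => _; last exact: expR_ge0.
  by rewrite ler_expR lerN2; exact: M_le_U.
Qed.

Let H t x := enorm (u t x) ^+ 2 / 2.

Let H0 t x : 0 <= H t x. Proof. by rewrite divr_ge0// sqr_ge0. Qed.

Let HG t x : I t -> H t x <= G / 2 * q x.
Proof. by move=> It; rewrite mulrAC ler_wpM2r//; exact: u_sqr_le. Qed.

Let cH t : I t -> continuous (H t).
Proof.
move=> It; apply: continuous_mulr; last exact: cst_continuous.
have cu : continuous (fun x => enorm (u t x)).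
  move=> x; apply: (@continuous_comp _ _ _ (u t) enorm); last exact: continuous_enorm.
  by apply: (@lipschitz_continuous_rV _ _ _ L'); exact: prox_grad_lipschitz.
by under eq_fun do rewrite expr2; exact: continuous_mulr.
Qed.

Let D t := \int[mu]_x (H t x * expR (- M t x)).

Let K1 := (L / 2 + L') * G.
(** Lipschitz constant of the envelope in time, relative to [q x]: the first-order term plus the
    quadratic remainder, in which one factor [|s - t|] is bounded by [tb]. *)
Let K3 := G / 2 + K1 * tb.

Let K10 : 0 <= K1.
Proof. by rewrite mulr_ge0// addr_ge0 ?(ltW L'0)// divr_ge0// ltW. Qed.

Let M_time s t x : I s -> I t ->
  `|M s x - M t x + (s - t) * H t x| <= K1 * q x * (s - t) ^+ 2.
Proof.
move=> Is It; have := envelope_time L0 tb0 Ltb dU lv x Is It.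
have -> : (s - t) / 2 * enorm (u t x) ^+ 2 = (s - t) * H t x by rewrite /H mulrAC mulrA.
move=> h; apply: le_trans h _; rewrite ler_wpM2r ?sqr_ge0// /K1 -[leRHS]mulrA.
rewrite ler_wpM2l; [by []| |exact: v_sqr_le].
by rewrite addr_ge0 ?(ltW L'0)// divr_ge0// ltW.
Qed.

Let dist_I s t : I s -> I t -> `|s - t| <= tb.
Proof.
rewrite /I/= => /andP[s0 s1] /andP[t0 t1]; rewrite ler_norml; apply/andP; split; lra.
Qed.

Let M_lip s t x : I s -> I t -> `|M s x - M t x| <= `|s - t| * (K3 * q x).
Proof.
move=> Is It; have h1 := M_time x Is It; have h2 := HG x It.
have -> : M s x - M t x = (M s x - M t x + (s - t) * H t x) - (s - t) * H t x.
  by rewrite addrK.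
apply: le_trans (ler_normB _ _) _; rewrite normrM (ger0_norm (H0 t x)).
rewrite /K3 [(_ + _) * q x]mulrDl mulrDr addrC; apply: lerD.
  by rewrite ler_wpM2l.
apply: le_trans h1 _; rewrite -[(s - t) ^+ 2]real_normK ?num_real//.
have -> : K1 * q x * `|s - t| ^+ 2 = `|s - t| * (K1 * q x * `|s - t|) by ring.
rewrite ler_wpM2l// [leRHS]mulrAC ler_wpM2l//; first exact: mulr_ge0.
exact: dist_I.
Qed.

(** Differentiation under the integral in quantitative form. The pointwise remainder is at most a
    constant times [q^2] and a Gaussian; half of the Gaussian absorbs [q^2]. *)
Let Z_time : exists B E, [/\ 0 <= B, 0 <= E & forall s t, I s -> I t ->
  `|Z s - Z t - (s - t) * D t| <= B * (s - t) ^+ 2 /\ `|D t| <= E].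
Proof.
have [k [C [k0 C0 hdom]]] := dom.
have k20 : 0 < k / 2 by rewrite divr_gt0.
pose P := (1 + 4 / k) ^+ 2; pose g (x : 'rV[R]_d) := expR C * expR (- (k * dotv x x)).
have P0 : 0 <= P by exact: sqr_ge0.
have g0 x : 0 <= g x by rewrite mulr_ge0 ?expR_ge0.
have qg x : q x ^+ 2 * g x <= expR C * P * expR (- (k / 2 * dotv x x)).
  rewrite /g mulrCA -[leRHS]mulrA ler_pM2l ?expR_gt0//.
  by apply: one_add_sqr_gaussian => //; exact: dotv_ge0.
have qq x : q x <= q x ^+ 2 by rewrite expr2 ler_peMr.
exists ((2 * K3 ^+ 2 + K1) * (expR C * P) * gauss (k / 2)), (G / 2 * (expR C * P) * gauss (k / 2)).
have K0 : 0 <= 2 * K3 ^+ 2 + K1 by rewrite addr_ge0// mulr_ge0// sqr_ge0.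
have eP : 0 <= expR C * P by rewrite mulr_ge0// expR_ge0.
have G20 : 0 <= G / 2 by rewrite divr_ge0.
split; [exact: mulr_ge0 (mulr_ge0 K0 eP) _|exact: mulr_ge0 (mulr_ge0 G20 eP) _|].
move=> s t Is It.
have cHE : continuous (fun x => H t x * expR (- M t x)).
  by apply: continuous_mulr; [exact: cH|exact: cE].
have hD x : `|H t x * expR (- M t x)| <= G / 2 * (expR C * P) * expR (- (k / 2 * dotv x x)).
  rewrite ger0_norm; last exact: mulr_ge0 (H0 _ _) (expR_ge0 _).
  apply: (@le_trans _ _ (G / 2 * q x * g x)).
    by apply: ler_pM; [exact: H0|exact: expR_ge0|exact: HG|exact: (hdom t x It).2].
  rewrite -[leLHS]mulrA -[leRHS]mulrA ler_wpM2l//; apply: le_trans (qg x).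
  by rewrite ler_wpM2r.
have [iD bD] := gaussian_dominated k20 cHE hD.
split; last exact: bD.
have ch : continuous (fun x => expR (- M s x) - expR (- M t x) -
    (s - t) * (H t x * expR (- M t x))).
  have cN (f : 'rV[R]_d -> R) : continuous f -> continuous (fun x => - f x).
    by move=> cf x; apply: continuousN; exact: cf.
  apply: continuous_addr.
    by apply: continuous_addr; [exact: cE|apply: cN; exact: cE].
  by apply: cN; apply: continuous_mulr => //; exact: cst_continuous.
have hb x : `|expR (- M s x) - expR (- M t x) - (s - t) * (H t x * expR (- M t x))| <=
    (2 * K3 ^+ 2 + K1) * (expR C * P) * (s - t) ^+ 2 * expR (- (k / 2 * dotv x x)).
  have h := time_weight_arith (H0 t x) (q0 x) (g0 x) (hdom t x It).2 (hdom s x Is).2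
    (q1 x) K10 (M_lip x Is It) (M_time x Is It).
  apply: le_trans h _; rewrite [leRHS]mulrAC ler_wpM2r ?sqr_ge0//.
  by rewrite -[leRHS]mulrA ler_wpM2l.
have [_ bb] := gaussian_dominated k20 ch hb.
have [z0 [z1 [_ hZ]]] := Z_facts.
have [is_ _ _] := hZ s Is; have [it _ _] := hZ t It.
have E : \int[mu]_x (expR (- M s x) - expR (- M t x) -
    (s - t) * (H t x * expR (- M t x))) = Z s - Z t - (s - t) * D t.
  have iB : mu.-integrable setT (EFin \o (fun x => expR (- M s x) - expR (- M t x))).
    by have := integrableB measurableT is_ it; apply: eq_integrable => // x _.
  have iZ : mu.-integrable setT (EFin \o (fun x => (s - t) * (H t x * expR (- M t x)))).
    by have := integrableZl measurableT (s - t) iD; apply: eq_integrable => // x _.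
  by rewrite (RintegralB measurableT iB iZ) (RintegralB measurableT is_ it) (RintegralZl _ measurableT iD).
by rewrite -E; apply: le_trans bb _; rewrite mulrAC.
Qed.

Let p t x := expR (- M t x) / Z t.

Let potentialE t x : I t -> - ln (p t x) = M t x + ln (Z t).
Proof.
move=> It; have [z0 [z1 [z00 /(_ t It)[_ Zt _]]]] := Z_facts.
have Zt0 : 0 < Z t by exact: lt_le_trans Zt.
by rewrite /p ln_div ?posrE ?expR_gt0// expRK; ring.
Qed.

Lemma moreau_path_envelope t x : I t -> moreau_path U t x = p t x.
Proof.
move=> It; rewrite /moreau_path (moreauE L0 tb0 Ltb dU lv x It); congr (_ / _).
by apply: eq_Rintegral => y _; rewrite (moreauE L0 tb0 Ltb dU lv y It).
Qed.

Let potential_pathE t x : I t -> potential (moreau_path U) t x = M t x + ln (Z t).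
Proof. by move=> It; rewrite /potential moreau_path_envelope// potentialE. Qed.

Let p_density t : I t -> is_density (p t).
Proof.
move=> It; have [z0 [z1 [z00 /(_ t It)[iM Zt _]]]] := Z_facts.
have Zt0 : 0 < Z t by exact: lt_le_trans Zt.
split.
- apply: continuous_measurable_rV; apply: continuous_mulr; first exact: cE.
  exact: cst_continuous.
- by move=> x; rewrite divr_ge0 ?expR_ge0// ltW.
- have E0 : (\int[mu]_x (p t x)%:E = ((Z t)^-1)%:E * \int[mu]_x (expR (- M t x))%:E)%E.
    rewrite -(integralZl measurableT iM); apply: eq_integral => x _.
    by rewrite -EFinM /p mulrC.
  have fE : (\int[mu]_x (expR (- M t x))%:E = (Z t)%:E)%E.
    by rewrite -(fineK (integrable_fin_num measurableT iM)).
  rewrite E0 fE -EFinM mulVf; first by [].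
  exact: lt0r_neq0.
Qed.

Let potential_expansion t : I t -> forall x h,
  `|potential (moreau_path U) t (x + h) - potential (moreau_path U) t x -
    dotv (u t x) h| <= (L / 2 + L') * enorm h ^+ 2.
Proof.
move=> It x h; rewrite !potential_pathE//.
exact: shift_arith (envelope_expansion L0 tb0 Ltb dU lv x h It).
Qed.

Theorem moreau_path_assumption : path_assumption I (moreau_path U).
Proof.
have [z0 [z1 [z00 hZ]]] := Z_facts.
have [B [E [B0 E0 hB]]] := Z_time.
have [k [C [k0 C0 hdom]]] := dom.
have [a' [a'0 ha']] := prox_grad_dissipative L0 tb0 Ltb lv hd.
have [a0 b0 r0 _] := hd.
have Z0 t : I t -> 0 < Z t by move=> /hZ[_ + _]; exact: lt_le_trans.
split.
- split=> //.
  + move=> x y; rewrite /I/= => /andP[x0 x1] /andP[y0 y1] z /andP[xz zy].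
    by rewrite (le_trans x0 xz) (le_trans zy y1).
  + by move=> t /andP[].
- move=> t It; have E' : moreau_path U t = p t by apply/funext => x; exact: moreau_path_envelope.
  rewrite E'; split; first exact: p_density.
  by move=> x; rewrite divr_gt0 ?expR_gt0// Z0.
(* The potential is the envelope, with time derivative [- H], plus [ln Z]; the derivative of [Z] is
   [D]. *)
- exists (fun t x => D t / Z t - H t x).
    move=> t x It.
    apply: (@is_derive_within_quadratic _ _ _ _ _
      (K1 * q x + (E + B * tb) ^+ 2 / z0 ^+ 2 + B / z0)) => // s Is.
    rewrite !potential_pathE//.
    have [hZt hD] := hB s t Is It; have [_ zt _] := hZ t It; have [_ zs _] := hZ s Is.
    have ZL : `|Z s - Z t| <= (E + B * tb) * `|s - t|.
      rewrite -[Z s - Z t](subrK ((s - t) * D t)).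
      apply: le_trans (ler_normD _ _) _; rewrite [leRHS]mulrDl addrC; apply: lerD.
        by rewrite normrM mulrC; apply: ler_wpM2r hD; exact: normr_ge0.
      apply: le_trans hZt _; rewrite -[(s - t) ^+ 2]real_normK ?num_real// expr2 mulrA.
      apply: ler_wpM2r; first exact: normr_ge0.
      by apply: ler_wpM2l => //; exact: dist_I.
    exact: potential_time_arith z00 zt zs (addr_ge0 E0 (mulr_ge0 B0 (ltW tb0)))
      (M_time x Is It) hZt ZL.
  exists (E / z0 + G / 2 + 1).
    by rewrite ltr_wpDl// addr_ge0// divr_ge0// ltW.
  move=> t x It; rewrite -enormE [dotv x x + 1]addrC -/(q x).
  have [_ hD] := hB t t It It; have [_ zt _] := hZ t It.
  apply: le_trans (ler_normB _ _) _.
  rewrite !mulrDl -addrA; apply: lerD.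
    rewrite normrM normfV (gtr0_norm (Z0 t It)).
    apply: (@le_trans _ _ (E / z0)); last first.
      by rewrite ler_peMr// divr_ge0// ltW.
    apply: ler_pM => //; first by rewrite invr_ge0 ltW// Z0.
    by rewrite lef_pV2 ?posrE// Z0.
  rewrite ger0_norm//; apply: le_trans (HG x It) _.
  by rewrite lerDl mul1r.
(* All constants are independent of time, so the uniform bounds are immediate; halving [a'] pays for
   the indicator of a ball. *)
- exists (fun=> L'), (fun=> a' / 2), (fun=> b), (fun=> 1 + 2 * b / a') => /=.
  have gE t : I t -> grad (potential (moreau_path U) t) = u t.
    move=> It; apply/funext => x.
    exact: (grad_of_expansion (potential_expansion It)).
  split.
  + move=> t It; split.
      by move=> x; exact: (differentiable_of_expansion (potential_expansion It)).
    by rewrite gE//; exact: prox_grad_lipschitz.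
  + move=> t [It _]; rewrite gE//; split => //; [by rewrite divr_gt0| |].
      by rewrite ltr_pwDl// divr_ge0// ?mulr_ge0// ltW.
    move=> x; apply: le_trans (ha' t x It).
    rewrite indicE (_ : (x \in _) = (enorm x < 1 + 2 * b / a')).
      exact: dissipative_indicator_arith (enorm_ge0 x).
    by apply/idP/idP; rewrite inE.
  + split.
    * by exists L' => _ [t _ <-].
    * by exists (a' / 2); [rewrite divr_gt0|move=> _ [t _ <-]].
    * by exists b => _ [t _ <-].
    * by exists (1 + 2 * b / a') => _ [t _ <-].
- have [AU AU0 hAU] := U_ub.
  (* One [A] for all growth bounds: [C] and [AU] for the envelope, the two logarithms for the
     normalisation, [G] for the gradient. *)
  have [C1' C1'0 hC] := @lsi_of_potential R d a' b
    (C + AU + `|ln z0| + `|ln z1| + G + 1) a'0 b0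
    (potential_bound_gt0 C0 AU0 (normr_ge0 _) (normr_ge0 _) G0).
  have lZ t : I t -> - `|ln z0| <= ln (Z t) /\ ln (Z t) <= `|ln z1|.
    move=> It; have [_ zt zt'] := hZ t It; have Zt0 := Z0 t It; split.
      apply: (@le_trans _ _ (ln z0)); first by rewrite lerNl -normrN ler_norm.
      by rewrite ler_ln ?posrE.
    apply: le_trans (ler_norm _).
    by rewrite ler_ln ?posrE//; exact: lt_le_trans zt'.
  have hlsi t nu : I t -> has_density nu (p t) -> lsi_with nu C1'.
    move=> It hnu.
    have [CV pV] := C1_of_expansion (potential_expansion It)
      (ex_intro _ L' (prox_grad_lipschitz L0 tb0 Ltb lv It)).
    have [l0 l1] := lZ t It.
    apply: (hC (potential (moreau_path U) t)) => //.
    - move=> x; rewrite potential_pathE//.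
      exact: potential_lb_arith AU0 (normr_ge0 _) G0 (hdom t x It).1 l0.
    - move=> x; rewrite potential_pathE//.
      exact: potential_ub_arith C0 (normr_ge0 _) G0 (q1 x) (normr_ge0 _)
        (le_trans (M_le_U x It) (hAU x)) l1.
    - move=> j x; rewrite pV.
      apply: le_trans (coord_le_enorm _ _) _; apply: le_trans (u_le x It) _.
      exact: gradient_ub_arith C0 AU0 (normr_ge0 _) (normr_ge0 _) (q0 x).
    - move=> x; rewrite enormE; apply: le_trans (ha' t x It) _.
      by rewrite le_eqVlt; apply/orP; left; apply/eqP; apply: eq_bigr => j _; rewrite pV.
    - rewrite (_ : (fun x => _) = p t)//; apply/funext => x.
      by rewrite -moreau_path_envelope// /potential opprK lnK// posrE
        moreau_path_envelope// divr_gt0 ?expR_gt0// Z0.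
  have [pi hpi] : exists pi : R -> probability 'rV[R]_d R,
      forall t, I t -> has_density (pi t) (p t).
    have [nu0 _] := has_density_measure (p_density I0).
    (* [choice] needs a measure at every real [t]; outside the interval the one at time 0 serves. *)
    have h t : exists nu : probability 'rV[R]_d R, I t -> has_density nu (p t).
      have [It|nIt] := pselect (I t); last by exists nu0.
      by have [nu hnu] := has_density_measure (p_density It); exists nu.
    by have [pi hpi] := choice h; exists pi.
  exists pi; split.
  + move=> t It; rewrite (_ : moreau_path U t = p t); first exact: hpi.
    by apply/funext => x; exact: moreau_path_envelope.
  + by move=> t It; exists C1'; split=> //; exact: hlsi (hpi t It).
  (* The admissible constants are bounded below by 0, so their infimum is at most the common
     constant [C1']. *)
  + exists C1' => _ [t It <-]; apply: ge_inf; last by split=> //; exact: hlsi (hpi t It).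
    by exists 0 => c [/ltW].
Qed.

End moreau_path_assumption.

Unset Implicit Arguments.

Theorem proposition4p13 (R : realType) (d : nat) (d_gt0 : (0 < d)%N)
    (p U : 'rV[R]_d -> R) (alpha L : R)
    (alpha_gt0 : 0 < alpha) (L_gt0 : 0 < L)
    (p_density : is_density p)
    (p_propto : exists2 c : R, 0 < c & forall x, p x = c * expR (- U x))
    (U_wconvex : weakly_convex alpha U)
    (U_diff : forall x, differentiable U x)
    (gradU_lip : lipschitz_with L (grad U))
    (gradU_diss : dissipative (grad U))
    (U_convex_out : convex_outside_ball U)
    (taubar : R) (taubar_gt0 : 0 < taubar)
    (taubar_lt : taubar < Num.min alpha^-1 L^-1) :
  path_assumption [set tau : R | 0 <= tau <= taubar] (moreau_path U).
Proof.
have [a [b [r hd]]] := gradU_diss.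
apply: (moreau_path_assumption L_gt0 taubar_gt0 _ U_diff gradU_lip hd).
move: taubar_lt; rewrite lt_min => /andP[_].
by rewrite -(ltr_pM2l L_gt0) mulfV// gt_eqF.
Qed.
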